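(* Let $\mathcal{I}$ be the instructive tree decomposition class. For each graph property $P$ below there is an $\mathcal{I}$-coherent treelike DP-core $C$ with $P(C,\mathcal{I})=P$ whose bitlength $\beta(k)$, multiplicity $\mu(k)$, state complexity $\nu(k)$ and deterministic state complexity $\delta(k)$ (as functions of $k$ only) satisfy: - Simple: $\beta=O(k^2)$, $\mu=1$, $\nu=2^{O(\beta(k))}$, $\delta=2^{O(\beta(k))}$; - $\mathrm{MaxDeg}_{\ge}(c)$: $\beta=O(k\log c)$, $\mu=1$, $\nu=2^{O(\beta(k))}$, $\delta=2^{O(\beta(k))}$; - $\mathrm{MinDeg}_{\le}(c)$: $\beta=O(k\log c)$, $\mu=1$, $\nu=2^{O(\beta(k))}$, $\delta=2^{O(\beta(k))}$; - $\mathrm{Colorable}(c)$: $\beta=O(k\log c)$, $\mu=2^{O(\beta(k))}$, $\nu=2^{O(\beta(k))}$, $\delta=2^{2^{O(\beta(k))}}$; - Conn: $\beta=O(k\log k)$, $\mu=2^{O(\beta(k))}$, $\nu=2^{O(\beta(k))}$, $\delta=2^{2^{O(\beta(k))}}$; - $\mathrm{VConn}_{\le}(c)$: $\beta=O(\log c+k\log k)$, $\mu=2^{O(\beta(k))}$, $\nu=2^{O(\beta(k))}$, $\delta=2^{2^{O(\beta(k))}}$; - $\mathrm{EConn}_{\le}(c)$: $\beta=O(\log c+k\log k)$, $\mu=2^{O(\beta(k))}$, $\nu=2^{O(\beta(k))}$, $\delta=2^{2^{O(\beta(k))}}$; - Hamiltonian: $\beta=O(k\log k)$, $\mu=2^{O(k)}$,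 $\nu=2^{O(\beta(k))}$, $\delta=2^{2^{O(k)}}$; - $\mathrm{NZFlow}(\mathbb{Z}_m)$: $\beta=O(k\log m)$, $\mu=2^{O(\beta(k))}$, $\nu=2^{O(\beta(k))}$, $\delta=2^{2^{O(\beta(k))}}$; - $\mathrm{Minor}(H)$: $\beta=O(k\log k+|V(H)|+|E(H)|)$, $\mu=2^{\beta(k)}$, $\nu=2^{O(\beta(k))}$, $\delta=2^{2^{O(\beta(k))}}$.
   Context: A graph is $G=(V,E,I)$ with $V,E$ finite subsets of $\mathbb{N}$, $I\subseteq E\times V$, each edge having two distinct endpoints (multi-edges allowed); $\simeq$ isomorphism. Properties: Simple = graphs without multi-edges; $\mathrm{MaxDeg}_{\ge}(c)$ = graphs with a vertex of degree $\ge c$; $\mathrm{MinDeg}_{\le}(c)$ = graphs with a vertex of degree $\le c$; $\mathrm{Colorable}(c)$ = graphs of chromatic number $\le c$; Conn = connected graphs; $\mathrm{VConn}_{\le}(c)$ = graphs of vertex-connectivity $\le c$; $\mathrm{EConn}_{\le}(c)$ = graphs of edge-connectivity $\le c$; Hamiltonian = graphs with a cycle through all vertices; $\mathrm{NZFlow}(\mathbb{Z}_m)$ = graphs admitting an orientation and a map $\phi:E\to\mathbb{Z}_m\setminus\{0\}$ such that at each vertex the sum of $\phi$ over incoming edges equals the sum over outgoing edges; $\mathrm{Minor}(H)$ = graphs containing $H$ as a minor. Instructive tree decompositions: $\Sigma_k$ consists of $\mathrm{Leaf}$ (arity 0), $\mathrm{IntroVertex}_u$, $\mathrm{ForgetVertex}_u$,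 $\mathrm{IntroEdge}_{u,v}$ (arity 1), $\mathrm{Join}$ (arity 2), $u\ne v\in[k+1]$. $L_k$ = terms accepted by the automaton with states $B\subseteq[k+1]$ (all final), transitions $\mathrm{Leaf}\to\emptyset$, $\mathrm{IntroVertex}_u(B)\to B\cup\{u\}$ ($u\notin B$), $\mathrm{ForgetVertex}_u(B)\to B\setminus\{u\}$ ($u\in B$), $\mathrm{IntroEdge}_{u,v}(B)\to B$ ($u,v\in B$), $\mathrm{Join}(B,B)\to B$. Graph $G(\tau)$: $\mathrm{Leaf}$ = empty graph; $\mathrm{IntroVertex}_u$ adds a new vertex labelled $u$; $\mathrm{ForgetVertex}_u$ removes label $u$; $\mathrm{IntroEdge}_{u,v}$ adds a new edge between vertices labelled $u,v$; $\mathrm{Join}$ glues two graphs identifying equally labelled active vertices. $\mathcal{I}=\{(\Sigma_k,L_k,G|_{L_k})\}_k$. Treelike DP-core $C[k]=(\Sigma_k,W_k,F_k,T_k,\mathrm{Clean}_k,\mathrm{Inv}_k)$: $W_k\subseteq\{0,1\}^*$ decidable; $F_k:W_k\to\{0,1\}$ (final witnesses); finite $\hat a\subseteq W_k$ for arity 0, $\hat a:W_k^p\to$ finite subsets of $W_k$ for arity $p\ge1$; $\mathrm{Clean}_k$, $\mathrm{Inv}_k$ on finite subsets. $\hat a(S_1,\dots,S_p)=\mathrm{Clean}_k(\bigcup_{w_i\in S_i}\hat a(w_1,\dots,w_p))$; $\mathrm{Dyn}_k(\mathrm{Leaf})=\widehat{\mathrm{Leaf}}$, $\mathrm{Dyn}_k(a(\tau_1,\dots))=\hat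 a(\mathrm{Dyn}_k(\tau_1),\dots)$; $\tau$ accepted if $\mathrm{Dyn}_k(\tau)$ has a final witness. $P(C,\mathcal{I})$ = isomorphism closure of $\{G(\tau):\tau\in L_k$ accepted by $C[k]$, some $k\}$. $\mathcal{I}$-coherent: for $\tau\in L_k,\tau'\in L_{k'}$ with $G(\tau)\simeq G(\tau')$, acceptance by $C[k]$, $C[k']$ agree and $\mathrm{Inv}_k(\mathrm{Dyn}_k(\tau))=\mathrm{Inv}_{k'}(\mathrm{Dyn}_{k'}(\tau'))$. Measures: $S$ is useful if $S=\mathrm{Dyn}_k(\tau)$ for some term $\tau$ over $\Sigma_k$ (of size at most $n$); $\beta$ = max bit-length of a witness in a useful set, $\mu$ = max size of a useful set, $\nu$ = number of useful witnesses, $\delta$ = number of useful sets; here these are bounded independently of $n$. *)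

(* Defs.v *)
From HB Require Import structures.
From mathcomp Require Import all_boot finmap.

Set Implicit Arguments.
Unset Strict Implicit.
Unset Printing Implicit Defensive.

Local Open Scope fset_scope.
Local Open Scope nat_scope.

(** * Multigraphs on finite sets of natural numbers *)

Record mgraph := MGraph {
  vset : {fset nat};
  eset : {fset nat};
  inc : {fset nat * nat} (* pairs (edge, vertex) *)
}.

Definition endpoints (G : mgraph) (e : nat) : {fset nat} :=
  [fset v in vset G | (e, v) \in inc G].

Definition is_graph (G : mgraph) : Prop :=
  inc G `<=` eset G `*` vset G /\ {in eset G, forall e, #|` endpoints G e| = 2}.

Definition isomorphic (G H : mgraph) : Prop :=
  exists f g : nat -> nat,
    [/\ {in vset G &, injective f}, f @` vset G = vset H,
        {in eset G &, injective g}, g @` eset G = eset H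
      & {in eset G & vset G, forall e v,
           ((g e, f v) \in inc H) = ((e, v) \in inc G)}].

Definition del_vertices (G : mgraph) (X : {fset nat}) : mgraph :=
  let E := [fset e in eset G | [disjoint endpoints G e & X]%fset] in
  MGraph (vset G `\` X) E [fset p in inc G | p.1 \in E].

Definition del_edges (G : mgraph) (F : {fset nat}) : mgraph :=
  MGraph (vset G) (eset G `\` F) [fset p in inc G | p.1 \notin F].

Definition induced (G : mgraph) (X : {fset nat}) : mgraph :=
  del_vertices G (vset G `\` X).

Definition degree (G : mgraph) (v : nat) : nat :=
  #|` [fset e in eset G | (e, v) \in inc G]|.

Definition adj (G : mgraph) : rel nat :=
  fun u v => (u != v) && has (fun e => ((e, u) \in inc G) && ((e, v) \in inc G)) (eset G).

(** [is_max P m]: [m] is the maximum of [P], with the convention [max 0 = 0]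
    for the empty set. *)
Definition is_max (P : nat -> Prop) (m : nat) : Prop :=
  forall b, m <= b <-> forall x, P x -> x <= b.

(** * Graph properties *)

Definition simple (G : mgraph) : Prop :=
  {in eset G &, forall e1 e2, endpoints G e1 = endpoints G e2 -> e1 = e2}.

Definition max_deg_ge (c : nat) (G : mgraph) : Prop :=
  exists2 v, v \in vset G & c <= degree G v.

Definition min_deg_le (c : nat) (G : mgraph) : Prop :=
  exists2 v, v \in vset G & degree G v <= c.

Definition has_coloring (c : nat) (G : mgraph) : Prop :=
  exists col : nat -> nat,
    {in vset G, forall v, col v < c} /\
    {in vset G &, forall u v, adj G u v -> col u <> col v}.

Definition chromatic_number (G : mgraph) (x : nat) : Prop :=
  has_coloring x G /\ forall c, has_coloring c G -> x <= c.

Definition colorable (c : nat) (G : mgraph) : Prop :=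
  exists2 x, chromatic_number G x & x <= c.

(** The empty graph is connected. *)
Definition connected (G : mgraph) : Prop :=
  {in vset G &, forall u v, exists2 p, path (adj G) u p & last u p = v}.

Definition vertex_connected (j : nat) (G : mgraph) : Prop :=
  j < #|` vset G| /\
  forall X : {fset nat}, X `<=` vset G -> #|` X| < j -> connected (del_vertices G X).

(** The complete graph on [n > 0] vertices has vertex-connectivity [n - 1]. *)
Definition vertex_connectivity (G : mgraph) : nat -> Prop :=
  is_max (fun j => vertex_connected j G).

Definition vconn_le (c : nat) (G : mgraph) : Prop :=
  exists2 x, vertex_connectivity G x & x <= c.

Definition edge_connected (j : nat) (G : mgraph) : Prop :=
  1 < #|` vset G| /\
  forall F : {fset nat}, F `<=` eset G -> #|` F| < j -> connected (del_edges G F).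

(** Graphs with at most one vertex have edge-connectivity [0]. *)
Definition edge_connectivity (G : mgraph) : nat -> Prop :=
  is_max (fun j => edge_connected j G).

Definition econn_le (c : nat) (G : mgraph) : Prop :=
  exists2 x, edge_connectivity G x & x <= c.

(** Two parallel edges form a cycle of length 2; there are no shorter ones. *)
Definition hamiltonian (G : mgraph) : Prop :=
  exists vs es : seq nat,
    [/\ vs != [::], uniq vs & vs =i vset G] /\
    [/\ uniq es, {subset es <= eset G}, size es = size vs &
        forall i, i < size vs ->
          endpoints G (nth 0 es i) =
            [fset nth 0 vs i; nth 0 vs (i.+1 %% size vs)]].

(** Elements of Z_m are represented by their residues in [0, m), so that the
    modulus [m = 1] is treated like the others (['Z_1] is not the trivial ring). *)
Definition nzflow (m : nat) (G : mgraph) : Prop :=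
  exists src tgt phi : nat -> nat,
    [/\ {in eset G, forall e, endpoints G e = [fset src e; tgt e]},
        {in eset G, forall e, 0 < phi e < m}
      & {in vset G, forall v,
           \sum_(e <- eset G | tgt e == v) phi e =
           \sum_(e <- eset G | src e == v) phi e %[mod m]}].

Definition has_minor (H G : mgraph) : Prop :=
  exists (X : nat -> {fset nat}) (g : nat -> nat),
    [/\ {in vset H, forall x,
           [/\ X x `<=` vset G, X x != fset0 & connected (induced G (X x))]},
        {in vset H &, forall x y, x != y -> [disjoint X x & X y]%fset},
        {in eset H &, injective g},
        {in eset H, forall e, g e \in eset G}
      & {in eset H & vset H, forall e x, (e, x) \in inc H ->
           exists2 v, v \in X x & (g e, v) \in inc G}].

(** * Instructive tree decompositions *)

(** The label set [k+1] is ['I_k.+1]. *)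
Variant unary (k : nat) :=
  | IntroVertex of 'I_k.+1
  | ForgetVertex of 'I_k.+1
  | IntroEdge (u v : 'I_k.+1) of u != v.

Inductive term (k : nat) :=
  | Leaf
  | Un of unary k & term k
  | Join of term k & term k.

Arguments Leaf {k}.

Fixpoint tsize k (t : term k) : nat :=
  match t with
  | Leaf => 1
  | Un _ t1 => (tsize t1).+1
  | Join t1 t2 => (tsize t1 + tsize t2).+1
  end.

Definition step_unary k (a : unary k) (B : {set 'I_k.+1}) : option {set 'I_k.+1} :=
  match a with
  | IntroVertex u => if u \notin B then Some (u |: B)%SET else None
  | ForgetVertex u => if u \in B then Some (B :\ u)%SET else None
  | IntroEdge u v _ => if (u \in B) && (v \in B) then Some B else None
  end.

Fixpoint run k (t : term k) : option {set 'I_k.+1} :=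
  match t with
  | Leaf => Some set0
  | Un a t1 => obind (step_unary a) (run t1)
  | Join t1 t2 =>
      match run t1, run t2 with
      | Some B1, Some B2 => if B1 == B2 then Some B1 else None
      | _, _ => None
      end
  end.

Definition inL k (t : term k) : bool := isSome (run t).

(** A graph together with the vertex carrying each label, if any. *)
Record bgraph (k : nat) := BGraph {
  bg_graph : mgraph;
  bg_label : 'I_k.+1 -> option nat
}.

Definition fresh (A : {fset nat}) : nat := (\max_(x <- A) x).+1.

Definition graph_unary k (a : unary k) (b : bgraph k) : bgraph k :=
  let: BGraph G th := b in
  match a with
  | IntroVertex u =>
      let n := fresh (vset G) in
      BGraph (MGraph (n |` vset G) (eset G) (inc G))
             (fun w => if w == u then Some n else th w)
  | ForgetVertex u => BGraph G (fun w => if w == u then None else th w)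
  | IntroEdge u v _ =>
      match th u, th v with
      | Some x, Some y =>
          let e := fresh (eset G) in
          BGraph (MGraph (vset G) (e |` eset G) ([fset (e, x); (e, y)] `|` inc G)) th
      | _, _ => b (* only outside [inL] *)
      end
  end.

(** Shifting by [fresh] makes the second graph disjoint from the first, except
    for its labelled vertices, which are sent to the vertices of the first graph
    with the same labels. *)
Definition graph_join k (b1 b2 : bgraph k) : bgraph k :=
  let: BGraph G1 th1 := b1 in
  let: BGraph G2 th2 := b2 in
  let rv v :=
    let w := fresh (vset G1) + v in
    if [pick u | th2 u == Some v] is Some u then odflt w (th1 u) else w in
  let re e := fresh (eset G1) + e in
  BGraph (MGraph (vset G1 `|` rv @` vset G2) (eset G1 `|` re @` eset G2)
                 (inc G1 `|` (fun p => (re p.1, rv p.2)) @` inc G2))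
         th1.

Fixpoint bgraph_of k (t : term k) : bgraph k :=
  match t with
  | Leaf => BGraph (MGraph fset0 fset0 fset0) (fun=> None)
  | Un a t1 => graph_unary a (bgraph_of t1)
  | Join t1 t2 => graph_join (bgraph_of t1) (bgraph_of t2)
  end.

Definition graph_of k (t : term k) : mgraph := bg_graph (bgraph_of t).

(** * Decidable sets of bitstrings *)

Definition bits := seq bool.

(** Deterministic one-tape Turing machines; tape symbols are bits or the blank
    [None], and the direction [true] moves the head to the right. *)
Record machine := Machine {
  tm_state : finType;
  tm_start : tm_state;
  tm_accept : pred tm_state;
  tm_delta : tm_state -> option bool -> option (tm_state * option bool * bool)
}.

(** State, tape to the left of the head (nearest cell first), tape from the head
    onwards; all other cells are blank. *)
Definition config (M : machine) : Type :=
  (tm_state M * seq (option bool) * seq (option bool))%type.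

Definition tm_step (M : machine) (c : config M) : option (config M) :=
  let: (q, l, r) := c in
  match tm_delta q (head None r) with
  | None => None
  | Some (q', s, true) => Some (q', s :: l, behead r)
  | Some (q', s, false) => Some (q', behead l, head None l :: s :: behead r)
  end.

Definition tm_run (M : machine) (n : nat) (w : bits) : config M :=
  iter n (fun c => odflt c (tm_step c)) (tm_start M, [::], map Some w).

Definition decidable_set (W : pred bits) : Prop :=
  exists M : machine, forall w : bits, exists n,
    tm_step (tm_run M n w) = None /\ tm_accept (tm_run M n w).1.1 = W w.

(** * Treelike DP-cores *)

Record core (k : nat) := Core {
  witness_set : pred bits;
  witness_set_dec : decidable_set witness_set;
  final : {w : bits | witness_set w} -> bool;
  leaf_hat : {fset {w : bits | witness_set w}};
  unary_hat : unary k -> {w : bits | witness_set w} -> {fset {w : bits | witness_set w}};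
  join_hat : {w : bits | witness_set w} -> {w : bits | witness_set w} ->
             {fset {w : bits | witness_set w}};
  clean : {fset {w : bits | witness_set w}} -> {fset {w : bits | witness_set w}};
  inv : {fset {w : bits | witness_set w}} -> bits
}.

Definition witness k (D : core k) : choiceType := {w : bits | witness_set D w}.

Definition dpcore := forall k, core k.

Fixpoint dyn k (D : core k) (t : term k) : {fset witness D} :=
  match t with
  | Leaf => leaf_hat D
  | Un a t1 => clean (\bigcup_(w <- dyn D t1) unary_hat a w)%fset
  | Join t1 t2 =>
      clean (\bigcup_(w1 <- dyn D t1) \bigcup_(w2 <- dyn D t2) join_hat w1 w2)%fset
  end.

Definition accepts k (D : core k) (t : term k) : bool := has (@final k D) (dyn D t).

Definition graph_property (C : dpcore) (G : mgraph) : Prop :=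
  exists k (t : term k), [/\ inL t, accepts (C k) t & isomorphic (graph_of t) G].

Definition coherent (C : dpcore) : Prop :=
  forall k k' (t : term k) (t' : term k'),
    inL t -> inL t' -> isomorphic (graph_of t) (graph_of t') ->
    accepts (C k) t = accepts (C k') t' /\
    inv (dyn (C k) t) = inv (dyn (C k') t').

(** * Complexity measures *)

Definition useful (C : dpcore) k (n : nat) (S : {fset witness (C k)}) : Prop :=
  exists2 t : term k, tsize t <= n & dyn (C k) t = S.

Definition has_card (T : choiceType) (P : T -> Prop) (n : nat) : Prop :=
  exists2 A : {fset T}, forall x, x \in A <-> P x & #|` A| = n.

Definition bitlength (C : dpcore) (k n : nat) : nat -> Prop :=
  is_max (fun x => exists S w, [/\ @useful C k n S, w \in S & x = size (val w)]).

Definition multiplicity (C : dpcore) (k n : nat) : nat -> Prop :=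
  is_max (fun x => exists2 S, @useful C k n S & x = #|` S|).

Definition state_complexity (C : dpcore) (k n : nat) : nat -> Prop :=
  has_card (fun w : witness (C k) => exists2 S, @useful C k n S & w \in S).

Definition det_state_complexity (C : dpcore) (k n : nat) : nat -> Prop :=
  has_card (fun S : {fset witness (C k)} => @useful C k n S).

(** Each measure is nondecreasing in the size bound [n], so it is bounded
    independently of [n] exactly when it is eventually constant; the constant is
    then its maximum over all [n]. *)
Definition measures (C : dpcore) (beta mu nu delta : nat -> nat) : Prop :=
  forall k, exists n0, forall n, n0 <= n ->
    [/\ bitlength C k n (beta k), multiplicity C k n (mu k),
        state_complexity C k n (nu k) & det_state_complexity C k n (delta k)].

(** [has_core P bd]: some coherent core recognizes [P], with measures
    [beta], [mu], [nu], [delta] satisfying [bd]. *)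
Definition has_core (P : mgraph -> Prop)
    (bd : (nat -> nat) -> (nat -> nat) -> (nat -> nat) -> (nat -> nat) -> Prop) : Prop :=
  exists (C : dpcore) (beta mu nu delta : nat -> nat),
    [/\ coherent C,
        forall G, is_graph G -> (graph_property C G <-> P G),
        measures C beta mu nu delta
      & bd beta mu nu delta].

(** Logarithms under an O-sign are read as at least 1. *)
Definition lg (n : nat) : nat := maxn 1 (trunc_log 2 n).

(** [f = O(g)], [f = 2^O(g)] and [f = 2^(2^O(g))] on [k >= 1], with implied
    constant [A]. *)
Definition bigO (A : nat) (f g : nat -> nat) : Prop :=
  forall k, 0 < k -> f k <= A * g k.

Definition exp_bigO (A : nat) (f g : nat -> nat) : Prop :=
  forall k, 0 < k -> f k <= 2 ^ (A * g k).

Definition exp2_bigO (A : nat) (f g : nat -> nat) : Prop :=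
  forall k, 0 < k -> f k <= 2 ^ (2 ^ (A * g k)).

(* Main.v *)
(* A DP-core may compute with arbitrary sets of bitstrings between two cleanings,
   so any finite deterministic tree automaton recognizing [P] on the accepted terms
   becomes a core once its states are coded by sets of strings: the operations tag
   their arguments, and cleaning decodes the tagged set and re-encodes the new
   state. A singleton code gives multiplicity [1], a code by subsets of the strings
   of a fixed length gives doubly exponentially many states.
   The automaton is the Myhill-Nerode quotient of the terms. The graph of a term in
   a context is, up to isomorphism, the gluing along the active vertices of the
   graph of the term with a graph depending on the context only, so the number of
   classes is bounded by the number of values of any signature of [A] that
   determines whether the gluing of [A] with [B] satisfies [P]. Only gluings thus
   have to be analysed for each property. For Hamiltonicity the signature of [A]
   is, for each degree pattern, the span over F_2 of the vectors counting the cuts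
   of [A] respected by a partial solution: the number of cuts respected by a
   spanning subgraph, with one vertex pinned, is odd iff the subgraph is connected,
   and it is a bilinear pairing of the two vectors. *)
Require Import Defs.
From mathcomp Require Import all_boot finmap all_algebra.
From mathcomp Require Import boolp zify.

Set Implicit Arguments.
Unset Strict Implicit.
Unset Printing Implicit Defensive.

(** * Cores from deterministic automata *)

Section Encoding.
Local Open Scope fset_scope.
Local Open Scope nat_scope.

(** The state of a term is not its signature. A signature is only asked to decide every gluing, not
    to be compositional, so it need not be a congruence for the term operations.
    Indistinguishability in all contexts is one; equal signatures imply it, and the signature of one
    chosen representative per class injects the classes into a finite type. What remains for each
    property is a gluing argument and a cardinality. Connectivity enters the gluing arguments
    through two-colourings constant along edges rather than through paths: a colouring restricts to
    both sides of a gluing, two colourings that agree on the boundary splice, and the trace of one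
    costs only [k + 1] bits. Hamiltonicity has the delicate bound, [2 ^ 2 ^ O(k)] states. Sets of
    pairings of the boundary would give [2 ^ 2 ^ O(k log k)], and sets of cut vectors even more. A
    nonzero value of a linear functional on a set of vectors depends only on their span, and a
    subspace of dimension at most [N = 2 ^ k.+1] is given by [N ^ 2] bits. *)

Definition all_bits : pred bits := fun=> true.

Lemma all_bits_dec : decidable_set all_bits.
Proof.
exists (@Machine unit tt (fun=> true) (fun _ _ => None)) => w.
by exists 0; split.
Qed.

Definition wit := {w : bits | all_bits w}.
Definition to_wit (w : bits) : wit := exist _ w isT.

Lemma to_wit_inj : injective to_wit.
Proof. by move=> u v /(congr1 val). Qed.

Variable k : nat.

Definition unary_code (a : unary k) : nat * (nat * nat) :=
  match a with
  | IntroVertex u => (0, (u : nat, 0))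
  | ForgetVertex u => (1, (u : nat, 0))
  | IntroEdge u v _ => (2, (u : nat, v : nat))
  end.

Lemma unary_code_inj : injective unary_code.
Proof.
case=> [u|u|u v uv] [u'|u'|u' v' uv'] //=.
- by case=> /ord_inj ->.
- by case=> /ord_inj ->.
- by case=> /ord_inj eu /ord_inj ev; subst; congr IntroEdge; apply: bool_irrelevance.
Qed.

(** A unary string numbering the triple makes [tag] injective. Its huge length is harmless: tagged
    sets exist only between an operation and the cleaning that follows, and the measures see only
    the sets [E t]. *)
Definition tag (o : nat * (nat * nat)) (w1 w2 : wit) : wit :=
  to_wit (nseq (choice.pickle (o, (val w1, val w2))) true).

Lemma tag_inj o w1 w2 o' w1' w2' :
  tag o w1 w2 = tag o' w1' w2' -> [/\ o = o', w1 = w1' & w2 = w2'].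
Proof.
move=> /(congr1 (size \o val)) /=; rewrite !size_nseq.
move=> /(pcan_inj choice.pickleK) [-> e1 e2]; split=> //; exact: val_inj.
Qed.

Definition tag_unary (a : unary k) (w : wit) : {fset wit} :=
  [fset tag (unary_code a) w w].
Definition tag_join (w1 w2 : wit) : {fset wit} := [fset tag (3, (0, 0)) w1 w2].

Definition tag_unary_set a (S : {fset wit}) : {fset wit} :=
  (\bigcup_(w <- S) tag_unary a w)%fset.
Definition tag_join_set (S1 S2 : {fset wit}) : {fset wit} :=
  (\bigcup_(w1 <- S1) \bigcup_(w2 <- S2) tag_join w1 w2)%fset.

Lemma tag_unary_setP a S x :
  reflect (exists2 w, w \in S & x = tag (unary_code a) w w) (x \in tag_unary_set a S).
Proof.
apply: (iffP (bigfcupP _ _ _ _)) => [[w /andP[wS _] /fset1P ->]|[w wS ->]].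
  by exists w.
by exists w; rewrite ?wS ?inE.
Qed.

Lemma tag_join_setP S1 S2 x :
  reflect (exists w1 w2, [/\ w1 \in S1, w2 \in S2 & x = tag (3, (0, 0)) w1 w2])
          (x \in tag_join_set S1 S2).
Proof.
apply: (iffP (bigfcupP _ _ _ _)) =>
    [[w1 /andP[w1S _] /bigfcupP[w2 /andP[w2S _] /fset1P ->]]|[w1 [w2 [w1S w2S ->]]]].
  by exists w1, w2.
by exists w1; rewrite ?w1S //; apply/bigfcupP; exists w2; rewrite ?w2S ?inE.
Qed.

(** One tagged element reveals the operation, and all of them together reveal the argument set. An
    empty argument would be tagged to the empty set by every operation, whence the demand that all
    codes be nonempty. *)
Lemma tag_unary_set_inj a a' S S' : S != fset0 ->
  tag_unary_set a S = tag_unary_set a' S' -> a = a' /\ S = S'.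
Proof.
move=> /fset0Pn[w wS] eSS.
have /tag_unary_setP[w' w'S'] : tag (unary_code a) w w \in tag_unary_set a' S'.
  by rewrite -eSS; apply/tag_unary_setP; exists w.
move=> /tag_inj[/unary_code_inj ea _ _]; subst a'; split=> //.
apply/fsetP => x; apply/idP/idP => xS.
  have : tag (unary_code a) x x \in tag_unary_set a S'.
    by rewrite -eSS; apply/tag_unary_setP; exists x.
  by case/tag_unary_setP => y yS /tag_inj[_ -> _].
have : tag (unary_code a) x x \in tag_unary_set a S.
  by rewrite eSS; apply/tag_unary_setP; exists x.
by case/tag_unary_setP => y yS /tag_inj[_ -> _].
Qed.

Lemma tag_unary_join_set a S S1 S2 : S != fset0 ->
  tag_unary_set a S <> tag_join_set S1 S2.
Proof.
move=> /fset0Pn[w wS] eSS.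
have /tag_join_setP[w1 [w2 [_ _ /tag_inj[+ _ _]]]] :
    tag (unary_code a) w w \in tag_join_set S1 S2.
  by rewrite -eSS; apply/tag_unary_setP; exists w.
by case: a {eSS}.
Qed.

(** The tagged pairs form the product of [S1] and [S2], and a product of nonempty sets determines
    its factors. *)
Lemma tag_join_set_inj S1 S2 S1' S2' : S1 != fset0 -> S2 != fset0 ->
  tag_join_set S1 S2 = tag_join_set S1' S2' -> S1 = S1' /\ S2 = S2'.
Proof.
move=> /fset0Pn[w1 w1S] /fset0Pn[w2 w2S] eSS.
have key x y : (x \in S1) && (y \in S2) = (x \in S1') && (y \in S2').
  apply/idP/idP => /andP[xS yS].
    have : tag (3, (0, 0)) x y \in tag_join_set S1' S2'.
      by rewrite -eSS; apply/tag_join_setP; exists x, y.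
    by case/tag_join_setP => x' [y' [? ? /tag_inj[_ -> ->]]]; apply/andP.
  have : tag (3, (0, 0)) x y \in tag_join_set S1 S2.
    by rewrite eSS; apply/tag_join_setP; exists x, y.
  by case/tag_join_setP => x' [y' [? ? /tag_inj[_ -> ->]]]; apply/andP.
have /andP[w1S' w2S'] : (w1 \in S1') && (w2 \in S2') by rewrite -key w1S.
split; apply/fsetP => x.
  by have := key x w2; rewrite w2S w2S' !andbT.
by have := key w1 x; rewrite w1S w1S'.
Qed.

Variables (E : term k -> {fset wit}) (fin : wit -> bool).
Hypothesis E_neq0 : forall t, E t != fset0.
Hypothesis E_un : forall a t t', E t = E t' -> E (Un a t) = E (Un a t').
Hypothesis E_join : forall t1 t1' t2 t2',
  E t1 = E t1' -> E t2 = E t2' -> E (Join t1 t2) = E (Join t1' t2').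

(* The operations only tag their arguments; cleaning recovers from the tagged
   set the operation and its argument sets, and applies the operation to them. *)
Definition decode (S : {fset wit}) : {fset wit} :=
  match pselect (exists p : unary k * term k, S = tag_unary_set p.1 (E p.2)) with
  | left h => let p := projT1 (cid h) in E (Un p.1 p.2)
  | right _ =>
    match pselect (exists p : term k * term k, S = tag_join_set (E p.1) (E p.2)) with
    | left h => let p := projT1 (cid h) in E (Join p.1 p.2)
    | right _ => S
    end
  end.

Lemma decode_un a t : decode (tag_unary_set a (E t)) = E (Un a t).
Proof.
rewrite /decode; case: pselect => [h|[]]; last by exists (a, t).
case: (cid h) => -[a' t'] /= e.
(* The term [t'] returned by choice need not be [t]; it only has the same code, and the congruence
   hypothesis absorbs the difference. *)
have [<- et] := tag_unary_set_inj (E_neq0 t) e.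
by apply/esym/E_un.
Qed.

Lemma decode_join t1 t2 : decode (tag_join_set (E t1) (E t2)) = E (Join t1 t2).
Proof.
rewrite /decode; case: pselect => [[[a' t'] /= e]|_].
  by case: (tag_unary_join_set (E_neq0 t') (esym e)).
case: pselect => [h|[]]; last by exists (t1, t2).
case: (cid h) => -[t1' t2'] /= e.
have [e1 e2] := tag_join_set_inj (E_neq0 t1) (E_neq0 t2) e.
by apply/esym/E_join.
Qed.

(** All bitstrings are witnesses, so decidability is trivial, and the constant invariant settles the
    second half of coherence. *)
Definition encoded_core : core k :=
  Core all_bits_dec fin (E Leaf) tag_unary tag_join decode (fun=> [::]).

Lemma dyn_encoded t : dyn encoded_core t = E t.
Proof.
elim: t => [|a t IH|t1 IH1 t2 IH2] //=.
  by rewrite IH; exact: decode_un.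
by rewrite IH1 IH2; exact: decode_join.
Qed.

End Encoding.

(** * Complexity measures of a core whose states range over a finite type *)

Section Measures.
Local Open Scope fset_scope.
Local Open Scope nat_scope.

Lemma injection_of_card (T U : finType) : #|T| <= #|U| -> exists f : T -> U, injective f.
Proof.
move=> le; exists (fun x => enum_val (widen_ord le (enum_rank x))) => x y.
by move=> /enum_val_inj /(congr1 val) /= /ord_inj /enum_rank_inj.
Qed.

Lemma leq_card_fset (T : finType) (X : {fset T}) : #|` X| <= #|T|.
Proof. by rewrite -(card_uniqP (fset_uniq X)) max_card. Qed.

(** Padding with [false] up to a marker [true] gives exactly [L.+1] bits; the first [true] tells
    where the string begins, so nothing is lost. The default of [insubd] never occurs on [A]. *)
Lemma card_short_strings (A : {fset wit}) L :
  {in A, forall w, size (val w) <= L} -> #|` A| <= 2 ^ L.+1.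
Proof.
move=> sA; pose pad w := nseq (L - size w) false ++ true :: w.
have pad_size w : w \in A -> size (pad (val w)) == L.+1.
  by move=> /sA sw; rewrite size_cat size_nseq /= addnS subnK.
pose f (w : wit) : (L.+1).-tuple bool := insubd [tuple of nseq L.+1 false] (pad (val w)).
have pad_inj u v : pad u = pad v -> u = v.
  rewrite /pad => e.
  have es m w : find id (nseq m false ++ true :: w) = m.
    by rewrite find_cat has_nseq andbF size_nseq /= addn0.
  move/(congr1 (find id)): (e); rewrite !es => em; move: e; rewrite em.
  by move/(congr1 (drop (L - size v).+1)); rewrite !drop_cat size_nseq ltnNge leqnSn /= subSnn /= !drop0.
have f_inj : {in A &, injective f}.
  move=> u v uA vA /(congr1 val); rewrite !val_insubd !pad_size //.
  by move=> /pad_inj; exact: val_inj.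
rewrite -(card_in_imfset imfset_key f_inj) (leq_trans (leq_card_fset _)) //.
by rewrite card_tuple card_bool.
Qed.

Variables (T : nat -> finType) (st : forall k, term k -> T k) (acc : forall k, T k -> bool).
Hypothesis st_un : forall k (a : unary k) t t', st t = st t' -> st (Un a t) = st (Un a t').
Hypothesis st_join : forall k (t1 t1' t2 t2' : term k),
  st t1 = st t1' -> st t2 = st t2' -> st (Join t1 t2) = st (Join t1' t2').

(** All codes have the same maximal length and the same cardinality, so that bitlength and
    multiplicity are known exactly without knowing which states are reached. *)
Variables (code : forall k, T k -> {fset wit}) (fin : nat -> wit -> bool) (L M : nat -> nat).
Hypothesis code_inj : forall k, injective (@code k).
Hypothesis code_fin : forall k q, has (fin k) (@code k q) = acc q.
Hypothesis code_size : forall k q, {in @code k q, forall w, size (val w) <= L k}.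
Hypothesis code_max : forall k q, exists2 w, w \in @code k q & size (val w) = L k.
Hypothesis code_card : forall k q, #|` @code k q| = M k.

Definition state_core : dpcore := fun k => encoded_core (fun t => code (st t)) (fin k).

Lemma dyn_state_core k (t : term k) : dyn (state_core k) t = code (st t).
Proof.
apply: dyn_encoded => [{}t|a t1 t2 /code_inj e|t1 t1' t2 t2' /code_inj e1 /code_inj e2].
- by apply/fset0Pn; have [w wS _] := code_max (st t); exists w.
- by rewrite (st_un _ e).
- by rewrite (st_join e1 e2).
Qed.

Lemma accepts_state_core k (t : term k) : accepts (state_core k) t = acc (st t).
Proof. by rewrite /accepts dyn_state_core -code_fin. Qed.

Definition reached k : {set T k} := [set q | `[< exists t : term k, st t = q >]].
Definition useful_sets k : {fset {fset wit}} := [fset code q | q in reached k].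
Definition useful_wits k : {fset wit} := (\bigcup_(S <- useful_sets k) S)%fset.

(** Only finitely many states are reached; one term chosen for each bounds the size beyond which the
    measures no longer grow. *)
Lemma reached_bound k : exists n0, forall q, q \in reached k ->
  exists2 t : term k, Defs.tsize t <= n0 & st t = q.
Proof.
pose b q := match pselect (exists t : term k, st t = q) with
            | left h => Defs.tsize (projT1 (cid h)) | right _ => 0 end.
exists (\max_q b q) => q; rewrite inE => /asboolP h.
have := leq_bigmax (F := b) q; rewrite /b; case: pselect => // h' le.
by exists (projT1 (cid h')) => //; case: (cid h').
Qed.

Lemma measures_state_core :
  measures state_core L M (fun k => #|` useful_wits k|) (fun k => #|` useful_sets k|).
Proof.
(* The successor ensures [n >= 1], so that [Leaf], of size 1, provides a useful set at which both
   maxima are attained. *)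
move=> k; have [n0 n0P] := reached_bound k; exists n0.+1 => n lt_n.
have usefulE (S : {fset witness (state_core k)}) :
    useful (C := state_core) n S <-> S \in useful_sets k.
  split=> [[t _ <-]|/imfsetP[q /= qr ->]].
    rewrite dyn_state_core; apply/imfsetP; exists (st t) => //=.
    by rewrite inE; apply/asboolP; exists t.
  have [t le <-] := n0P _ qr; exists t; last exact: dyn_state_core.
  exact: leq_trans le (ltnW lt_n).
have useful_leaf : @useful state_core k n (code (st (@Leaf k))).
  by exists Leaf; rewrite ?dyn_state_core //= (leq_ltn_trans _ lt_n).
split.
- move=> b; split=> [le x [S [w [/usefulE/imfsetP[q /= _ ->] wS ->]]]|].
    exact: leq_trans (code_size wS) le.
  apply; have [w wS <-] := code_max (st (@Leaf k)).
  by exists (code (st (@Leaf k))), w; split.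
- move=> b; split=> [le x [S /usefulE/imfsetP[q /= _ ->] ->]|]; first by rewrite code_card.
  by apply; exists (code (st (@Leaf k))); rewrite ?code_card.
- exists (useful_wits k) => // w; split=> [/bigfcupP[S]|[S /usefulE SU wS]].
    by rewrite andbT => SU wS; exists S => //; apply/usefulE.
  by apply/bigfcupP; exists S; rewrite ?SU.
- by exists (useful_sets k) => // S; split=> /usefulE.
Qed.

Lemma leq_useful_wits k : #|` useful_wits k| <= 2 ^ (L k).+1.
Proof.
apply: card_short_strings => w /bigfcupP[S]; rewrite andbT => /imfsetP[q /= _ ->].
exact: code_size.
Qed.

Lemma leq_useful_sets k : #|` useful_sets k| <= #|T k|.
Proof.
apply: leq_trans (leq_imfset_card _ _ _) _.
by rewrite -(card_uniqP (enum_finmem_uniq _)) max_card.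
Qed.

End Measures.

(** * Coding states by single strings or by sets of strings *)

Section Codes.
Local Open Scope fset_scope.
Local Open Scope nat_scope.

Lemma leq_pow2_double n : 0 < n -> 2 ^ n.+1 <= 2 ^ (2 * n).
Proof. by move=> n0; rewrite leq_exp2l // mul2n -addnn -addn1 leq_add2l. Qed.

Variables (T : nat -> finType) (st : forall k, term k -> T k) (acc : forall k, T k -> bool).
Hypothesis st_un : forall k (a : unary k) t t', st t = st t' -> st (Un a t) = st (Un a t').
Hypothesis st_join : forall k (t1 t1' t2 t2' : term k),
  st t1 = st t1' -> st t2 = st t2' -> st (Join t1 t2) = st (Join t1' t2').

(** Finality is a predicate on single witnesses, so the acceptance bit is put in front of the code
    of the state; it accounts for the extra bit of length. *)
Lemma deterministic_core (l : nat -> nat) : (forall k, #|T k| <= 2 ^ l k) ->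
  exists (C : dpcore) (nu delta : nat -> nat),
    [/\ forall k (t : term k), accepts (C k) t = acc (st t),
        forall k (t : term k), Defs.inv (dyn (C k) t) = [::],
        measures C (fun k => (l k).+1) (fun=> 1) nu delta,
        exp_bigO 2 nu (fun k => (l k).+1) & exp_bigO 2 delta (fun k => (l k).+1)].
Proof.
move=> cardT.
have /all_tag[enc enc_inj] k : {f : T k -> (l k).-tuple bool & injective f}.
  by apply: cid; apply: injection_of_card; rewrite card_tuple card_bool.
pose code k (q : T k) := [fset to_wit (acc q :: enc k q)].
pose fin (k : nat) (w : wit) := head false (val w).
have code_inj k : injective (@code k).
  by move=> q q' /fset1_inj /to_wit_inj [_ /val_inj /enc_inj].
have code_fin k (q : T k) : has (fin k) (code k q) = acc q.
  apply/hasP/idP => [[w /fset1P -> //]|aq].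
  by exists (to_wit (acc q :: enc k q)); rewrite ?inE.
have code_size k (q : T k) : {in code k q, forall w, size (val w) <= (l k).+1}.
  by move=> w /fset1P ->; rewrite /= size_tuple.
have code_max k (q : T k) : exists2 w, w \in code k q & size (val w) = (l k).+1.
  by exists (to_wit (acc q :: enc k q)); rewrite ?inE //= size_tuple.
have code_card k (q : T k) : #|` code k q| = 1 by rewrite cardfs1.
exists (state_core st code fin), (fun k => #|` useful_wits st code k|),
  (fun k => #|` useful_sets st code k|); split.
- by move=> k t; rewrite (accepts_state_core (L := fun k => (l k).+1) st_un st_join code_inj code_fin).
- by [].
- exact: (measures_state_core (M := fun=> 1) st_un st_join fin code_inj code_size code_max code_card).
- by move=> k _; apply: leq_trans (leq_useful_wits _ code_size _) (leq_pow2_double _).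
- move=> k _; apply: leq_trans (leq_useful_sets st code k) (leq_trans (cardT k) _).
  by rewrite leq_exp2l // mul2n -addnn addSn -addnS leq_addr.
Qed.

(* Each state is coded by a set of exactly [2 ^ (l + 2)] strings: a function on
   the strings of length [l], followed by filler that is never final. *)
Lemma powerset_core (l : nat -> nat) : (forall k, #|T k| <= 2 ^ 2 ^ l k) ->
  exists (C : dpcore) (nu delta : nat -> nat),
    [/\ forall k (t : term k), accepts (C k) t = acc (st t),
        forall k (t : term k), Defs.inv (dyn (C k) t) = [::],
        measures C (fun k => (l k).+2) (fun k => 2 ^ (l k).+2) nu delta,
        exp_bigO 2 nu (fun k => (l k).+2) & exp2_bigO 1 delta l].
Proof.
move=> cardT.
have /all_tag[enc enc_inj] k : {f : T k -> {set (l k).-tuple bool} & injective f}.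
  apply: cid; apply: injection_of_card; suff -> : #|{set (l k).-tuple bool}| = 2 ^ 2 ^ l k by [].
  by rewrite -cardsT -powersetT card_powerset cardsT card_tuple card_bool.
pose graph_w k (q : T k) (d : (l k).-tuple bool) := to_wit [:: acc q, d \in enc k q & d].
(* The graph of the characteristic function, unlike the subset itself, has the same size [2 ^ l] for
   all states. The fillers of lengths [l + 1] and [l] raise it to [2 ^ (l + 2)], so the multiplicity
   is exactly [2 ^ beta], as the bound for minors demands. *)
pose filler n : {fset wit} := [fset to_wit (val (d : n.-tuple bool)) | d in {: n.-tuple bool}].
pose code k (q : T k) := [fset graph_w k q d | d in {: (l k).-tuple bool}] `|`
  (filler (l k).+1 `|` filler (l k)).
(* Only strings of the graph part have full length; their first bit is the acceptance bit. *)
pose fin k (w : wit) := (size (val w) == (l k).+2) && head false (val w).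
have size_filler n w : w \in filler n -> size (val w) = n.
  by case/imfsetP => d _ ->; rewrite /= size_tuple.
have card_filler n : #|` filler n| = 2 ^ n.
  rewrite card_imfset; last by move=> d d' /to_wit_inj /val_inj.
  by rewrite -(card_uniqP (enum_finmem_uniq _)) -[in RHS]card_bool -card_tuple; apply: eq_card => d; rewrite enum_finmemE.
have size_graph k (q : T k) w :
    w \in [fset graph_w k q d | d in {: (l k).-tuple bool}] -> size (val w) = (l k).+2.
  by case/imfsetP => d _ ->; rewrite /= size_tuple.
have mem_graph k (q : T k) d : graph_w k q d \in code k q.
  by rewrite inE; apply/orP; left; apply/imfsetP; exists d.
have codeP k (q : T k) w : w \in code k q -> size (val w) = (l k).+2 ->
    exists d, w = graph_w k q d.
  rewrite 2!inE => /orP[/imfsetP[d _ ->] _|]; first by exists d.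
  by case/orP => /size_filler -> ?; lia.
have code_inj k : injective (@code k).
  move=> q q' e; apply: enc_inj; apply/setP => d.
  have [] := codeP k q' (graph_w k q d); first by rewrite -e.
    by rewrite /= size_tuple.
  by move=> d' /(congr1 val)[_ -> /val_inj ->].
have code_fin k (q : T k) : has (fin k) (code k q) = acc q.
  apply/hasP/idP => [[w wc /andP[/eqP sw]]|aq].
    by have [d ->] := codeP k q w wc sw.
  exists (graph_w k q [tuple of nseq (l k) false]) => //.
  by rewrite /fin /= size_tuple eqxx.
have code_size k (q : T k) : {in code k q, forall w, size (val w) <= (l k).+2}.
  move=> w; rewrite 2!inE => /or3P[/size_graph ->|/size_filler ->|/size_filler ->] //.
  by rewrite ltnW.
have code_max k (q : T k) : exists2 w, w \in code k q & size (val w) = (l k).+2.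
  exists (graph_w k q [tuple of nseq (l k) false]) => //.
  by rewrite /= size_tuple.
have code_card k (q : T k) : #|` code k q| = 2 ^ (l k).+2.
  rewrite cardfsU cardfsU !card_filler disjoint_fsetI0 ?disjoint_fsetI0 ?cardfs0 ?subn0.
  - rewrite card_imfset; last by move=> d d' /to_wit_inj [_ /val_inj].
    have -> : size (enum_finmem (mem {: (l k).-tuple bool})) = 2 ^ l k.
      by rewrite -(card_uniqP (enum_finmem_uniq _)) -[in RHS]card_bool -card_tuple; apply: eq_card => d; rewrite enum_finmemE.
    by rewrite !expnS !mul2n -!addnn; lia.
  - by apply/fdisjointP => w /size_graph e; apply/negP; rewrite inE => /orP[] /size_filler; lia.
  - by apply/fdisjointP => w /size_filler e; apply/negP => /size_filler; lia.
exists (state_core st code fin), (fun k => #|` useful_wits st code k|),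
  (fun k => #|` useful_sets st code k|); split.
- by move=> k t; rewrite (accepts_state_core (L := fun k => (l k).+2) st_un st_join code_inj code_fin).
- by [].
- exact: (measures_state_core (M := fun k => 2 ^ (l k).+2) st_un st_join fin code_inj
           code_size code_max code_card).
- by move=> k _; apply: leq_trans (leq_useful_wits _ code_size _) (leq_pow2_double _).
- move=> k _; apply: leq_trans (leq_useful_sets st code k) (leq_trans (cardT k) _).
  by rewrite mul1n.
Qed.

End Codes.

(** * Gluing and renaming graphs *)

Section Graphs.
Local Open Scope fset_scope.
Local Open Scope nat_scope.

Lemma fresh_gt (A : {fset nat}) x : x \in A -> x < fresh A.
Proof. by move=> xA; rewrite ltnS; exact: (@leq_bigmax_seq _ _ xpredT id). Qed.

Lemma fresh_notin (A : {fset nat}) n : fresh A + n \notin A.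
Proof. by apply/negP => /fresh_gt; rewrite ltnNge leq_addr. Qed.

Lemma fresh_notin0 (A : {fset nat}) : fresh A \notin A.
Proof. by rewrite -[fresh A]addn0 fresh_notin. Qed.

Lemma endpointsP G e v : reflect (v \in vset G /\ (e, v) \in inc G) (v \in endpoints G e).
Proof. by rewrite !inE; exact: andP. Qed.

Lemma is_graph_inc G e v : is_graph G -> (e, v) \in inc G -> e \in eset G /\ v \in vset G.
Proof. by case=> /fsubsetP sub _ /sub; rewrite inE => /andP. Qed.

Lemma mem_endpoints G e v : is_graph G -> (v \in endpoints G e) = ((e, v) \in inc G).
Proof.
move=> gG; rewrite !inE; apply: andb_idl => ie.
by have [] := is_graph_inc gG ie.
Qed.

Lemma mgraph_eq G H : vset G = vset H -> eset G = eset H -> inc G = inc H -> G = H.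
Proof. by case: G H => [V E I] [V' E' I'] /= -> -> ->. Qed.

(** Gluing is done by names: two graphs are glued along the vertices that they literally share. *)
Definition gunion (A B : mgraph) : mgraph :=
  MGraph (vset A `|` vset B) (eset A `|` eset B) (inc A `|` inc B).

Definition gimage (f g : nat -> nat) (G : mgraph) : mgraph :=
  MGraph (f @` vset G) (g @` eset G) ((fun p => (g p.1, f p.2)) @` inc G).

Lemma gunionC A B : gunion A B = gunion B A.
Proof. by rewrite /gunion fsetUC [eset A `|` _]fsetUC [inc A `|` _]fsetUC. Qed.

Lemma gunionA A B C : gunion A (gunion B C) = gunion (gunion A B) C.
Proof. by rewrite /gunion /= !fsetUA. Qed.

Lemma inc_gunionl A B e v : is_graph A -> is_graph B -> [disjoint eset A & eset B] ->
  e \in eset A -> ((e, v) \in inc (gunion A B)) = ((e, v) \in inc A).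
Proof.
move=> gA gB /fdisjointP dis eA; rewrite inE orb_idr // => /(is_graph_inc gB)[eB _].
by have := dis _ eA; rewrite eB.
Qed.

Lemma inc_gunionr A B e v : is_graph A -> is_graph B -> [disjoint eset A & eset B] ->
  e \in eset B -> ((e, v) \in inc (gunion A B)) = ((e, v) \in inc B).
Proof. by move=> gA gB dis eB; rewrite gunionC inc_gunionl // fdisjoint_sym. Qed.

Lemma endpoints_gunionl A B e : is_graph A -> is_graph B -> [disjoint eset A & eset B] ->
  e \in eset A -> endpoints (gunion A B) e = endpoints A e.
Proof.
move=> gA gB dis eA; apply/fsetP => v.
rewrite (mem_endpoints _ _ gA) -(inc_gunionl _ gA gB dis eA) in_fset /= inE /=.
apply: andb_idl; rewrite inc_gunionl // => /(is_graph_inc gA)[_ vA].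
by rewrite inE vA.
Qed.

Lemma endpoints_gunionr A B e : is_graph A -> is_graph B -> [disjoint eset A & eset B] ->
  e \in eset B -> endpoints (gunion A B) e = endpoints B e.
Proof. by move=> gA gB dis eB; rewrite gunionC endpoints_gunionl // fdisjoint_sym. Qed.

Lemma is_graph_gunion A B : is_graph A -> is_graph B -> [disjoint eset A & eset B] ->
  is_graph (gunion A B).
Proof.
move=> gA gB dis; split.
  apply/fsubsetP => -[e v]; rewrite !inE /= => /orP[/(is_graph_inc gA)|/(is_graph_inc gB)] [-> ->];
  by rewrite ?orbT.
move=> e; rewrite inE => /orP[eA|eB].
  by rewrite endpoints_gunionl //; case: gA => _ ->.
by rewrite endpoints_gunionr //; case: gB => _ ->.
Qed.

Lemma inc_gimage f g G e v : is_graph G ->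
  {in vset G &, injective f} -> {in eset G &, injective g} ->
  e \in eset G -> v \in vset G ->
  ((g e, f v) \in inc (gimage f g G)) = ((e, v) \in inc G).
Proof.
move=> gG fi gi eG vG; apply/imfsetP/idP => [[[e' v'] /= i [/gi ee /fi ev]]|i].
  by have [e'G v'G] := is_graph_inc gG i; rewrite ee // ev.
by exists (e, v).
Qed.

Lemma gimage_isomorphic f g G : is_graph G ->
  {in vset G &, injective f} -> {in eset G &, injective g} -> isomorphic G (gimage f g G).
Proof.
by move=> gG fi gi; exists f, g; split=> // e v eG vG; rewrite inc_gimage.
Qed.

Lemma endpoints_gimage f g G e : is_graph G ->
  {in vset G &, injective f} -> {in eset G &, injective g} ->
  e \in eset G -> endpoints (gimage f g G) (g e) = f @` endpoints G e.
Proof.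
move=> gG fi gi eG; apply/fsetP => w; apply/endpointsP/imfsetP.
  move=> [/imfsetP[v /= vG ->]]; rewrite inc_gimage // => i.
  by exists v => //; apply/endpointsP.
by move=> [v /endpointsP[vG i] ->]; rewrite inc_gimage //= in_imfset.
Qed.

Lemma is_graph_gimage f g G : is_graph G ->
  {in vset G &, injective f} -> {in eset G &, injective g} -> is_graph (gimage f g G).
Proof.
move=> gG fi gi; split.
  apply/fsubsetP => _ /imfsetP[[e v] /= /(is_graph_inc gG)[eG vG] ->].
  by rewrite inE /= !in_imfset.
move=> _ /imfsetP[e /= eG ->]; rewrite endpoints_gimage // card_in_imfset /=.
  by case: gG => _ ->.
by move=> v w /endpointsP[vG _] /endpointsP[wG _]; exact: fi.
Qed.

Lemma isomorphic_gimage G H : is_graph G -> is_graph H -> isomorphic G H ->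
  exists f g, [/\ {in vset G &, injective f}, {in eset G &, injective g} & H = gimage f g G].
Proof.
move=> gG gH [f [g [fi fV gi gE fg]]]; exists f, g; split=> //.
apply: mgraph_eq => //=; apply/fsetP => -[e v]; apply/idP/imfsetP => [i|].
  have [] := is_graph_inc gH i; rewrite -fV -gE => /imfsetP[e' /= e'G ee] /imfsetP[v' /= v'G ev].
  by exists (e', v') => /=; rewrite -?fg // -?ee -?ev.
by case=> -[e' v'] /= i [-> ->]; have [? ?] := is_graph_inc gG i; rewrite fg.
Qed.

Lemma left_inverse_in (A : {fset nat}) (f : nat -> nat) : {in A &, injective f} ->
  exists f', {in A, cancel f f'}.
Proof.
move=> fi; exists (fun y => head 0 [seq x <- enum_fset A | f x == y]) => x xA.
have : x \in [seq z <- enum_fset A | f z == f x] by rewrite mem_filter eqxx.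
case e: [seq z <- _ | _] => [//|z s] _ /=.
have : z \in [seq z <- enum_fset A | f z == f x] by rewrite e mem_head.
by rewrite mem_filter => /andP[/eqP + zA]; exact: fi.
Qed.

Lemma isomorphic_sym G H : is_graph G -> is_graph H -> isomorphic G H -> isomorphic H G.
Proof.
move=> gG gH iso; have [f [g [fi gi eH]]] := isomorphic_gimage gG gH iso.
have [f' fK] := left_inverse_in fi; have [g' gK] := left_inverse_in gi.
have -> : G = gimage f' g' H.
  rewrite eH /gimage -!imfset_comp; apply: mgraph_eq => /=.
  - by rewrite -[LHS]imfset_id; apply: eq_in_imfset => v /= /fK.
  - by rewrite -[LHS]imfset_id; apply: eq_in_imfset => v /= /gK.
  rewrite -[LHS]imfset_id; apply: eq_in_imfset => -[e v] /= /(is_graph_inc gG)[eG vG].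
  by rewrite fK ?gK.
apply: gimage_isomorphic => //; rewrite eH.
  by move=> _ _ /imfsetP[v /= vG ->] /imfsetP[w /= wG ->]; rewrite !fK // => ->.
by move=> _ _ /imfsetP[v /= vG ->] /imfsetP[w /= wG ->]; rewrite !gK // => ->.
Qed.

(** Stated for renamings, which are explicit functions, and in one direction only; the converse
    follows from the symmetry of isomorphism. *)
Definition iso_invariant (P : mgraph -> Prop) :=
  forall f g G, is_graph G -> {in vset G &, injective f} -> {in eset G &, injective g} ->
  P G -> P (gimage f g G).

Lemma iso_invariantP P G H : iso_invariant P -> is_graph G -> is_graph H ->
  isomorphic G H -> (P G <-> P H).
Proof.
move=> Pinv gG gH iso; split.
  by have [f [g [fi gi ->]]] := isomorphic_gimage gG gH iso; exact: Pinv.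
by have [f [g [fi gi ->]]] := isomorphic_gimage gH gG (isomorphic_sym gG gH iso); exact: Pinv.
Qed.

End Graphs.

(** * Copies of boundaried graphs *)

Section Copies.
Local Open Scope fset_scope.
Local Open Scope nat_scope.
Variable k : nat.
Implicit Types (b : bgraph k) (S : {set 'I_k.+1}) (th : 'I_k.+1 -> nat) (t : term k).

Record boundaried b S : Prop := Boundaried {
  bd_graph : is_graph (bg_graph b);
  bd_dom : forall u, isSome (bg_label b u) = (u \in S);
  bd_vset : forall u x, bg_label b u = Some x -> x \in vset (bg_graph b);
  bd_inj : forall u v x, bg_label b u = Some x -> bg_label b v = Some x -> u = v
}.

Lemma bd_label b S u : boundaried b S -> u \in S -> exists2 x, bg_label b u = Some x & x \in vset (bg_graph b).
Proof.
move=> bS uS; have := bd_dom bS u; rewrite uS; case e: (bg_label b u) => [x|] // _.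
by exists x => //; exact: (bd_vset bS e).
Qed.

Lemma bd_in b S u x : boundaried b S -> bg_label b u = Some x -> u \in S.
Proof. by move=> bS e; rewrite -(bd_dom bS) e. Qed.

(** Prescribing the names [th u] of labelled vertices and leaving the other names free turns the
    term operations into plain set operations: [graph_join], which shifts names, becomes the union
    of two copies. *)
Definition copy_by th b A (f g : nat -> nat) : Prop :=
  [/\ {in vset (bg_graph b) &, injective f}, {in eset (bg_graph b) &, injective g},
      A = gimage f g (bg_graph b) & forall u x, bg_label b u = Some x -> f x = th u].

Definition copy th b A : Prop := exists f g, copy_by th b A f g.

Lemma copy_isomorphic th b A S : boundaried b S -> copy th b A -> isomorphic (bg_graph b) A.
Proof. by move=> bS [f [g [fi gi -> _]]]; apply: gimage_isomorphic => //; case: bS. Qed.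

Lemma copy_is_graph th b A S : boundaried b S -> copy th b A -> is_graph A.
Proof. by move=> bS [f [g [fi gi -> _]]]; apply: is_graph_gimage => //; case: bS. Qed.

Lemma copy_label th b A S u : boundaried b S -> copy th b A -> u \in S -> th u \in vset A.
Proof.
move=> bS [f [g [_ _ -> fl]]] uS; have [x ex xV] := bd_label bS uS.
by rewrite -(fl _ _ ex); apply: in_imfset.
Qed.

Lemma eq_copy th th' b A S : boundaried b S -> {in S, th =1 th'} -> copy th b A -> copy th' b A.
Proof.
move=> bS e [f [g [fi gi -> fl]]]; exists f, g; split=> // u x eu.
by rewrite (fl _ _ eu) e // (bd_in bS eu).
Qed.

(** Unlabelled vertices are shifted above [F] and all label names, edges above [Fe]; collisions with
    [F] can then occur only at active vertices. *)
Lemma copy_exists th b S (F Fe : {fset nat}) : boundaried b S -> {in S &, injective th} ->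
  exists A, [/\ copy th b A, forall v, v \in vset A -> v \in F -> exists2 u, u \in S & v = th u
              & [disjoint eset A & Fe]].
Proof.
move=> bS thi; pose big := fresh (F `|` [fset th u | u in S]).
pose f x := if [pick u | bg_label b u == Some x] is Some u then th u else big + x.
pose g e := fresh Fe + e.
have gi : {in eset (bg_graph b) &, injective g} by move=> x y _ _ /addnI.
have big_th u : u \in S -> th u < big.
  by move=> uS; apply: fresh_gt; rewrite inE in_imfset ?orbT.
have fl u x : bg_label b u = Some x -> f x = th u.
  rewrite /f => e; case: pickP => [v /eqP e'|/(_ u)]; last by rewrite e eqxx.
  by rewrite (bd_inj bS e e').
have fi : {in vset (bg_graph b) &, injective f}.
  move=> x y _ _; rewrite /f; case: pickP => [u /eqP eu|nu]; case: pickP => [v /eqP ev|nv].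
  - by move/(thi _ _ (bd_in bS eu) (bd_in bS ev)) => e; move: eu; rewrite e ev => -[].
  - by move=> e; have := big_th _ (bd_in bS eu); lia.
  - by move=> e; have := big_th _ (bd_in bS ev); lia.
  - by move/addnI.
exists (gimage f g (bg_graph b)); split; first by exists f, g; split.
  move=> _ /imfsetP[x /= xV ->]; rewrite /f.
  case: pickP => [u /eqP eu|nu xF]; first by exists u => //; exact: (bd_in bS eu).
  have : big + x < big by apply: fresh_gt; rewrite inE xF.
  by lia.
apply/fdisjointP => _ /imfsetP[e /= _ ->]; exact: fresh_notin.
Qed.

Lemma boundaried_leaf : boundaried (bgraph_of (@Leaf k)) set0.
Proof.
split=> //=; last by move=> u; rewrite inE.
Qed.

Lemma boundaried_intro b S u : boundaried b S -> u \notin S ->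
  boundaried (graph_unary (IntroVertex u) b) (u |: S)%SET.
Proof.
case: b => G lb bS uS; have fG := fresh_notin0 (vset G).
have [/= gG dom vs li] := bS; split=> /=.
- have sub : vset G `<=` fresh (vset G) |` vset G by exact: fsubsetUr.
  case: (gG) => [inG epG]; split.
    by apply/fsubsetP => -[e v] /(is_graph_inc gG)[eG vG]; rewrite !inE /= eG vG orbT.
  move=> e eG; rewrite -(epG e eG); congr (size (enum_fset _)); apply/fsetP => v.
  apply/endpointsP/endpointsP => -[_ i]; split=> //=; first by case: (is_graph_inc gG i).
  by rewrite inE; case: (is_graph_inc gG i) => _ ->; rewrite orbT.
- by move=> w; rewrite !inE; case: eqP => //= _; exact: dom.
- by move=> w x; case: eqP => [_ [<-]|_ /vs xG]; rewrite !inE ?eqxx ?xG ?orbT.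
- move=> w v x; do 2 case: eqP => [->|?] //.
  + by move=> [<-] /vs; rewrite (negPf fG).
  + by move=> /vs xG [ex]; move: fG; rewrite ex xG.
  + exact: li.
Qed.

Lemma copy_intro th b S u A : boundaried b S -> copy th b A -> u \notin S -> th u \notin vset A ->
  copy th (graph_unary (IntroVertex u) b) (MGraph (th u |` vset A) (eset A) (inc A)).
Proof.
case: b => G lb bS [f [g [/= fi gi -> fl]]] uS /= thA; have fG := fresh_notin0 (vset G).
pose f' x := if x == fresh (vset G) then th u else f x.
have f'E : {in vset G, f' =1 f}.
  by move=> x xG; rewrite /f'; case: eqP => // e; move: fG; rewrite -e xG.
have f'n : f' (fresh (vset G)) = th u by rewrite /f' eqxx.
have thf v : v \in vset G -> th u = f v -> False.
  by move=> vG e; case/negP: thA; rewrite e; apply: in_imfset.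
exists f', g; split=> //=.
- move=> x y; rewrite !inE => /orP[/eqP->|xG] /orP[/eqP->|yG]; rewrite ?f'n ?f'E //.
  + by move/thf => [].
  + by move=> /esym/thf => -[].
  + exact: fi.
- apply: mgraph_eq => //=; first by rewrite imfsetU1 f'n; congr (_ `|` _); apply/esym/eq_in_imfset.
  by apply: eq_in_imfset => -[e v] /= /(is_graph_inc (bd_graph bS))[_ vG]; rewrite f'E.
- move=> w x; case: eqP => [-> [<-] //|_ ew]; rewrite f'E ?(fl _ _ ew) //.
  exact: (bd_vset bS ew).
Qed.

Lemma boundaried_forget b S u : boundaried b S ->
  boundaried (graph_unary (ForgetVertex u) b) (S :\ u)%SET.
Proof.
case: b => G lb [/= gG dom vs li]; split=> //=.
- by move=> w; rewrite !inE; case: eqP => //= _; exact: dom.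
- by move=> w x; case: eqP => // _; exact: vs.
- by move=> w v x; do 2 case: eqP => // _; exact: li.
Qed.

Lemma copy_forget th b u A : copy th b A -> copy th (graph_unary (ForgetVertex u) b) A.
Proof.
case: b => G lb [f [g [/= fi gi -> fl]]]; exists f, g; split=> //= w x.
by case: eqP => // _; exact: fl.
Qed.

Lemma is_graph_add_edge G e x y : is_graph G -> e \notin eset G -> x \in vset G -> y \in vset G ->
  x != y -> is_graph (MGraph (vset G) (e |` eset G) ([fset (e, x); (e, y)] `|` inc G)).
Proof.
move=> gG eG xG yG xy; split.
  apply/fsubsetP => -[e' v]; rewrite !inE /= => /orP[/orP[]/eqP[-> ->]|].
  - by rewrite eqxx.
  - by rewrite eqxx.
  - by case/(is_graph_inc gG) => -> ->; rewrite orbT.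
move=> e' /fset1UP[->|e'G].
  rewrite -[RHS](_ : #|` [fset x; y]| = 2); last by rewrite cardfs2 xy.
  congr (size (enum_fset _)); apply/fsetP => v; rewrite !inE /= !xpair_eqE !eqxx /=.
  apply/andP/orP => [[vG /orP[/orP //|/(is_graph_inc gG)[eG' _]]]|].
    by move: eG; rewrite eG'.
  by case=> /eqP ->; rewrite ?xG ?yG eqxx ?orbT.
case: (gG) => _ /(_ _ e'G) <-; congr (size (enum_fset _)); apply/fsetP => v.
rewrite !inE /= !xpair_eqE; case: eqP => // ee; by move: eG; rewrite -ee e'G.
Qed.

Lemma boundaried_edge b S u v (uv : u != v) : boundaried b S -> u \in S -> v \in S ->
  boundaried (graph_unary (IntroEdge uv) b) S.
Proof.
case: b => G lb bS uS vS /=.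
have [x /= eu xG] := bd_label bS uS; have [y /= ev yG] := bd_label bS vS; rewrite eu ev.
have [/= gG dom vs li] := bS; split=> //=.
apply: is_graph_add_edge => //; first exact: fresh_notin0.
by apply: contra_neq uv => e; apply: li eu _; rewrite e.
Qed.

Lemma copy_edge th b S u v (uv : u != v) e A : boundaried b S -> u \in S -> v \in S ->
  copy th b A -> e \notin eset A ->
  copy th (graph_unary (IntroEdge uv) b)
    (MGraph (vset A) (e |` eset A) ([fset (e, th u); (e, th v)] `|` inc A)).
Proof.
case: b => G lb bS uS vS [f [g [/= fi gi -> fl]]] /= eA.
have [x /= eu xG] := bd_label bS uS; have [y /= ev yG] := bd_label bS vS; rewrite eu ev.
have fG := fresh_notin0 (eset G).
pose g' z := if z == fresh (eset G) then e else g z.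
have g'E : {in eset G, g' =1 g}.
  by move=> z zG; rewrite /g'; case: eqP => // ez; move: fG; rewrite -ez zG.
have g'n : g' (fresh (eset G)) = e by rewrite /g' eqxx.
have neg z : z \in eset G -> e = g z -> False.
  by move=> zG ez; case/negP: eA; rewrite ez; apply: in_imfset.
exists f, g'; split=> //=.
- move=> z z'; rewrite !inE => /orP[/eqP->|zG] /orP[/eqP->|zG']; rewrite ?g'n ?g'E //.
  + by move/neg => [].
  + by move=> /esym/neg => -[].
  + exact: gi.
- apply: mgraph_eq => //=; first by rewrite imfsetU1 g'n; congr (_ `|` _); apply/esym/eq_in_imfset.
  rewrite imfsetU imfset_fset2 /= g'n (fl _ _ eu) (fl _ _ ev); congr (_ `|` _).
  by apply: eq_in_imfset => -[z w] /= /(is_graph_inc (bd_graph bS))[zG _]; rewrite g'E.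
Qed.

Definition join_vertex (b1 b2 : bgraph k) (v : nat) :=
  let w := fresh (vset (bg_graph b1)) + v in
  if [pick u | bg_label b2 u == Some v] is Some u then odflt w (bg_label b1 u) else w.

Lemma graph_joinE b1 b2 : graph_join b1 b2 =
  BGraph (gunion (bg_graph b1) (gimage (join_vertex b1 b2)
            (fun e => fresh (eset (bg_graph b1)) + e) (bg_graph b2))) (bg_label b1).
Proof. by case: b1 b2 => [G1 l1] [G2 l2]. Qed.

Lemma join_vertex_label b1 b2 S u x y : boundaried b1 S -> boundaried b2 S ->
  bg_label b1 u = Some x -> bg_label b2 u = Some y -> join_vertex b1 b2 y = x.
Proof.
move=> b1S b2S e1 e2; rewrite /join_vertex; case: pickP => [v /eqP e|/(_ u)]; last by rewrite e2 eqxx.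
by rewrite (bd_inj b2S e e2) e1.
Qed.

Lemma join_vertexP b1 b2 S v : boundaried b1 S -> boundaried b2 S ->
  (exists u x, [/\ bg_label b2 u = Some v, bg_label b1 u = Some x & join_vertex b1 b2 v = x])
  \/ ((forall u, bg_label b2 u <> Some v) /\
      join_vertex b1 b2 v = fresh (vset (bg_graph b1)) + v).
Proof.
move=> b1S b2S; rewrite /join_vertex; case: pickP => [u /eqP e|n].
  have [x e1 _] := bd_label b1S (bd_in b2S e).
  by left; exists u, x; rewrite e1.
by right; split=> // u e; have := n u; rewrite e eqxx.
Qed.

Lemma join_vertex_inj b1 b2 S : boundaried b1 S -> boundaried b2 S -> injective (join_vertex b1 b2).
Proof.
move=> b1S b2S v w.
have [[u [x [e2 e1 ->]]]|[nv ->]] := join_vertexP v b1S b2S;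
have [[u' [x' [e2' e1' ->]]]|[nw ->]] := join_vertexP w b1S b2S.
- by move=> e; subst x'; move: e2'; rewrite -(bd_inj b1S e1 e1') e2 => -[].
- by have := fresh_gt (bd_vset b1S e1); lia.
- by have := fresh_gt (bd_vset b1S e1'); lia.
- by move/addnI.
Qed.

Lemma boundaried_join b1 b2 S : boundaried b1 S -> boundaried b2 S ->
  boundaried (graph_join b1 b2) S.
Proof.
move=> b1S b2S; rewrite graph_joinE; split=> /=.
- apply: is_graph_gunion; first by case: b1S.
    apply: is_graph_gimage; first by case: b2S.
      by move=> x y _ _; exact: join_vertex_inj b1S b2S _ _.
    by move=> x y _ _ /addnI.
  rewrite fdisjoint_sym; apply/fdisjointP => _ /imfsetP[e _ ->]; exact: fresh_notin.
- exact: bd_dom b1S.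
- by move=> u x e; rewrite inE (bd_vset b1S e).
- exact: bd_inj b1S.
Qed.

(** The second renaming is applied after undoing the shift. It agrees with the first at identified
    vertices, both giving [th u]; injectivity across the two halves holds because the copies meet
    only in active vertices. *)
Lemma copy_join th b1 b2 S A1 A2 : boundaried b1 S -> boundaried b2 S ->
  {in S &, injective th} -> copy th b1 A1 -> copy th b2 A2 ->
  (forall v, v \in vset A1 -> v \in vset A2 -> exists2 u, u \in S & v = th u) ->
  [disjoint eset A1 & eset A2] -> copy th (graph_join b1 b2) (gunion A1 A2).
Proof.
move=> b1S b2S thi [f1 [g1 [fi1 gi1 eA1 fl1]]] [f2 [g2 [fi2 gi2 eA2 fl2]]] cap /fdisjointP dis.
rewrite graph_joinE; set G1 := bg_graph b1; set G2 := bg_graph b2.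
pose f v := if v \in vset G1 then f1 v else f2 (v - fresh (vset G1)).
pose g e := if e \in eset G1 then g1 e else g2 (e - fresh (eset G1)).
have fE1 : {in vset G1, f =1 f1} by move=> v vG; rewrite /f vG.
have gE1 : {in eset G1, g =1 g1} by move=> v vG; rewrite /g vG.
have fE2 v : f (join_vertex b1 b2 v) = f2 v.
  have [[u [x [e2 e1 ->]]]|[nv ->]] := join_vertexP v b1S b2S.
    by rewrite (fl2 _ _ e2) fE1 ?(fl1 _ _ e1) //; exact: (bd_vset b1S e1).
  by rewrite /f (negPf (fresh_notin _ _)) addKn.
have gE2 e : g (fresh (eset G1) + e) = g2 e.
  by rewrite /g (negPf (fresh_notin _ _)) addKn.
have cross v w : v \in vset G1 -> w \in vset G2 -> f1 v = f2 w -> v = join_vertex b1 b2 w.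
  move=> vG wG e; have [||u uS eu] := cap (f1 v).
  - by rewrite eA1; apply: in_imfset.
  - by rewrite e eA2; apply: in_imfset.
  have [x ex xG] := bd_label b1S uS; have [y ey yG] := bd_label b2S uS.
  have -> : v = x by apply: fi1 => //; rewrite eu (fl1 _ _ ex).
  have -> : w = y by apply: fi2 => //; rewrite -e eu (fl2 _ _ ey).
  by rewrite (join_vertex_label b1S b2S ex ey).
exists f, g; split=> /=.
- move=> v w; rewrite !inE => /orP[vG|/imfsetP[v' /= vG ->]] /orP[wG|/imfsetP[w' /= wG ->]];
  rewrite ?fE2 ?fE1 //; first exact: fi1.
  + exact: cross.
  + by move=> /esym e; rewrite (cross _ _ wG vG e).
  + by move=> e; rewrite (fi2 _ _ vG wG e).
- move=> v w; rewrite !inE => /orP[vG|/imfsetP[v' /= vG ->]] /orP[wG|/imfsetP[w' /= wG ->]];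
  rewrite ?gE2 ?gE1 //; first exact: gi1.
  + move=> e; have := dis (g1 v); rewrite eA1 in_imfset // => /(_ isT).
    by rewrite e eA2 in_imfset.
  + move=> e; have := dis (g1 w); rewrite eA1 in_imfset // => /(_ isT).
    by rewrite -e eA2 in_imfset.
  + by move=> e; rewrite (gi2 _ _ vG wG e).
- rewrite eA1 eA2; apply: mgraph_eq => /=; rewrite imfsetU -imfset_comp; congr (_ `|` _);
  apply: eq_in_imfset => //=.
  + by move=> v vG /=; rewrite fE1.
  + by move=> v vG /=; rewrite gE1.
  + by move=> [e v] /= /(is_graph_inc (bd_graph b1S))[eG vG]; rewrite fE1 ?gE1.
  + by move=> [e v] /= i; rewrite fE2 gE2.
- by move=> u x e; rewrite fE1 ?(fl1 _ _ e) //; exact: (bd_vset b1S e).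
Qed.

Lemma boundaried_of t S : run t = Some S -> boundaried (bgraph_of t) S.
Proof.
elim: t S => [|a t IH|t1 IH1 t2 IH2] S /=.
- by move=> [<-]; exact: boundaried_leaf.
- case: (run t) IH => [S'|] //= /(_ _ erefl) bS.
  case: a => [u|u|u v uv] /=; case: ifP => // h [<-].
  + exact: boundaried_intro.
  + exact: boundaried_forget.
  + by case/andP: h; exact: boundaried_edge.
- case: (run t1) IH1 => [S1|] // /(_ _ erefl) bS1.
  case: (run t2) IH2 => [S2|] // /(_ _ erefl) bS2.
  by case: eqP => // e [<-]; subst S2; exact: boundaried_join.
Qed.

End Copies.

(** * Contexts *)

Section Contexts.
Local Open Scope fset_scope.
Local Open Scope nat_scope.
Variable k : nat.
Implicit Types (S : {set 'I_k.+1}) (th : 'I_k.+1 -> nat) (t : term k).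

Variant frame := UnFrame of unary k | JoinLeft of term k | JoinRight of term k.

Definition plug (x : frame) t : term k :=
  match x with
  | UnFrame a => Un a t
  | JoinLeft t2 => Join t t2
  | JoinRight t1 => Join t1 t
  end.

(* Innermost frame first. *)
Definition fill (c : seq frame) t : term k := foldl (fun t x => plug x t) t c.

Lemma run_plug x t t' : run t = run t' -> run (plug x t) = run (plug x t').
Proof. by case: x => [a|t2|t1] /= ->. Qed.

Lemma run_fill c t t' : run t = run t' -> run (fill c t) = run (fill c t').
Proof. by elim: c t t' => //= x c IH t t' e; apply/IH/run_plug. Qed.

Lemma run_fill_None c t : run t = None -> run (fill c t) = None.
Proof.
elim: c t => //= x c IH t e; apply: IH; case: x => [a|t2|t1] /=; rewrite e //.
by case: (run t1).
Qed.

(** [B] is what the context alone contributes: it is fixed before the term [t], of which only the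
    active set [S] is known. [F] and [Fe] are vertex and edge names reserved in advance, so that one
    [B] can be glued to several given copies. *)
Definition outer_graph c th S (F Fe : {fset nat}) B :=
  [/\ is_graph B, {in S, forall u, th u \in vset B},
      forall v, v \in vset B -> v \in F -> exists2 u, u \in S & v = th u,
      [disjoint eset B & Fe]
    & forall t A, run t = Some S -> copy th (bgraph_of t) A ->
        (forall v, v \in vset A -> v \in vset B -> exists2 u, u \in S & v = th u) ->
        [disjoint eset A & eset B] ->
        isomorphic (graph_of (fill c t)) (gunion A B)].

Definition bset th S : {fset nat} := [fset th u | u in S].

Lemma outer_nil th S F Fe : outer_graph [::] th S F Fe (MGraph (bset th S) fset0 fset0).
Proof.
split=> /=.
- by split=> //=; apply/fsubsetP => x; rewrite inE.
- by move=> u uS; apply: in_imfset.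
- by move=> v /imfsetP[u /= uS ->]; exists u.
- by rewrite fdisjoint0X.
move=> t A rt cA _ _; have bS := boundaried_of rt.
rewrite (_ : gunion _ _ = A); first exact: copy_isomorphic bS cA.
apply: mgraph_eq; rewrite /= ?fsetU0 //; apply/fsetUidPl/fsubsetP => _ /imfsetP[u /= uS ->].
exact: copy_label bS cA uS.
Qed.

(** Induction on the context, its innermost operation being moved between the term and the outer
    graph. The term [t0] only witnesses that the context accepts the active set [S]. *)
Lemma outer_exists c th S F Fe t0 : {in S &, injective th} -> run t0 = Some S ->
  inL (fill c t0) -> exists B, outer_graph c th S F Fe B.
Proof.
elim: c th S F Fe t0 => [|x c IH] th S F Fe t0 thi rt0 /=.
  by move=> _; eexists; exact: outer_nil.
case: x => [[u|u|u v uv]|t2|t1] Lc.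
- have [uS|uS] := boolP (u \in S).
    by move: Lc; rewrite /inL run_fill_None //= rt0 /= uS.
  (* The new vertex gets a fresh name and is a boundary vertex of the graph given by the induction
     hypothesis. It stays in [B], but is no longer shared with [A]. *)
  pose z := fresh (F `|` bset th S).
  have zF : z \notin F by have := fresh_notin0 (F `|` bset th S); rewrite inE => /norP[].
  have zS w : w \in S -> th w <> z.
    move=> wS e; have := fresh_notin0 (F `|` bset th S).
    by rewrite inE -/z -e in_imfset ?orbT.
  pose th' w := if w == u then z else th w.
  have th'E : {in S, th =1 th'}.
    by move=> w wS; rewrite /th'; case: eqP => // e; move: uS; rewrite -e wS.
  have th'u : th' u = z by rewrite /th' eqxx.
  have thi' : {in (u |: S)%SET &, injective th'}.
    move=> w w'; rewrite !inE => /orP[/eqP->|wS] /orP[/eqP->|wS']; rewrite ?th'u -?th'E //.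
    + by move=> e; case: (zS _ wS').
    + by move=> e; case: (zS _ wS).
    + exact: thi.
  have [||B [gB SB FB FeB isoB]] := IH th' (u |: S)%SET F Fe (Un (IntroVertex u) t0) thi'.
  + by rewrite /= rt0 /= uS.
  + exact: Lc.
  exists B; split=> //.
  + by move=> w wS; rewrite th'E //; apply: SB; rewrite !inE wS orbT.
  + move=> w wB wF; have [s] := FB _ wB wF; rewrite !inE => /orP[/eqP->|sS] e.
      by move: zF; rewrite -th'u -e wF.
    by exists s; rewrite // th'E.
  move=> t A rt cA cap dis; have bS := boundaried_of rt.
  have zB : z \in vset B by rewrite -th'u; apply: SB; rewrite !inE eqxx.
  have zA : z \notin vset A.
    by apply/negP => zA; have [s sS /esym/(zS _ sS)] := cap _ zA zB.
  have cA' : copy th' (bgraph_of (Un (IntroVertex u) t)) (MGraph (z |` vset A) (eset A) (inc A)).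
    by rewrite -th'u; apply: (copy_intro bS); rewrite ?th'u //; exact: eq_copy bS th'E cA.
  rewrite (_ : gunion A B = gunion (MGraph (z |` vset A) (eset A) (inc A)) B).
    apply: isoB cA' _ _ => //=; first by rewrite rt /= uS.
    move=> w; rewrite !inE => /orP[/eqP->|wA] wB; first by exists u; rewrite ?inE ?eqxx.
    by have [s sS e] := cap _ wA wB; exists s; rewrite -?th'E // !inE sS orbT.
  by apply: mgraph_eq => //=; rewrite -fsetUA fsetUCA mem_fset1U // inE zB orbT.
- have [uS|uS] := boolP (u \in S); last first.
    by move: Lc; rewrite /inL run_fill_None //= rt0 /= (negPf uS).
  have thi' : {in (S :\ u)%SET &, injective th}.
    by move=> w w'; rewrite !inE => /andP[_ wS] /andP[_ wS']; exact: thi.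
  (* The name of the forgotten vertex becomes reserved: the rest of the context must not reuse
     it. *)
  have [||B [gB SB FB FeB isoB]] := IH th (S :\ u)%SET (th u |` F) Fe (Un (ForgetVertex u) t0) thi'.
  + by rewrite /= rt0 /= uS.
  + exact: Lc.
  have uB : th u \notin vset B.
    apply/negP => uB; have [|s] := FB _ uB; first by rewrite !inE eqxx.
    by rewrite !inE => /andP[su sS] /(thi _ _ uS sS) e; rewrite e eqxx in su.
  (* At the hole [u] is still active, so its vertex is put back as an isolated vertex of the outer
     graph. *)
  exists (MGraph (th u |` vset B) (eset B) (inc B)); split=> //=.
  + split=> /=.
      by apply/fsubsetP => -[e v] /(is_graph_inc gB)[eB vB]; rewrite !inE /= eB vB orbT.
    case: (gB) => _ epB e eB; rewrite -(epB e eB); congr (size (enum_fset _)); apply/fsetP => v.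
    rewrite (mem_endpoints _ _ gB) !inE /=; apply: andb_idl => /(is_graph_inc gB)[_ ->].
    by rewrite orbT.
  + move=> w wS; have [->|wu] := eqVneq w u; first by rewrite !inE eqxx.
    by rewrite inE SB ?orbT // !inE wu.
  + move=> v; rewrite !inE => /orP[/eqP->|vB] vF; first by exists u.
    by have [|s] := FB _ vB; rewrite !inE ?vF ?orbT // => /andP[_ sS] ->; exists s.
  move=> t A rt cA cap dis; have bS := boundaried_of rt.
  have uA := copy_label bS cA uS.
  rewrite (_ : gunion A _ = gunion A B).
    apply: (isoB (Un (ForgetVertex u) t)) => //; first by rewrite /= rt /= uS.
      exact: copy_forget.
    move=> v vA vB; have [|s sS e] := cap v vA; first by rewrite !inE vB orbT.
    exists s => //; rewrite !inE sS andbT; apply: contraNneq uB => <-; by rewrite -e.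
  by apply: mgraph_eq => //=; rewrite fsetUCA mem_fset1U // inE uA.
- have [/andP[uS vS]|h] := boolP ((u \in S) && (v \in S)); last first.
    by move: Lc; rewrite /inL run_fill_None //= rt0 /= (negPf h).
  have [||B [gB SB FB FeB isoB]] := IH th S F Fe (Un (IntroEdge uv) t0) thi.
  + by rewrite /= rt0 /= uS vS.
  + exact: Lc.
  pose e := fresh (eset B `|` Fe).
  have := fresh_notin0 (eset B `|` Fe); rewrite inE -/e => /norP[eB eFe].
  exists (MGraph (vset B) (e |` eset B) ([fset (e, th u); (e, th v)] `|` inc B)); split=> //=.
  + apply: is_graph_add_edge => //; try exact: SB.
    by apply/eqP => /(thi _ _ uS vS) euv; case/eqP: (uv).
  + by rewrite fdisjointUX fdisjoint1X eFe.
  move=> t A rt cA cap; rewrite fdisjoint_sym fdisjointUX fdisjoint1X => /andP[eA dis].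
  have bS := boundaried_of rt.
  rewrite (_ : gunion A _ =
    gunion (MGraph (vset A) (e |` eset A) ([fset (e, th u); (e, th v)] `|` inc A)) B).
    apply: (isoB (Un (IntroEdge uv) t)) => //; first by rewrite /= rt /= uS vS.
      exact: (copy_edge uv bS).
    by rewrite /= fdisjointUX fdisjoint1X eB fdisjoint_sym.
  by apply: mgraph_eq => //=; exact: etrans (fsetUCA _ _ _) (fsetUA _ _ _).
- have rt2 : run t2 = Some S.
    apply: contraPP Lc => h; rewrite /inL run_fill_None //= rt0.
    by case: (run t2) h => // S2 h; case: eqP => // e; subst S2.
  have bS2 := boundaried_of rt2.
  have [||B [gB SB FB FeB isoB]] := IH th S F Fe (Join t0 t2) thi.
  + by rewrite /= rt0 rt2 eqxx.
  + exact: Lc.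
  (* The sibling subterm belongs to the context: a copy of it, meeting [F] and [B] only in active
     vertices, is absorbed into the outer graph. *)
  have [A2 [cA2 capA2 disA2]] := copy_exists (F `|` vset B) (Fe `|` eset B) bS2 thi.
  have gA2 := copy_is_graph bS2 cA2.
  have [disA2e disA2B] : [disjoint eset A2 & Fe] /\ [disjoint eset A2 & eset B].
    by move: disA2; rewrite fdisjointXU => /andP.
  exists (gunion A2 B); split=> //=.
  + exact: is_graph_gunion.
  + by move=> w wS; rewrite inE SB ?orbT.
  + move=> v; rewrite inE => /orP[vA vF|vB]; last exact: FB.
    by apply: capA2 => //; rewrite inE vF.
  + by rewrite fdisjointUX disA2e.
  move=> t A rt cA cap; rewrite fdisjointXU => /andP[dis1 dis2].
  have bS := boundaried_of rt; rewrite gunionA.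
  apply: (isoB (Join t t2)); rewrite /= ?rt ?rt2 ?eqxx //.
  + by apply: (copy_join bS bS2) => // v vA vA2; apply: cap => //; rewrite inE vA2.
  + move=> v; rewrite inE => /orP[vA vB|vA2 vB]; last by apply: capA2 => //; rewrite inE vB orbT.
    by apply: cap => //; rewrite inE vB orbT.
  + by rewrite fdisjointUX dis2.
- have rt1 : run t1 = Some S.
    apply: contraPP Lc => h; rewrite /inL run_fill_None //= rt0.
    by case: (run t1) h => // S1 h; case: eqP => // e; subst S1.
  have bS1 := boundaried_of rt1.
  have [||B [gB SB FB FeB isoB]] := IH th S F Fe (Join t1 t0) thi.
  + by rewrite /= rt0 rt1 eqxx.
  + exact: Lc.
  have [A1 [cA1 capA1 disA1]] := copy_exists (F `|` vset B) (Fe `|` eset B) bS1 thi.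
  have gA1 := copy_is_graph bS1 cA1.
  have [disA1e disA1B] : [disjoint eset A1 & Fe] /\ [disjoint eset A1 & eset B].
    by move: disA1; rewrite fdisjointXU => /andP.
  exists (gunion A1 B); split=> //=.
  + exact: is_graph_gunion.
  + by move=> w wS; rewrite inE SB ?orbT.
  + move=> v; rewrite inE => /orP[vA vF|vB]; last exact: FB.
    by apply: capA1 => //; rewrite inE vF.
  + by rewrite fdisjointUX disA1e.
  move=> t A rt cA cap; rewrite fdisjointXU => /andP[dis1 dis2].
  have bS := boundaried_of rt; rewrite gunionA [gunion A A1]gunionC.
  apply: (isoB (Join t1 t)); rewrite /= ?rt ?rt1 ?eqxx //.
  + apply: (copy_join bS1 bS) => //; last by rewrite fdisjoint_sym.
    by move=> v vA1 vA; apply: cap => //; rewrite inE vA1.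
  + move=> v; rewrite inE => /orP[vA1 vB|vA vB]; first by apply: capA1 => //; rewrite inE vB orbT.
    by apply: cap => //; rewrite inE vB orbT.
  + by rewrite fdisjointUX disA1B.
Qed.

End Contexts.

(** * Every graph is the graph of an accepted term *)

Section Constructible.
Local Open Scope fset_scope.
Local Open Scope nat_scope.

(** With [k] the largest vertex number, each vertex is its own label: all vertices are introduced,
    then all edges, and nothing is ever forgotten. This large [k] is allowed because
    [graph_property] ranges over all [k]. *)
Lemma constructible G : is_graph G ->
  exists k (t : term k), inL t /\ isomorphic (graph_of t) G.
Proof.
move=> gG; pose k := \max_(v <- vset G) v; exists k.
have Vk v : v \in vset G -> v < k.+1.
  by move=> vG; rewrite ltnS; exact: (@leq_bigmax_seq _ _ xpredT id).
pose th (u : 'I_k.+1) : nat := u.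
have vertices (V : {fset nat}) : V `<=` vset G ->
    exists t : term k, run t = Some [set u : 'I_k.+1 | (u : nat) \in V] /\
      copy th (bgraph_of t) (MGraph V fset0 fset0).
  elim/fset1U_rect: V => [_|v V vV IH].
    exists Leaf; split=> /=; first by congr Some; apply/setP => u; rewrite !inE.
    exists id, id; split=> //=.
    by apply: mgraph_eq; rewrite /= imfset0.
  rewrite fsubUset fsub1set => /andP[/Vk vk /IH[t [rt ct]]].
  pose u := Ordinal vk; exists (Un (IntroVertex u) t); split.
    rewrite /= rt /= inE /= vV; congr Some; apply/setP => w; rewrite !inE /=.
    by rewrite -val_eqE.
  have bS := boundaried_of rt.
  by apply: (copy_intro bS ct); rewrite ?inE.
have inGE (E : {fset nat}) : E `<=` eset G -> exists t : term k,
   run t = Some [set u : 'I_k.+1 | (u : nat) \in vset G] /\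
   copy th (bgraph_of t) (MGraph (vset G) E [fset p in inc G | p.1 \in E]).
  elim/fset1U_rect: E => [_|e E eE IH].
    have [t [rt ct]] := vertices _ (fsubset_refl _); exists t; split=> //.
    rewrite (_ : [fset p in inc G | _] = fset0) //.
    by apply/fsetP => p; rewrite !inE andbF.
  rewrite fsubUset fsub1set => /andP[eG /IH[t [rt ct]]].
  have := (proj2 gG) e eG => /eqP; case ep: (enum_fset (endpoints G e)) => [|x [|y []]] // _.
  have epE z : (z \in endpoints G e) = (z \in [:: x; y]) by rewrite -ep.
  have xy : x != y by have := fset_uniq (endpoints G e); rewrite ep /= inE andbT.
  have [xG yG] : x \in vset G /\ y \in vset G.
    by split; have := epE x; have := epE y; rewrite !inE !eqxx ?orbT => /andP[? _] /andP[? _].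
  pose u := Ordinal (Vk _ xG); pose v := Ordinal (Vk _ yG).
  have uv : u != v by rewrite -val_eqE.
  exists (Un (IntroEdge uv) t); split; first by rewrite /= rt /= !inE xG yG.
  have bS := boundaried_of rt.
  have := copy_edge (e := e) uv bS _ _ ct; rewrite !inE /= => /(_ xG yG eE).
  rewrite (_ : _ `|` _ = [fset p in inc G | p.1 \in e |` E]) //.
  apply/fsetP => -[e' z]; rewrite !inE /= !xpair_eqE /th /=.
  case: (eqVneq e' e) => [->|_] //=.
  by rewrite (negPf eE) andbF orbF andbT -(mem_endpoints _ _ gG) epE !inE.
have [t [rt ct]] := inGE _ (fsubset_refl _); exists t; split; first by rewrite /inL rt.
have := copy_isomorphic (boundaried_of rt) ct.
rewrite (_ : MGraph _ _ _ = G) //; apply: mgraph_eq => //=.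
by apply/fsetP => -[e z]; rewrite !inE /=; apply: andb_idr => /(is_graph_inc gG)[].
Qed.

End Constructible.

(** * The Myhill-Nerode automaton of a signature *)

Section Signatures.
Local Open Scope fset_scope.
Local Open Scope nat_scope.

(* The active vertex labelled [u] is the number [u]; the other vertices of [A] exceed [k]. *)
Record glued k (S : {set 'I_k.+1}) (A B : mgraph) : Prop := Glued {
  gl_left : is_graph A;
  gl_right : is_graph B;
  gl_edges : [disjoint eset A & eset B];
  gl_active : forall u : 'I_k.+1, ((u : nat) \in vset A) = (u \in S);
  gl_sub : forall u : 'I_k.+1, u \in S -> (u : nat) \in vset B;
  gl_bound : forall v, v \in vset A -> v \in vset B -> v < k.+1
}.

(** One implication suffices, since [A] and [A'] can be exchanged; this also makes the notion stable
    under negation. *)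
Definition respects (P : mgraph -> Prop) (T : nat -> finType)
    (sig : forall k, {set 'I_k.+1} -> mgraph -> T k) : Prop :=
  forall k S A A' B, @glued k S A B -> @glued k S A' B ->
    sig k S A = sig k S A' -> P (gunion A B) -> P (gunion A' B).

Variables (P : mgraph -> Prop) (T : nat -> finType).
Variable sig : forall k, {set 'I_k.+1} -> mgraph -> T k.
Hypothesis P_inv : iso_invariant P.
Hypothesis P_sig : respects P sig.

Definition normal_copy k (t : term k) (A : mgraph) : Prop :=
  forall S, run t = Some S -> copy (fun u => u : nat) (bgraph_of t) A /\
    forall u : 'I_k.+1, (u : nat) \in vset A -> u \in S.

Lemma normal_copy_exists k (t : term k) : exists A, normal_copy t A.
Proof.
case rt: (run t) => [S|]; last by exists (MGraph fset0 fset0 fset0) => S; rewrite rt.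
pose F : {fset nat} := [fset nat_of_ord u | u in {: 'I_k.+1}].
have [|A [cA capA _]] := copy_exists (th := fun u => u : nat) F fset0 (boundaried_of rt).
  by move=> u v _ _ /ord_inj.
exists A => S'; rewrite rt => -[<-]; split=> // u uA.
have [|s sS /ord_inj -> //] := capA _ uA.
by apply/imfsetP; exists u.
Qed.

Definition normal k (t : term k) : mgraph := projT1 (cid (normal_copy_exists t)).

Lemma normalP k (t : term k) : normal_copy t (normal t).
Proof. by rewrite /normal; case: cid. Qed.

(** Acceptance by the automaton is part of the test, which makes the predicate meaningful for
    arbitrary terms and contexts. *)
Definition holds k (t : term k) : bool := inL t && `[< P (graph_of t) >].

Definition equiv k (t t' : term k) : Prop := forall c, holds (fill c t) = holds (fill c t').

Definition term_sig k (t : term k) : option ({set 'I_k.+1} * T k) :=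
  omap (fun S => (S, sig S (normal t))) (run t).

Lemma is_graph_of k (t : term k) : inL t -> is_graph (graph_of t).
Proof. by rewrite /inL; case rt: (run t) => [S|] // _; have [] := boundaried_of rt. Qed.

(** Both terms are completed by one and the same outer graph, so the two filled contexts are gluings
    of [normal t] and [normal t'] with a common [B], which is the situation of [respects]. *)
Lemma term_sig_holds k (t t' : term k) c : term_sig t = term_sig t' ->
  holds (fill c t) -> holds (fill c t').
Proof.
rewrite /term_sig; case rt: (run t) => [S|] /=; last first.
  by rewrite /holds /inL run_fill_None.
case rt': (run t') => [S'|] //= [eS esig] /andP[Lt /asboolP Pt]; subst S'.
have [cA nA] := normalP rt; have [cA' nA'] := normalP rt'.
have bS := boundaried_of rt; have bS' := boundaried_of rt'.
(* The names of both copies are reserved at once. *)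
have [|B [gB SB FB FeB isoB]] := outer_exists (th := fun u => u : nat)
  (vset (normal t) `|` vset (normal t')) (eset (normal t) `|` eset (normal t')) _ rt Lt.
  by move=> u v _ _ /ord_inj.
move: FeB; rewrite fdisjointXU => /andP[]; rewrite fdisjoint_sym => d d'.
rewrite fdisjoint_sym in d'.
have Lt' : inL (fill c t') by rewrite /inL -(run_fill c (etrans rt (esym rt'))).
have glue t1 : boundaried (bgraph_of t1) S -> copy (fun u => u : nat) (bgraph_of t1) (normal t1) ->
    (forall u : 'I_k.+1, (u : nat) \in vset (normal t1) -> u \in S) ->
    vset (normal t1) `<=` vset (normal t) `|` vset (normal t') ->
    [disjoint eset (normal t1) & eset B] -> glued S (normal t1) B.
  move=> b1 c1 n1 /fsubsetP s1 d1; split=> //.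
  - exact: copy_is_graph b1 c1.
  - by move=> u; apply/idP/idP; [exact: n1|exact: copy_label b1 c1].
  - by move=> v vA vB; have [u _ ->] := FB _ vB (s1 _ vA).
have gl := glue _ bS cA nA (fsubsetUl _ _) d.
have gl' := glue _ bS' cA' nA' (fsubsetUr _ _) d'.
have iso : isomorphic (graph_of (fill c t)) (gunion (normal t) B).
  apply: isoB => // v vA vB; have [|u ? ->] := FB v vB; last by exists u.
  by rewrite inE vA.
have iso' : isomorphic (graph_of (fill c t')) (gunion (normal t') B).
  apply: isoB => // v vA vB; have [|u ? ->] := FB v vB; last by exists u.
  by rewrite inE vA orbT.
rewrite /holds Lt'; apply/asboolP.
have gU A : glued S A B -> is_graph (gunion A B) by case=> *; exact: is_graph_gunion.
apply/(iso_invariantP P_inv (is_graph_of Lt') (gU _ gl') iso').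
apply: (P_sig gl gl' esig).
by apply/(iso_invariantP P_inv (is_graph_of Lt) (gU _ gl) iso).
Qed.

Lemma term_sig_equiv k (t t' : term k) : term_sig t = term_sig t' -> equiv t t'.
Proof. by move=> e c; apply/idP/idP; apply: term_sig_holds. Qed.

Lemma equiv_refl k (t : term k) : equiv t t. Proof. by []. Qed.

(* The chosen representative depends only on the class, so that its signature
   is a complete invariant of the class. *)
Definition repr k (t : term k) : term k := projT1 (cid (ex_intro (equiv t) t (equiv_refl t))).

Lemma equiv_repr k (t : term k) : equiv t (repr t).
Proof. by rewrite /repr; case: cid. Qed.

Lemma repr_equiv k (t t' : term k) : equiv t t' -> repr t = repr t'.
Proof.
move=> e.
(* Equivalent terms define the same predicate by extensionality, and choices made from equal
   predicates coincide. *)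
have cid_eq (Q Q' : term k -> Prop) (h : exists x, Q x) (h' : exists x, Q' x) : Q = Q' ->
    projT1 (cid h) = projT1 (cid h').
  by move=> eQ; subst Q'; rewrite (Prop_irrelevance h h').
apply: cid_eq; apply/funext => s; apply/propext.
by split=> es c; rewrite -es e.
Qed.

(** Unlike [term_sig], this is constant on the classes of [equiv], hence compatible with the term
    operations, and it has the same finite range. *)
Definition class k (t : term k) : option ({set 'I_k.+1} * T k) := term_sig (repr t).

Lemma classP k (t t' : term k) : class t = class t' <-> equiv t t'.
Proof.
split=> [/term_sig_equiv e c|/repr_equiv e]; last by rewrite /class e.
by rewrite (equiv_repr t) (equiv_repr t').
Qed.

Lemma class_un k (a : unary k) t t' : class t = class t' -> class (Un a t) = class (Un a t').
Proof. by move=> /classP e; apply/classP => c; exact: (e (UnFrame a :: c)). Qed.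

Lemma class_join k (t1 t1' t2 t2' : term k) :
  class t1 = class t1' -> class t2 = class t2' -> class (Join t1 t2) = class (Join t1' t2').
Proof.
move=> /classP e1 /classP e2; apply/classP => c.
by rewrite (e1 (JoinLeft t2 :: c)) (e2 (JoinRight t1' :: c)).
Qed.

Definition class_acc k (q : option ({set 'I_k.+1} * T k)) : bool :=
  `[< exists2 t : term k, class t = q & holds t >].

Lemma class_accP k (t : term k) : class_acc (class t) = holds t.
Proof.
apply/asboolP/idP => [[t' /classP e]|ht]; last by exists t.
by rewrite (e [::]).
Qed.

Lemma core_recognizes (C : dpcore) beta mu nu delta bd :
  (forall k (t : term k), accepts (C k) t = class_acc (class t)) ->
  (forall k (t : term k), Defs.inv (dyn (C k) t) = [::]) ->
  measures C beta mu nu delta -> bd beta mu nu delta -> has_core P bd.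
Proof.
move=> accC invC mC bdC; exists C, beta, mu, nu, delta; split=> //.
- move=> k k' t t' Lt Lt' iso; rewrite !accC !class_accP !invC; split=> //.
  rewrite /holds Lt Lt' /=; apply: asbool_equiv_eq.
  exact: iso_invariantP P_inv (is_graph_of Lt) (is_graph_of Lt') iso.
move=> G gG; split.
  move=> [k [t [Lt]]]; rewrite accC class_accP => /andP[_ /asboolP Pt] iso.
  by apply/(iso_invariantP P_inv (is_graph_of Lt) gG iso).
move=> PG; have [k [t [Lt iso]]] := constructible gG; exists k, t; split=> //.
rewrite accC class_accP /holds Lt; apply/asboolP.
by apply/(iso_invariantP P_inv (is_graph_of Lt) gG iso).
Qed.

Lemma card_class k : #|{: option ({set 'I_k.+1} * T k)}| = (2 ^ k.+1 * #|T k|).+1.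
Proof.
rewrite card_option card_prod; congr (_ * _).+1.
by rewrite -cardsT -powersetT card_powerset cardsT card_ord.
Qed.

Theorem has_deterministic_core (l : nat -> nat) : (forall k, #|T k| <= 2 ^ l k) ->
  has_core P (fun beta mu nu delta =>
    [/\ forall k, beta k = (l k + k).+3, forall k, mu k = 1,
        exp_bigO 2 nu beta & exp_bigO 2 delta beta]).
Proof.
move=> cardT.
(* [k + 1] bits for the active set and one more for the value [None]; with the acceptance bit the
   length is [(l k + k).+3]. *)
have [k|C [nu [delta [accC invC mC nuC deltaC]]]] :=
  deterministic_core class_acc class_un class_join (l := fun k => (l k + k).+2).
  rewrite card_class !expnS expnD; have := cardT k; have := expn_gt0 2 (l k + k).
  by rewrite expnD /=; nia.
by apply: (core_recognizes accC invC mC); split.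
Qed.

Theorem has_powerset_core (l : nat -> nat) : (forall k, #|T k| <= 2 ^ 2 ^ l k) ->
  has_core P (fun beta mu nu delta =>
    [/\ forall k, beta k = l k + k + 4, forall k, mu k = 2 ^ beta k,
        exp_bigO 2 nu beta & exp2_bigO 1 delta (fun k => l k + k + 2)]).
Proof.
move=> cardT.
have [k|C [nu [delta [accC invC mC nuC deltaC]]]] :=
  powerset_core class_acc class_un class_join (l := fun k => l k + k + 2).
  (* The active set and [None] add [k + 2] to the first exponent [2 ^ l k]; adding [k + 2] to the
     second exponent is more than enough. *)
  rewrite card_class; apply: (@leq_trans (2 ^ (k + 2 + 2 ^ l k))).
    rewrite expnD addn2 !expnS; have := cardT k; have := expn_gt0 2 k; have := expn_gt0 2 (2 ^ l k).
    by rewrite /=; nia.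
  rewrite leq_exp2l // !expnD; have := ltn_expl k (ltnSn 1); have := expn_gt0 2 (l k).
  by rewrite /=; nia.
apply: (core_recognizes accC invC mC); split=> //.
by move=> k; rewrite [RHS]addnC !addnS addn0 addnC.
Qed.

End Signatures.

Lemma has_core_weaken P (bd bd' : (nat -> nat) -> (nat -> nat) -> (nat -> nat) -> (nat -> nat) -> Prop) :
  has_core P bd -> (forall beta mu nu delta, bd beta mu nu delta -> bd' beta mu nu delta) ->
  has_core P bd'.
Proof.
by move=> [C [b [m [n [d [co re me h]]]]]] sub; exists C, b, m, n, d; split=> //; exact: sub.
Qed.

(** * Glued graphs *)

Section Gluing.
Local Open Scope fset_scope.
Local Open Scope nat_scope.
Variables (k : nat) (S : {set 'I_k.+1}).

Lemma glued_graph A B : glued S A B -> is_graph (gunion A B).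
Proof. by case=> *; exact: is_graph_gunion. Qed.

Lemma glued_boundary A B v : glued S A B -> v \in vset A -> v \in vset B ->
  exists2 u : 'I_k.+1, u \in S & v = u.
Proof.
move=> gl vA vB; have vk := gl_bound gl vA vB; exists (Ordinal vk) => //.
by rewrite -(gl_active gl).
Qed.

Lemma glued_same A A' B v : glued S A B -> glued S A' B -> v \in vset B ->
  (v \in vset A') = (v \in vset A).
Proof.
move=> gl gl' vB; apply/idP/idP => vA.
  by have [u uS ->] := glued_boundary gl' vA vB; rewrite (gl_active gl).
by have [u uS ->] := glued_boundary gl vA vB; rewrite (gl_active gl').
Qed.

(** The inner vertices of [A] are thus recognized by [k < v] alone, which lets signatures speak of
    them without knowing [B]. *)
Lemma glued_inner A B v : glued S A B -> v \in vset A -> (v \in vset B) = (v < k.+1).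
Proof.
move=> gl vA; apply/idP/idP => [vB|vk]; first exact: (gl_bound gl vA vB).
have uS : Ordinal vk \in S by rewrite -(gl_active gl).
exact: (gl_sub gl uS).
Qed.

Lemma mem_gunion_edge A B e : e \in eset (gunion A B) = (e \in eset A) || (e \in eset B).
Proof. by rewrite inE. Qed.

Lemma mem_gunion_vertex A B v : v \in vset (gunion A B) = (v \in vset A) || (v \in vset B).
Proof. by rewrite inE. Qed.

(** A recurring pattern: a solution on [gunion A B] is restricted to [A], traded through the
    signature for a solution on [A'] with the same trace on active vertices, and spliced with the
    old solution on [B]. *)
Definition splice (X : {fset nat}) (C : Type) (h1 h2 : nat -> C) v := if v \in X then h1 v else h2 v.

Lemma splicel X C (h1 h2 : nat -> C) v : v \in X -> splice X h1 h2 v = h1 v.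
Proof. by rewrite /splice => ->. Qed.

Lemma splicer A B C (h1 h2 : nat -> C) v : glued S A B ->
  (forall u : 'I_k.+1, u \in S -> h1 u = h2 u) -> v \in vset B -> splice (vset A) h1 h2 v = h2 v.
Proof.
rewrite /splice => gl e vB; case: ifP => // vA.
by have [u uS ->] := glued_boundary gl vA vB; exact: e.
Qed.

Lemma splice_edger A B C (h1 h2 : nat -> C) e : glued S A B -> e \in eset B ->
  splice (eset A) h1 h2 e = h2 e.
Proof.
move=> gl eB; rewrite /splice; case: ifP => // eA.
by have /fdisjointP/(_ _ eA) := gl_edges gl; rewrite eB.
Qed.

Lemma degree_gunion A B v : glued S A B -> degree (gunion A B) v = degree A v + degree B v.
Proof.
case=> gA gB dis _ _ _; rewrite /degree.
rewrite (_ : [fset e in _ | _] =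
  [fset e in eset A | (e, v) \in inc A] `|` [fset e in eset B | (e, v) \in inc B]).
  rewrite cardfsU disjoint_fsetI0 ?cardfs0 ?subn0 //.
  apply/fdisjointP => e; rewrite !inE => /andP[eA _]; rewrite negb_and.
  by move/fdisjointP: dis => ->.
apply/fsetP => e; rewrite !inE /=; apply/idP/idP.
  case/andP=> /orP[eA|eB] i.
    have : (e, v) \in inc (gunion A B) by rewrite inE.
    by rewrite inc_gunionl // => ->; rewrite eA.
  have : (e, v) \in inc (gunion A B) by rewrite inE.
  by rewrite inc_gunionr // => ->; rewrite eB orbT.
by case/orP => /andP[-> ->]; rewrite ?orbT.
Qed.

Lemma degree_notin A v : is_graph A -> v \notin vset A -> degree A v = 0.
Proof.
move=> gA vA; apply/eqP; rewrite cardfs_eq0; apply/eqP/fsetP => e; rewrite !inE.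
by apply/negP => /andP[_ /(is_graph_inc gA)[_]]; exact/negP.
Qed.

End Gluing.

Section LogBounds.
Local Open Scope nat_scope.

Lemma ltn_lg c : c < 2 ^ (lg c).+1.
Proof.
apply: (@leq_trans (2 ^ (trunc_log 2 c).+1)); first exact: trunc_log_ltn.
by rewrite leq_exp2l // ltnS leq_maxr.
Qed.

Lemma lg_gt0 c : 0 < lg c. Proof. exact: leq_maxl. Qed.

Lemma lg_exp c n : c.+1 ^ n <= 2 ^ ((lg c).+1 * n).
Proof. by rewrite expnM; case: n => // n; rewrite leq_exp2r // ltn_lg. Qed.

End LogBounds.

(** * Simple graphs and degrees *)

Section Simple.
Local Open Scope fset_scope.
Local Open Scope nat_scope.

Lemma endpoints2 G e : is_graph G -> e \in eset G ->
  exists x y, [/\ x != y, x \in vset G, y \in vset G & endpoints G e = [fset x; y]].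
Proof.
move=> gG eG; have := (proj2 gG) e eG; case ep: (enum_fset (endpoints G e)) => [|x [|y []]] // _.
have epE z : (z \in endpoints G e) = (z \in [:: x; y]) by rewrite -ep.
exists x, y; split.
- by have := fset_uniq (endpoints G e); rewrite ep /= inE andbT.
- by have := epE x; rewrite !inE eqxx => /andP[].
- by have := epE y; rewrite !inE eqxx orbT => /andP[].
- by apply/fsetP => z; rewrite epE !inE.
Qed.

Lemma endpoints_sub G e : endpoints G e `<=` vset G.
Proof. by apply/fsubsetP => v /endpointsP[]. Qed.

Definition simple_sig k (S : {set 'I_k.+1}) (A : mgraph) : ({set 'I_k.+1 * 'I_k.+1} * bool)%type :=
  ([set p : 'I_k.+1 * 'I_k.+1 | `[< exists2 e, e \in eset A & endpoints A e = [fset (p.1 : nat); (p.2 : nat)] >]]%SET,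
   `[< simple A >]).

Lemma simple_inv : iso_invariant simple.
Proof.
move=> f g G gG fi gi sG _ _ /imfsetP[e1 /= e1G ->] /imfsetP[e2 /= e2G ->].
rewrite !endpoints_gimage // => ee; congr g; apply: sG => //.
apply/fsetP => v; apply/idP/idP => ve.
  have : f v \in f @` endpoints G e2 by rewrite -ee in_imfset.
  case/imfsetP => w /= we /fi -> //; [have /endpointsP[] // := ve|by have /endpointsP[] := we].
have : f v \in f @` endpoints G e1 by rewrite ee in_imfset.
case/imfsetP => w /= we /fi -> //; [have /endpointsP[] // := ve|by have /endpointsP[] := we].
Qed.

(** Parallel edges with one edge in [A'] and the other in [B] have active endpoints, and the
    signature then puts an edge of [A] between the same vertices. *)
Lemma simple_respects : respects simple simple_sig.
Proof.
move=> k S A A' B gl gl' [epairs esimple] sK.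
have gA := gl_left gl; have gA' := gl_left gl'; have gB := gl_right gl.
have dA := gl_edges gl; have dA' := gl_edges gl'.
have sA' : simple A'.
  apply/asboolP; rewrite -esimple; apply/asboolP => e1 e2 e1A e2A ee.
  by apply: sK; rewrite ?mem_gunion_edge ?e1A ?e2A // !endpoints_gunionl.
have mixed e1 e2 : e1 \in eset A' -> e2 \in eset B -> endpoints A' e1 <> endpoints B e2.
  move=> e1A e2B ee; have [x [y [xy xA yA ep]]] := endpoints2 gA' e1A.
  have /endpointsP[xB _] : x \in endpoints B e2 by rewrite -ee ep !inE eqxx.
  have /endpointsP[yB _] : y \in endpoints B e2 by rewrite -ee ep !inE eqxx orbT.
  have [u uS ex] := glued_boundary gl' xA xB; have [v vS ey] := glued_boundary gl' yA yB.
  move/setP: epairs => /(_ (u, v)); rewrite !inE /= -ex -ey => eq.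
  have : `[< exists2 e, e \in eset A' & endpoints A' e = [fset x; y] >] by apply/asboolP; exists e1.
  rewrite -eq => /asboolP[e3 e3A ep3].
  have e32 : e3 = e2.
    apply: sK; rewrite ?mem_gunion_edge ?e3A ?e2B ?orbT //.
    by rewrite endpoints_gunionl ?endpoints_gunionr // ep3 -ep ee.
  by have /fdisjointP/(_ _ e3A) := dA; rewrite e32 e2B.
move=> e1 e2; rewrite !mem_gunion_edge => /orP[e1A|e1B] /orP[e2A|e2B].
- by rewrite !endpoints_gunionl //; exact: sA'.
- by rewrite endpoints_gunionl ?endpoints_gunionr // => /mixed-/(_ e1A e2B).
- by rewrite endpoints_gunionr ?endpoints_gunionl // => /esym/mixed-/(_ e2A e1B).
- rewrite !endpoints_gunionr // => ee; apply: sK; rewrite ?mem_gunion_edge ?e1B ?e2B ?orbT //.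
  by rewrite !endpoints_gunionr.
Qed.

Theorem simple_core : exists A : nat,
     has_core simple (fun beta mu nu delta =>
       [/\ bigO A beta (fun k => k ^ 2), forall k, mu k = 1,
           exp_bigO A nu beta & exp_bigO A delta beta]).
Proof.
(* Here [beta] is [k ^ 2 + 3 * k + 5], and 9 is its value at the worst case [k = 1]. The constants
   of the later theorems are likewise values of [beta] at [k = 1] with all logarithms equal to 1. *)
exists 9; have H := has_deterministic_core simple_inv simple_respects
  (l := fun k => k.+1 * k.+1 + 1).
apply: (has_core_weaken (H _)) => [k|beta mu nu delta [eb em nuB deltaB]].
  rewrite card_prod card_bool expnD leq_mul2r orbC.
  by rewrite -cardsT -powersetT card_powerset cardsT card_prod card_ord leqnn.
split=> //.
- by move=> k k0; rewrite eb; nia.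
- by move=> k k0; apply: leq_trans (nuB k k0) _; rewrite leq_exp2l //; lia.
- by move=> k k0; apply: leq_trans (deltaB k k0) _; rewrite leq_exp2l //; lia.
Qed.

End Simple.

Section Degrees.
Local Open Scope fset_scope.
Local Open Scope nat_scope.

Lemma degree_gimage f g G v : is_graph G -> {in vset G &, injective f} ->
  {in eset G &, injective g} -> v \in vset G -> degree (gimage f g G) (f v) = degree G v.
Proof.
move=> gG fi gi vG; rewrite /degree.
rewrite (_ : [fset e in eset (gimage f g G) | _] = g @` [fset e in eset G | (e, v) \in inc G]).
  by rewrite card_in_imfset //= => e e'; rewrite !inE => /andP[+ _] /andP[+ _]; exact: gi.
apply/fsetP => e; apply/idP/imfsetP => [|[e' /=]].
  rewrite !inE => /andP[/imfsetP[e' /= e'G ->]]; rewrite inc_gimage // => i.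
  by exists e'; rewrite // !inE e'G.
by rewrite !inE => /andP[e'G i] ->; rewrite in_imfset //= inc_gimage.
Qed.

(** Whether a sum of two degrees reaches [c] depends only on the summands cut off at [c]. *)
Definition capped_degree k c (A : mgraph) : {ffun 'I_k.+1 -> 'I_c.+1} :=
  [ffun u : 'I_k.+1 => inord (minn (degree A u) c)].

Lemma capped_degreeE k c A A' (u : 'I_k.+1) : capped_degree k c A = capped_degree k c A' ->
  minn (degree A u) c = minn (degree A' u) c.
Proof.
move=> /ffunP/(_ u)/(congr1 val) /=; rewrite !ffunE !inordK // ltnS geq_minr //.
Qed.

Section MaxDegree.
Variable c : nat.

Definition max_deg_sig k (S : {set 'I_k.+1}) (A : mgraph) : ({ffun 'I_k.+1 -> 'I_c.+1} * bool)%type :=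
  (capped_degree k c A, `[< max_deg_ge c A >]).

Lemma max_deg_inv : iso_invariant (max_deg_ge c).
Proof.
move=> f g G gG fi gi [v vG cv]; exists (f v); first exact: in_imfset.
by rewrite degree_gimage.
Qed.

Lemma max_deg_respects : respects (max_deg_ge c) max_deg_sig.
Proof.
move=> k S A A' B gl gl' [edeg eflag] [v]; rewrite mem_gunion_vertex => vK.
rewrite (degree_gunion v gl) => cv.
have [vB|vB] := boolP (v \in vset B).
  exists v; rewrite ?mem_gunion_vertex ?vB ?orbT // (degree_gunion v gl').
  have [vA|vA] := boolP (v \in vset A).
    have [u uS eu] := glued_boundary gl vA vB.
    have := capped_degreeE u edeg; rewrite -eu; lia.
  by move: cv; rewrite (degree_notin (gl_left gl) vA); lia.
have vA : v \in vset A by move: vK; rewrite (negPf vB) orbF.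
have : `[< max_deg_ge c A >].
  by apply/asboolP; exists v => //; move: cv; rewrite (degree_notin (gl_right gl) vB) addn0.
rewrite eflag => /asboolP[w wA cw]; exists w; first by rewrite mem_gunion_vertex wA.
by rewrite (degree_gunion w gl') (leq_trans cw) // leq_addr.
Qed.

End MaxDegree.

Theorem max_deg_core : exists A : nat, forall c : nat,
     has_core (max_deg_ge c) (fun beta mu nu delta =>
       [/\ bigO A beta (fun k => k * lg c), forall k, mu k = 1,
           exp_bigO A nu beta & exp_bigO A delta beta]).
Proof.
exists 9 => c; have H := has_deterministic_core (max_deg_inv (c := c)) (max_deg_respects (c := c))
  (l := fun k => (lg c).+1 * k.+1 + 1).
apply: (has_core_weaken (H _)) => [k|beta mu nu delta [eb em nuB deltaB]].
  rewrite card_prod card_bool expnD leq_mul2r orbC.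
  by rewrite card_ffun !card_ord lg_exp.
split=> //.
- by move=> k k0; rewrite eb; have := lg_gt0 c; nia.
- by move=> k k0; apply: leq_trans (nuB k k0) _; rewrite leq_exp2l //; lia.
- by move=> k k0; apply: leq_trans (deltaB k k0) _; rewrite leq_exp2l //; lia.
Qed.

Section MinDegree.
Variable c : nat.

(** The cap is [c.+1] because exceeding [c] has to be detected. The flag concerns inner vertices
    only: an active vertex may still receive edges from [B]. *)
Definition min_deg_sig k (S : {set 'I_k.+1}) (A : mgraph) : ({ffun 'I_k.+1 -> 'I_c.+2} * bool)%type :=
  (capped_degree k c.+1 A, `[< exists v, [/\ v \in vset A, k < v & degree A v <= c] >]).

Lemma min_deg_inv : iso_invariant (min_deg_le c).
Proof.
move=> f g G gG fi gi [v vG cv]; exists (f v); first exact: in_imfset.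
by rewrite degree_gimage.
Qed.

Lemma min_deg_respects : respects (min_deg_le c) min_deg_sig.
Proof.
move=> k S A A' B gl gl' [edeg eflag] [v]; rewrite mem_gunion_vertex => vK.
rewrite (degree_gunion v gl) => cv.
have [vB|vB] := boolP (v \in vset B).
  exists v; rewrite ?mem_gunion_vertex ?vB ?orbT // (degree_gunion v gl').
  have [vA|vA] := boolP (v \in vset A).
    have [u uS eu] := glued_boundary gl vA vB.
    have := capped_degreeE u edeg; rewrite -eu; lia.
  rewrite degree_notin ?(glued_same gl gl') //; last exact: gl_left gl'.
  exact: leq_trans (leq_addl _ _) cv.
have vA : v \in vset A by move: vK; rewrite (negPf vB) orbF.
have : `[< exists v, [/\ v \in vset A, k < v & degree A v <= c] >].
  apply/asboolP; exists v; split=> //; last exact: leq_trans (leq_addr _ _) cv.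
  by move: vB; rewrite (glued_inner gl vA) -leqNgt.
rewrite eflag => /asboolP[w [wA kw cw]]; exists w; first by rewrite mem_gunion_vertex wA.
rewrite (degree_gunion w gl') [degree B w]degree_notin ?addn0 //; first exact: gl_right gl.
by rewrite (glued_inner gl' wA) -leqNgt.
Qed.

End MinDegree.

Theorem min_deg_core : exists A : nat, forall c : nat,
     has_core (min_deg_le c) (fun beta mu nu delta =>
       [/\ bigO A beta (fun k => k * lg c), forall k, mu k = 1,
           exp_bigO A nu beta & exp_bigO A delta beta]).
Proof.
exists 11 => c; have H := has_deterministic_core (min_deg_inv (c := c)) (min_deg_respects (c := c))
  (l := fun k => (lg c).+2 * k.+1 + 1).
apply: (has_core_weaken (H _)) => [k|beta mu nu delta [eb em nuB deltaB]].
  rewrite card_prod card_bool expnD leq_mul2r orbC.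
  rewrite card_ffun !card_ord expnM leq_exp2r // !expnS.
  by have := ltn_lg c; rewrite expnS; lia.
split=> //.
- by move=> k k0; rewrite eb; have := lg_gt0 c; nia.
- by move=> k k0; apply: leq_trans (nuB k k0) _; rewrite leq_exp2l //; lia.
- by move=> k k0; apply: leq_trans (deltaB k k0) _; rewrite leq_exp2l //; lia.
Qed.

End Degrees.

(** * Colourings and flows *)

Section Colorable.
Local Open Scope fset_scope.
Local Open Scope nat_scope.

Lemma card_set_type (T : finType) : #|{: {set T}}| = 2 ^ #|T|.
Proof. by rewrite -(cardsT T) -card_powerset powersetT cardsT. Qed.

Lemma has_core_of_set_sig P (T : nat -> finType) (sig : forall k, {set 'I_k.+1} -> mgraph -> T k) l :
  iso_invariant P -> respects P sig -> (forall k, #|T k| <= 2 ^ 2 ^ l k) ->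
  has_core P (fun beta mu nu delta =>
    [/\ forall k, beta k = l k + k + 4, forall k, mu k = 2 ^ beta k,
        exp_bigO 2 nu beta & exp2_bigO 1 delta beta]).
Proof.
move=> inv resp card; have H := has_powerset_core inv resp card.
apply: (has_core_weaken H) => beta mu nu delta [eb em nuB deltaB]; split=> //.
move=> k k0; apply: leq_trans (deltaB k k0) _; do 2 rewrite leq_exp2l //.
by rewrite !mul1n eb leq_add2l.
Qed.

Lemma has_core_of_set_sig_bigO P (T : nat -> finType) (sig : forall k, {set 'I_k.+1} -> mgraph -> T k) l A g :
  iso_invariant P -> respects P sig -> (forall k, #|T k| <= 2 ^ 2 ^ l k) ->
  1 < A -> bigO A (fun k => l k + k + 4) g ->
  has_core P (fun beta mu nu delta =>
    [/\ bigO A beta g, exp_bigO A mu beta, exp_bigO A nu beta & exp2_bigO A delta beta]).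
Proof.
move=> inv resp card A1 bg; have H := has_core_of_set_sig inv resp card.
apply: (has_core_weaken H) => beta mu nu delta [eb em nuB deltaB]; split=> k k0.
- by rewrite eb; exact: bg.
- by rewrite em leq_exp2l // leq_pmull // ltnW.
- by apply: leq_trans (nuB k k0) _; rewrite leq_exp2l // leq_mul2r A1 orbT.
- apply: leq_trans (deltaB k k0) _; do 2 rewrite leq_exp2l //.
  by rewrite leq_mul2r ltnW ?orbT.
Qed.

Lemma adjP G u v : reflect (u <> v /\ exists e, [/\ e \in eset G, (e, u) \in inc G & (e, v) \in inc G])
  (adj G u v).
Proof.
apply: (iffP andP) => -[/eqP uv]; first by move=> /hasP[e eG /andP[iu iv]]; split=> //; exists e.
by move=> [e [eG iu iv]]; split=> //; apply/hasP; exists e; rewrite ?iu.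
Qed.

Lemma colorableE c G : is_graph G -> (colorable c G <-> has_coloring c G).
Proof.
move=> gG; split=> [[x [[col [colx colp]] _] xc]|hc].
  by exists col; split=> // v vG; exact: leq_trans (colx v vG) xc.
have ex : exists n, `[< has_coloring n G >] by exists c; apply/asboolP.
have /asboolP h1 := ex_minnP ex; case: ex_minnP h1 => n /asboolP hn minn _.
exists n; last by apply: minn; apply/asboolP.
by split=> // d hd; apply: minn; apply/asboolP.
Qed.

(** Quantifying over the incidences of one edge lets each constraint be settled on the side of the
    gluing that contains the edge. *)
Definition proper_coloring c (col : nat -> nat) G : Prop :=
  {in vset G, forall v, col v < c} /\
  forall e u v, u <> v -> (e, u) \in inc G -> (e, v) \in inc G -> col u <> col v.

Lemma has_coloringE c G : is_graph G ->
  (has_coloring c G <-> exists col, proper_coloring c col G).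
Proof.
move=> gG; split=> -[col [colc colp]]; exists col; split=> //.
  move=> e u v uv iu iv; have [eG uG] := is_graph_inc gG iu; have [_ vG] := is_graph_inc gG iv.
  by apply: colp => //; apply/adjP; split=> //; exists e.
by move=> u v uG vG /adjP[uv [e [eG iu iv]]]; exact: colp iu iv.
Qed.

Variable c : nat.

(** [proper_coloring] keeps the colours below [c]; the type ['I_c.+1] makes [inord] available for
    [c = 0] as well. *)
Definition color_sig k (S : {set 'I_k.+1}) (A : mgraph) : {set {ffun 'I_k.+1 -> 'I_c.+1}} :=
  [set f : {ffun 'I_k.+1 -> 'I_c.+1} | `[< exists col, proper_coloring c col A /\
     forall u : 'I_k.+1, u \in S -> col u = f u >]]%SET.

Lemma colorable_inv : iso_invariant (colorable c).
Proof.
move=> f g G gG fi gi /(colorableE _ gG)/(has_coloringE _ gG)[col [colc colp]].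
have gG' := is_graph_gimage gG fi gi.
apply/(colorableE _ gG')/(has_coloringE _ gG'); have [f' fK] := left_inverse_in fi.
exists (fun v => col (f' v)); split; first by move=> _ /imfsetP[v /= vG ->]; rewrite fK // colc.
move=> e x y xy /imfsetP[[e1 u] /= iu [e1E ex]] /imfsetP[[e2 v] /= iv [ee ey]].
move: ee xy; rewrite e1E ex ey => ee.
have [e1G uG] := is_graph_inc gG iu; have [e2G vG] := is_graph_inc gG iv.
rewrite !fK // => uv; apply: (colp e1) => //; first by move=> e'; apply: uv; rewrite e'.
by rewrite (gi _ _ e1G e2G ee).
Qed.

Lemma colorable_respects : respects (colorable c) color_sig.
Proof.
move=> k S A A' B gl gl' esig /(colorableE _ (glued_graph gl))/(has_coloringE _ (glued_graph gl)).
move=> [col [colc colp]].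
apply/(colorableE _ (glued_graph gl'))/(has_coloringE _ (glued_graph gl')).
pose f : {ffun 'I_k.+1 -> 'I_c.+1} := [ffun u : 'I_k.+1 => inord (col u)].
have fE (u : 'I_k.+1) : u \in S -> col u = f u.
  move=> uS; rewrite ffunE inordK // ltnS ltnW // colc // mem_gunion_vertex.
  by rewrite (gl_active gl) uS.
have /setP/(_ f) := esig; rewrite !inE => /esym eq.
have : `[< exists col, proper_coloring c col A /\ forall u : 'I_k.+1, u \in S -> col u = f u >].
  apply/asboolP; exists col; split=> //; split.
    by move=> v vA; apply: colc; rewrite mem_gunion_vertex vA.
  by move=> e u v uv iu iv; apply: (colp e) => //; rewrite inE ?iu ?iv.
rewrite -eq => /asboolP[col' [[colc' colp'] fE']].
have agree (u : 'I_k.+1) : u \in S -> col' u = col u by move=> uS; rewrite fE // fE'.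
exists (splice (vset A') col' col); split.
  move=> v; rewrite mem_gunion_vertex; case: (boolP (v \in vset A')) => [vA _|_ /= vB].
    by rewrite splicel // colc'.
  by rewrite (splicer gl' agree vB) colc // mem_gunion_vertex vB orbT.
move=> e u v uv iu iv; have gA' := gl_left gl'; have gB := gl_right gl'.
have [eK _] := is_graph_inc (glued_graph gl') iu.
move: (eK); rewrite mem_gunion_edge => /orP[eA|eB].
  move: iu iv; rewrite !(inc_gunionl _ gA' gB (gl_edges gl') eA) => iu iv.
  have [_ uA] := is_graph_inc gA' iu; have [_ vA] := is_graph_inc gA' iv.
  by rewrite !splicel //; exact: colp' iu iv.
move: iu iv; rewrite !(inc_gunionr _ gA' gB (gl_edges gl') eB) => iu iv.
have [_ uB] := is_graph_inc gB iu; have [_ vB] := is_graph_inc gB iv.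
by rewrite !(splicer gl' agree) //; apply: (colp e) => //; rewrite inE ?iu ?iv orbT.
Qed.

End Colorable.

Theorem colorable_core : exists A : nat, forall c : nat,
     has_core (colorable c) (fun beta mu nu delta =>
       [/\ bigO A beta (fun k => k * lg c), exp_bigO A mu beta,
           exp_bigO A nu beta & exp2_bigO A delta beta]).
Proof.
exists 9 => c; apply: (has_core_of_set_sig_bigO (colorable_inv (c := c)) (colorable_respects (c := c))
  (l := fun k => (lg c).+1 * k.+1)) => // [k|k k0].
  by rewrite card_set_type card_ffun !card_ord leq_exp2l // lg_exp.
by have := lg_gt0 c; nia.
Qed.

Section Flow.
Local Open Scope fset_scope.
Local Open Scope nat_scope.

Lemma big_fsetU_disjoint (X Y : {fset nat}) (p : pred nat) (F : nat -> nat) : [disjoint X & Y] ->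
  \sum_(e <- X `|` Y | p e) F e = \sum_(e <- X | p e) F e + \sum_(e <- Y | p e) F e.
Proof.
move=> /fdisjointP dis; rewrite -big_cat; apply: perm_big; apply: uniq_perm.
- exact: fset_uniq.
- rewrite cat_uniq !fset_uniq /= andbT; apply/hasPn => y yY; apply/negP => yX.
  by have := dis _ yX; rewrite yY.
- by move=> x; rewrite mem_cat inE.
Qed.

Variable m : nat.

(** [d] is the inflow still missing at [v], to be supplied from the other side of the gluing. *)
Definition flow_at (src tgt phi : nat -> nat) G v (d : nat) : Prop :=
  \sum_(e <- eset G | tgt e == v) phi e + d = \sum_(e <- eset G | src e == v) phi e %[mod m].

Definition flow_edges (src tgt phi : nat -> nat) G : Prop :=
  {in eset G, forall e, endpoints G e = [fset src e; tgt e]} /\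
  {in eset G, forall e, 0 < phi e < m}.

Lemma nzflowE G : nzflow m G <-> exists src tgt phi, flow_edges src tgt phi G /\
  {in vset G, forall v, flow_at src tgt phi G v 0}.
Proof.
split=> -[src [tgt [phi]]].
  move=> [ep ph fl]; exists src, tgt, phi; split=> // v vG.
  by rewrite /flow_at addn0 fl.
by move=> [[ep ph] fl]; exists src, tgt, phi; split=> // v /fl; rewrite /flow_at addn0.
Qed.

Lemma flow_notin src tgt phi G v : flow_edges src tgt phi G -> v \notin vset G ->
  \sum_(e <- eset G | tgt e == v) phi e = 0 /\ \sum_(e <- eset G | src e == v) phi e = 0.
Proof.
move=> [ep _] vG; split; rewrite big_seq_cond big1 // => e /andP[eG /eqP ev];
by move: vG; rewrite -ev; have /fsubsetP/(_ v) := endpoints_sub G e; rewrite ep // !inE -ev eqxx ?orbT => ->.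
Qed.

Lemma nzflow_inv : iso_invariant (nzflow m).
Proof.
move=> f g G gG fi gi /nzflowE[src [tgt [phi [fe fl]]]].
have [f' fK] := left_inverse_in fi; have [g' gK] := left_inverse_in gi.
have srcG e : e \in eset G -> src e \in vset G.
  by move=> eG; have /fsubsetP := endpoints_sub G e; apply; rewrite (proj1 fe) // !inE eqxx.
have tgtG e : e \in eset G -> tgt e \in vset G.
  by move=> eG; have /fsubsetP := endpoints_sub G e; apply; rewrite (proj1 fe) // !inE eqxx orbT.
apply/nzflowE; exists (fun e => f (src (g' e))), (fun e => f (tgt (g' e))), (fun e => phi (g' e)).
split; first split.
- by move=> _ /imfsetP[e /= eG ->]; rewrite gK // endpoints_gimage // (proj1 fe) // imfset_fset2.
- by move=> _ /imfsetP[e /= eG ->]; rewrite gK //; exact: (proj2 fe).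
have sumE (h : nat -> nat) v : v \in vset G -> {in eset G, forall e, h e \in vset G} ->
    \sum_(e <- g @` eset G | f (h (g' e)) == f v) phi (g' e) = \sum_(e <- eset G | h e == v) phi e.
  move=> vG hG; rewrite big_mkcond big_imfset //= [RHS]big_mkcond big_seq [RHS]big_seq.
  apply: eq_bigr => e eG; rewrite gK //.
  by rewrite (inj_in_eq fi) //; exact: hG.
by move=> _ /imfsetP[v /= vG ->]; rewrite /flow_at !sumE //; exact: fl.
Qed.

Definition flow_sig k (S : {set 'I_k.+1}) (A : mgraph) : {set {ffun 'I_k.+1 -> 'I_m.-1.+1}} :=
  [set d : {ffun 'I_k.+1 -> 'I_m.-1.+1} | `[< exists src tgt phi, [/\ flow_edges src tgt phi A,
     {in vset A, forall v, k < v -> flow_at src tgt phi A v 0}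
     & forall u : 'I_k.+1, u \in S -> flow_at src tgt phi A u (d u)] >]]%SET.

Lemma flow_at_gunion src tgt phi k (S : {set 'I_k.+1}) A B v d : glued S A B ->
  flow_at src tgt phi (gunion A B) v d <->
  \sum_(e <- eset A | tgt e == v) phi e + \sum_(e <- eset B | tgt e == v) phi e + d =
  \sum_(e <- eset A | src e == v) phi e + \sum_(e <- eset B | src e == v) phi e %[mod m].
Proof. by move=> gl; rewrite /flow_at !big_fsetU_disjoint //; case: gl. Qed.

Lemma nzflow_respects : 0 < m -> respects (nzflow m) flow_sig.
Proof.
move=> m0 k S A A' B gl gl' esig /nzflowE[src [tgt [phi [[ep ph] fl]]]].
have gA := gl_left gl; have gB := gl_right gl; have dA := gl_edges gl.
have gA' := gl_left gl'; have dA' := gl_edges gl'.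
have feA : flow_edges src tgt phi A.
  split=> e eA; last by apply: ph; rewrite mem_gunion_edge eA.
  by rewrite -ep ?mem_gunion_edge ?eA // endpoints_gunionl.
have feB : flow_edges src tgt phi B.
  split=> e eB; last by apply: ph; rewrite mem_gunion_edge eB orbT.
  by rewrite -ep ?mem_gunion_edge ?eB ?orbT // endpoints_gunionr.
pose i v := \sum_(e <- eset A | tgt e == v) phi e; pose o v := \sum_(e <- eset A | src e == v) phi e.
(* The residue of [o u - i u], written so that the subtraction is not truncated. *)
pose d : {ffun 'I_k.+1 -> 'I_m.-1.+1} := [ffun u : 'I_k.+1 => inord ((o u + (m - i u %% m)) %% m)].
have dE (u : 'I_k.+1) : i u + d u = o u %[mod m].
  rewrite ffunE inordK ?prednK ?ltn_mod // modnDmr addnCA -modnDmr -[in X in _ + X]modnDml subnKC.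
    by rewrite modnn addn0.
  by rewrite ltnW // ltn_mod.
have /setP/(_ d) := esig; rewrite !inE => /esym eq.
have : `[< exists src tgt phi, [/\ flow_edges src tgt phi A,
     {in vset A, forall v, k < v -> flow_at src tgt phi A v 0}
     & forall u : 'I_k.+1, u \in S -> flow_at src tgt phi A u (d u)] >].
  apply/asboolP; exists src, tgt, phi; split=> //; last by move=> u uS; exact: dE.
  move=> v vA kv.
  have vB : v \notin vset B by rewrite (glued_inner gl vA) -leqNgt.
  have := fl v; rewrite mem_gunion_vertex vA => /(_ isT) /(flow_at_gunion _ _ _ _ _ gl).
  by have [-> ->] := flow_notin feB vB; rewrite !addn0 /flow_at addn0.
rewrite -eq => /asboolP[src' [tgt' [phi' [[ep' ph'] flA' flS']]]].
pose E := eset A'; apply/nzflowE; exists (splice E src' src), (splice E tgt' tgt), (splice E phi' phi).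
split; first split.
- move=> e; rewrite mem_gunion_edge => /orP[eA|eB].
    by rewrite endpoints_gunionl // !splicel // ep'.
  by rewrite endpoints_gunionr // !(splice_edger _ _ gl' eB) (proj1 feB).
- move=> e; rewrite mem_gunion_edge => /orP[eA|eB]; first by rewrite splicel // ph'.
  by rewrite (splice_edger _ _ gl' eB) (proj2 feB).
move=> v vK; apply/(flow_at_gunion _ _ _ _ _ gl').
have sumA (h h' : nat -> nat) : \sum_(e <- eset A' | splice E h' h e == v) splice E phi' phi e =
    \sum_(e <- eset A' | h' e == v) phi' e.
  rewrite big_mkcond [RHS]big_mkcond big_seq [RHS]big_seq; apply: eq_bigr => e eA.
  by rewrite !splicel.
have sumB (h h' : nat -> nat) : \sum_(e <- eset B | splice E h' h e == v) splice E phi' phi e =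
    \sum_(e <- eset B | h e == v) phi e.
  rewrite big_mkcond [RHS]big_mkcond big_seq [RHS]big_seq; apply: eq_bigr => e eB.
  by rewrite !(splice_edger _ _ gl' eB).
rewrite !sumA !sumB addn0.
have [vA|vA] := boolP (v \in vset A'); last first.
  have [-> ->] := flow_notin (conj ep' ph') vA; rewrite !add0n.
  have vB : v \in vset B by move: vK; rewrite mem_gunion_vertex (negPf vA).
  have := fl v; rewrite mem_gunion_vertex vB orbT => /(_ isT) /(flow_at_gunion _ _ _ _ _ gl).
  have [|-> ->] := flow_notin feA (v := v); first by rewrite -(glued_same gl gl').
  by rewrite !add0n addn0.
have [vB|vB] := boolP (v \in vset B); last first.
  have [-> ->] := flow_notin feB vB; rewrite !addn0.
  have := flA' v vA; rewrite /flow_at addn0; apply.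
  by move: vB; rewrite (glued_inner gl' vA) -leqNgt.
have [u uS ev] := glued_boundary gl' vA vB.
have := fl v; rewrite mem_gunion_vertex vB orbT => /(_ isT) /(flow_at_gunion _ _ _ _ _ gl).
have := flS' u uS; have := dE u; rewrite /flow_at /i /o -ev addn0.
set iA := \sum_(e <- eset A | tgt e == v) _; set oA := \sum_(e <- eset A | src e == v) _.
set iB := \sum_(e <- eset B | tgt e == v) _; set oB := \sum_(e <- eset B | src e == v) _.
set iA' := \sum_(e <- eset A' | _) _; set oA' := \sum_(e <- eset A' | src' e == v) _.
move=> e1 e2 e3.
(* Cancelling [iA] shows that [B] supplies exactly the demand [d u], which is also what [A'] leaves
   open. *)
have e4 : iB = d u + oB %[mod m].
  by apply/eqP; rewrite -(eqn_modDl iA) addnA; apply/eqP; rewrite e3 -modnDml -e1 modnDml.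
by rewrite -modnDmr e4 modnDmr addnA -modnDml e2 modnDml.
Qed.

End Flow.

Section FlowCore.
Local Open Scope nat_scope.

Theorem nzflow_core : exists A : nat, forall m : nat, 0 < m ->
     has_core (nzflow m) (fun beta mu nu delta =>
       [/\ bigO A beta (fun k => k * lg m), exp_bigO A mu beta,
           exp_bigO A nu beta & exp2_bigO A delta beta]).
Proof.
exists 9 => m m0; apply: (has_core_of_set_sig_bigO (@nzflow_inv m) (nzflow_respects m0)
  (l := fun k => (lg m).+1 * k.+1)) => // [k|k k0].
  rewrite card_set_type card_ffun !card_ord prednK // leq_exp2l //.
  by apply: leq_trans (lg_exp m k.+1); rewrite leq_exp2r.
by have := lg_gt0 m; nia.
Qed.

End FlowCore.

(** * Edge and vertex cuts *)

Section Cuts.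
Local Open Scope fset_scope.
Local Open Scope nat_scope.

Lemma has_core_iff P Q bd : (forall G, is_graph G -> (P G <-> Q G)) -> has_core P bd -> has_core Q bd.
Proof.
move=> PQ [C [b [m [n [d [co re me h]]]]]]; exists C, b, m, n, d; split=> // G gG.
by rewrite -PQ //; exact: re.
Qed.

Lemma iso_invariant_not P : iso_invariant P -> iso_invariant (fun G => ~ P G).
Proof.
move=> inv f g G gG fi gi nP PG'; apply: nP.
have gG' := is_graph_gimage gG fi gi.
exact/(iso_invariantP inv gG gG' (gimage_isomorphic gG fi gi)).
Qed.

Lemma iso_invariant_or P Q : iso_invariant P -> iso_invariant Q -> iso_invariant (fun G => P G \/ Q G).
Proof. by move=> iP iQ f g G gG fi gi [h|h]; [left; exact: iP|right; exact: iQ]. Qed.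

Lemma respects_not P (T : nat -> finType) (sig : forall k, {set 'I_k.+1} -> mgraph -> T k) :
  respects P sig -> respects (fun G => ~ P G) sig.
Proof. by move=> r k S A A' B gl gl' e nP PK; apply/nP/(r k S A' A B gl' gl (esym e)). Qed.

Lemma respects_or P Q (T U : nat -> finType) (sig : forall k, {set 'I_k.+1} -> mgraph -> T k)
  (sig' : forall k, {set 'I_k.+1} -> mgraph -> U k) :
  respects P sig -> respects Q sig' ->
  respects (T := fun k => (T k * U k)%type) (fun G => P G \/ Q G) (fun k S A => (sig k S A, sig' k S A)).
Proof.
move=> rP rQ k S A A' B gl gl' [e e'] [h|h]; [left; exact: (rP k S A)|right; exact: (rQ k S A)].
Qed.

Definition at_most c (G : mgraph) : Prop := #|` vset G| <= c.

Definition size_sig c k (S : {set 'I_k.+1}) (A : mgraph) : 'I_c.+2 := inord (minn #|` vset A| c.+1).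

Lemma at_most_inv c : iso_invariant (at_most c).
Proof. by move=> f g G gG fi gi; rewrite /at_most /= card_in_imfset. Qed.

Lemma at_most_respects c : respects (at_most c) (size_sig c).
Proof.
move=> k S A A' B gl gl' /(congr1 val); rewrite /= !inordK ?ltnS ?geq_minr // => e.
have cardU X : #|` vset (gunion X B)| = #|` vset X| + #|` vset B `\` vset X|.
  rewrite /= (_ : _ `|` _ = vset X `|` (vset B `\` vset X)).
    rewrite cardfsU disjoint_fsetI0 ?cardfs0 ?subn0 //.
    by apply/fdisjointP => x xX; rewrite !inE xX.
  by apply/fsetP => x; rewrite !inE; case: (x \in vset X).
rewrite /at_most !cardU (_ : vset B `\` vset A' = vset B `\` vset A); first by lia.
by apply/fsetP => x; rewrite !inE andbC [RHS]andbC; apply: andb_id2l => xB; rewrite (glued_same gl gl').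
Qed.

Definition monochrome (chi : nat -> bool) G : Prop :=
  forall e u v, (e, u) \in inc G -> (e, v) \in inc G -> chi u = chi v.

Definition separated G : Prop := exists chi : nat -> bool,
  [/\ monochrome chi G, exists2 u, u \in vset G & chi u & exists2 v, v \in vset G & ~~ chi v].

(** All that the colouring form of connectivity requires; after a deletion it holds without counting
    endpoints again. *)
Definition inc_wf G : Prop := forall e v, (e, v) \in inc G -> e \in eset G /\ v \in vset G.

Lemma is_graph_wf G : is_graph G -> inc_wf G.
Proof. by move=> gG e v; exact: is_graph_inc. Qed.

(** For the converse, colour by reachability from [u]. Colourings, unlike paths, can be cut at the
    boundary and spliced. *)
Lemma connectedE G : inc_wf G -> (connected G <-> forall chi, monochrome chi G ->
  {in vset G &, forall u v, chi u = chi v}).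
Proof.
move=> wf; split=> [co chi mono u v uG vG|h u v uG vG].
  have [p pp <-] := co u v uG vG.
  elim: p u {uG} pp => //= w p IH u /andP[/adjP[_ [e [_ iu iw]]] /IH <-].
  exact: mono iu iw.
pose chi w := `[< exists2 p, path (adj G) u p & last u p = w >].
have /asboolP uu : chi u by apply/asboolP; exists [::].
have step e x y : (e, x) \in inc G -> (e, y) \in inc G -> chi x -> chi y.
  move=> ix iy /asboolP[p pp ex]; have [<-|xy] := eqVneq x y; first by apply/asboolP; exists p.
  apply/asboolP; exists (rcons p y); last by rewrite last_rcons.
  rewrite rcons_path pp ex; apply/adjP; split; first exact/eqP.
  by exists e; split=> //; case: (wf _ _ ix).
have mono : monochrome chi G.
  by move=> e x y ix iy; apply/idP/idP; [exact: step ix iy|exact: step iy ix].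
have := h chi mono u v uG vG; rewrite {1}/chi asboolT // => /esym/asboolP[p pp e].
by exists p.
Qed.

Lemma not_connectedE G : inc_wf G -> (~ connected G <-> separated G).
Proof.
move=> wf; rewrite (connectedE wf); split=> [h|[chi [mono [u uG cu] [v vG cv]]] h]; last first.
  by move: cv; rewrite -(h chi mono u v uG vG) cu.
apply: contrapT => ns; apply: h => chi mono u v uG vG.
apply: contrapT => /eqP; case cu: (chi u); case cv: (chi v) => // _; apply: ns; exists chi; split=> //.
- by exists u.
- by exists v; rewrite ?cv.
- by exists v.
- by exists u; rewrite ?cu.
Qed.

Definition crosses (chi : nat -> bool) (X : {fset nat}) : bool := has chi X && has (predC chi) X.

Definition crossing chi G : {fset nat} := [fset e in eset G | crosses chi (endpoints G e)].

Lemma crossesPn chi G e : is_graph G -> reflect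
  (forall u v, (e, u) \in inc G -> (e, v) \in inc G -> chi u = chi v) (~~ crosses chi (endpoints G e)).
Proof.
move=> gG; apply: (iffP idP) => [|h].
  rewrite negb_and => /orP[/hasPn h|/hasPn h] u v; rewrite -!(mem_endpoints _ _ gG) => iu iv.
    by rewrite (negPf (h _ iu)) (negPf (h _ iv)).
  by have := h _ iu; have := h _ iv; rewrite /= !negbK => -> ->.
apply/negP => /andP[/hasP[u +] + /hasP[v +]]; rewrite !mem_endpoints //= => iu cu iv.
by rewrite -(h _ _ iu iv) cu.
Qed.

Definition cut_le c G : Prop := exists chi : nat -> bool,
  [/\ #|` crossing chi G| <= c, exists2 u, u \in vset G & chi u & exists2 v, v \in vset G & ~~ chi v].

Lemma eq_crosses chi chi' (X : {fset nat}) : {in X, chi =1 chi'} -> crosses chi X = crosses chi' X.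
Proof. by move=> e; congr (_ && _); apply: eq_in_has => x xX /=; rewrite e. Qed.

Lemma endpoints_vset G e v : v \in endpoints G e -> v \in vset G.
Proof. by case/endpointsP. Qed.

Lemma cut_le_inv c : iso_invariant (cut_le c).
Proof.
move=> f g G gG fi gi [chi [cc [u uG cu] [v vG cv]]].
have [f' fK] := left_inverse_in fi; exists (fun v => chi (f' v)); split.
- rewrite (_ : crossing _ _ = g @` crossing chi G).
    by rewrite card_in_imfset //= => e e'; rewrite !inE => /andP[+ _] /andP[+ _]; exact: gi.
  have crossE e : e \in eset G -> crosses (fun v => chi (f' v)) (endpoints (gimage f g G) (g e)) =
      crosses chi (endpoints G e).
    move=> eG; have h q : has q (f @` endpoints G e) = has (q \o f) (endpoints G e).
      apply/hasP/hasP => [[_ /imfsetP[x /= xe ->] qx]|[x xe qx]]; first by exists x.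
      by exists (f x) => //; exact: in_imfset.
    rewrite endpoints_gimage // /crosses !h; congr (_ && _); apply: eq_in_has => x /endpoints_vset xG /=;
    by rewrite fK.
  apply/fsetP => e; apply/idP/imfsetP => [|[e' /=]].
    by rewrite !inE => /andP[/imfsetP[e' /= eG ->]]; rewrite crossE // => ce; exists e'; rewrite // !inE eG.
  by rewrite !inE => /andP[eG ce] ->; rewrite in_imfset //= crossE.
- by exists (f u); rewrite ?in_imfset ?fK.
- by exists (f v); rewrite ?in_imfset ?fK.
Qed.

Lemma card_crossing_gunion chi k (S : {set 'I_k.+1}) A B : glued S A B ->
  #|` crossing chi (gunion A B)| = #|` crossing chi A| + #|` crossing chi B|.
Proof.
case=> gA gB dis _ _ _; rewrite (_ : crossing _ _ = crossing chi A `|` crossing chi B).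
  rewrite cardfsU disjoint_fsetI0 ?cardfs0 ?subn0 //; apply/fdisjointP => e; rewrite !inE => /andP[eA _].
  by rewrite negb_and; move/fdisjointP: dis => ->.
apply/fsetP => e.
rewrite !inE.
have [eA|eA] := boolP (e \in eset A); have [eB|eB] := boolP (e \in eset B); rewrite //= ?orbF.
- by move/fdisjointP: dis => /(_ _ eA); rewrite eB.
- by rewrite endpoints_gunionl.
- by rewrite endpoints_gunionr.
Qed.

Lemma eq_crossing chi chi' G : {in vset G, chi =1 chi'} -> crossing chi G = crossing chi' G.
Proof.
move=> e; apply/fsetP => x; rewrite !inE; congr (_ && _); apply: eq_crosses => v /endpoints_vset; exact: e.
Qed.

(** An element describes a two-colouring of [A]: its trace, a bound on its crossing edges, and the
    colours it must use. The flags are needed because one side of a cut may lie wholly inside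
    [A]. *)
Definition cut_sig c k (S : {set 'I_k.+1}) (A : mgraph) :
    {set ({set 'I_k.+1} * 'I_c.+1) * (bool * bool)} :=
  [set p : ({set 'I_k.+1} * 'I_c.+1) * (bool * bool) | `[< exists chi : nat -> bool,
     [/\ forall u : 'I_k.+1, u \in S -> chi u = (u \in p.1.1), #|` crossing chi A| <= p.1.2,
         p.2.1 -> exists2 u, u \in vset A & chi u & p.2.2 -> exists2 v, v \in vset A & ~~ chi v] >]]%SET.

Lemma cut_le_respects c : respects (cut_le c) (cut_sig c).
Proof.
move=> k S A A' B gl gl' esig [chi [cc [u uK cu] [v vK cv]]].
have gA' := gl_left gl'; have gB := gl_right gl'.
have ccA : #|` crossing chi A| <= c.
  by apply: leq_trans cc; rewrite (card_crossing_gunion _ gl) leq_addr.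
pose p : ({set 'I_k.+1} * 'I_c.+1) * (bool * bool) :=
  ([set u : 'I_k.+1 | chi u]%SET, inord #|` crossing chi A|,
   (`[< exists2 u, u \in vset A & chi u >], `[< exists2 v, v \in vset A & ~~ chi v >])).
have : p \in cut_sig c S A.
  rewrite inE; apply/asboolP; exists chi; split=> /=.
  - by move=> w _; rewrite inE.
  - by rewrite inordK.
  - by move/asboolP.
  - by move/asboolP.
rewrite esig inE => /asboolP[chi' /= []].
rewrite inordK // => agree0 cc' ht hf.
have agree (w : 'I_k.+1) : w \in S -> chi' w = chi w by move=> wS; rewrite agree0 // inE.
have hA w : w \in vset A' -> splice (vset A') chi' chi w = chi' w by exact: splicel.
have hB w : w \in vset B -> splice (vset A') chi' chi w = chi w by exact: (splicer gl' agree).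
exists (splice (vset A') chi' chi); split.
- apply: leq_trans cc; rewrite (card_crossing_gunion _ gl) (card_crossing_gunion _ gl').
  by rewrite (eq_crossing hA) (eq_crossing hB) leq_add2r.
- move: uK; rewrite mem_gunion_vertex; have [uB _|uB] := boolP (u \in vset B).
    by exists u; rewrite ?hB // mem_gunion_vertex uB orbT.
  rewrite orbF => uA; have [|w wA cw] := ht; first by apply/asboolP; exists u.
  by exists w; rewrite ?hA // mem_gunion_vertex wA.
- move: vK; rewrite mem_gunion_vertex; have [vB _|vB] := boolP (v \in vset B).
    by exists v; rewrite ?hB // mem_gunion_vertex vB orbT.
  rewrite orbF => vA; have [|w wA cw] := hf; first by apply/asboolP; exists v.
  by exists w; rewrite ?hA // mem_gunion_vertex wA.
Qed.

Lemma connected_cut G : is_graph G -> (~ cut_le 0 G <-> connected G).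
Proof.
move=> gG; have -> : cut_le 0 G <-> separated G; last first.
  rewrite -(not_connectedE (is_graph_wf gG)); split; [exact: contrapT|by move=> h; apply].
split=> -[chi [h [u uG cu] [v vG cv]]]; exists chi; split; try by exists u.
- move: h; rewrite leqn0 cardfs_eq0 => /eqP/fsetP h e x y ix iy.
  have [eG _] := is_graph_inc gG ix.
  have := h e; rewrite !inE eG /= => /negbT/(crossesPn _ _ gG); exact.
- by exists v.
- rewrite leqn0 cardfs_eq0; apply/eqP/fsetP => e; rewrite !inE; apply/negP => /andP[_].
  by apply/negP/(crossesPn _ _ gG) => x y; exact: h.
- by exists v.
Qed.

(** Failure at [c.+1] bounds [Q] by [c], so the maximum exists; it is 0 for an empty [Q].
    Connectivity at most [c] thus becomes failure of [c.+1]-connectedness, which a cut or a lack of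
    vertices certifies. *)
Lemma is_max_le (Q : nat -> Prop) c : (forall i j, i <= j -> Q j -> Q i) ->
  ((exists2 x, is_max Q x & x <= c) <-> ~ Q c.+1).
Proof.
move=> down; split=> [[x mx xc] qc|nq].
  have := proj1 (mx x) (leqnn x) _ qc; lia.
have qc y : Q y -> y <= c by move=> qy; rewrite leqNgt; apply/negP => /down/(_ qy).
have [[y qy]|no] := lem (exists y, Q y); last first.
  by exists 0 => // b; split=> // _ x qx; case: no; exists x.
have ex : exists y, `[< Q y >] by exists y; apply/asboolP.
have bd y' : `[< Q y' >] -> y' <= c by move/asboolP/qc.
case: (ex_maxnP ex bd) => x /asboolP qx maxx; exists x; last exact: qc.
move=> b; split=> [xb z qz|]; last exact.
by apply: leq_trans xb; apply: maxx; apply/asboolP.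
Qed.

Lemma del_edges_wf G F : is_graph G -> inc_wf (del_edges G F).
Proof.
by move=> gG e v; rewrite !inE /= => /andP[/(is_graph_inc gG)[-> ->] ->].
Qed.

Lemma econn_le_cut c G : is_graph G -> (at_most 1 G \/ cut_le c G <-> econn_le c G).
Proof.
move=> gG; rewrite /econn_le /edge_connectivity is_max_le; last first.
  move=> i j ij [V1 co]; split=> // F sF cF; apply: co => //; exact: leq_trans ij.
split=> [h [V1 co]|h].
  case: h => [|[chi [cc [u uG cu] [v vG cv]]]]; first by rewrite /at_most leqNgt V1.
  have sF : crossing chi G `<=` eset G by apply/fsubsetP => e; rewrite !inE => /andP[].
  apply: (proj2 (not_connectedE (del_edges_wf gG)) _ (co _ sF cc)); exists chi; split.
  - move=> e x y; rewrite !inE /= => /andP[ix +] /andP[iy _]; have [-> _] := is_graph_inc gG ix.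
    by move=> /(crossesPn _ _ gG); apply.
  - by exists u.
  - by exists v.
have [V1|V1] := leqP #|` vset G| 1; [by left|right].
apply: contrapT => nc; apply: h; split=> // F sF cF; apply: contrapT.
move=> /(not_connectedE (del_edges_wf gG))[chi [mono [u uG cu] [v vG cv]]].
apply: nc; exists chi; split; [|by exists u|by exists v].
rewrite ltnS in cF; apply: leq_trans cF; apply: fsubset_leq_card; apply/fsubsetP => e.
rewrite !inE => /andP[eG]; apply: contraTT => eF; apply/(crossesPn _ _ gG) => x y ix iy.
by apply: (mono e); rewrite !inE ?ix ?iy.
Qed.

Definition vertex_cut_le c G : Prop := exists X chi : nat -> bool,
  [/\ #|` [fset v in vset G | X v]| <= c,
      forall e u v, (e, u) \in inc G -> (e, v) \in inc G -> ~~ X u -> ~~ X v -> chi u = chi v,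
      exists u, [/\ u \in vset G, ~~ X u & chi u] & exists v, [/\ v \in vset G, ~~ X v & ~~ chi v]].

Lemma vertex_cut_le_inv c : iso_invariant (vertex_cut_le c).
Proof.
move=> f g G gG fi gi [X [chi [cX mono [u [uG Xu cu]] [v [vG Xv cv]]]]].
have [f' fK] := left_inverse_in fi; exists (fun v => X (f' v)), (fun v => chi (f' v)); split.
- rewrite (_ : [fset v in _ | _] = f @` [fset v in vset G | X v]).
    by rewrite card_in_imfset //= => x y; rewrite !inE => /andP[+ _] /andP[+ _]; exact: fi.
  apply/fsetP => w; apply/idP/imfsetP => [|[x /=]].
    by rewrite !inE => /andP[/imfsetP[x /= xG ->]]; rewrite fK // => Xx; exists x; rewrite // !inE xG.
  by rewrite !inE => /andP[xG Xx] ->; rewrite in_imfset //= fK.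
- move=> e x y /imfsetP[[e1 a] /= ia [e1E ->]] /imfsetP[[e2 b] /= ib [ee ->]].
  have [e1G aG] := is_graph_inc gG ia; have [e2G bG] := is_graph_inc gG ib.
  rewrite !fK //; apply: (mono e1) => //.
  by rewrite (gi _ _ e1G e2G (etrans (esym e1E) ee)).
- by exists (f u); rewrite in_imfset ?fK.
- by exists (f v); rewrite in_imfset ?fK.
Qed.

(** Deleted vertices are counted only among the inner ones of [A]; the active ones are counted with
    [B], so none is counted twice. *)
Definition vertex_cut_sig c k (S : {set 'I_k.+1}) (A : mgraph) :
    {set (({set 'I_k.+1} * {set 'I_k.+1}) * 'I_c.+1) * (bool * bool)} :=
  [set p : (({set 'I_k.+1} * {set 'I_k.+1}) * 'I_c.+1) * (bool * bool) |
   `[< exists X chi : nat -> bool,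
     [/\ forall u : 'I_k.+1, u \in S -> X u = (u \in p.1.1.1) /\ chi u = (u \in p.1.1.2),
         #|` [fset v in vset A | (k < v) && X v]| <= p.1.2,
         forall e u v, (e, u) \in inc A -> (e, v) \in inc A -> ~~ X u -> ~~ X v -> chi u = chi v,
         p.2.1 -> exists u, [/\ u \in vset A, ~~ X u & chi u]
       & p.2.2 -> exists v, [/\ v \in vset A, ~~ X v & ~~ chi v]] >]]%SET.

Lemma card_vertices_gunion (X : nat -> bool) k (S : {set 'I_k.+1}) A B : glued S A B ->
  #|` [fset v in vset (gunion A B) | X v]| =
  #|` [fset v in vset A | (k < v) && X v]| + #|` [fset v in vset B | X v]|.
Proof.
move=> gl; rewrite (_ : [fset v in vset (gunion A B) | X v] =
  [fset v in vset A | (k < v) && X v] `|` [fset v in vset B | X v]).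
  rewrite cardfsU disjoint_fsetI0 ?cardfs0 ?subn0 //; apply/fdisjointP => v; rewrite !inE.
  by move=> /and3P[vA kv _]; rewrite (glued_inner gl vA) ltnNge kv.
apply/fsetP => v; rewrite !inE.
have [vA|//] := boolP (v \in vset A); rewrite (glued_inner gl vA) ltnNge /=.
by case: leqP => _; rewrite ?orbF.
Qed.

Lemma vertex_cut_le_respects c : respects (vertex_cut_le c) (vertex_cut_sig c).
Proof.
move=> k S A A' B gl gl' esig [X [chi [cX mono [u [uK Xu cu]] [v [vK Xv cv]]]]].
have gA' := gl_left gl'; have gB := gl_right gl'.
have cXA : #|` [fset v in vset A | (k < v) && X v]| <= c.
  by apply: leq_trans cX; rewrite (card_vertices_gunion _ gl) leq_addr.
pose p : (({set 'I_k.+1} * {set 'I_k.+1}) * 'I_c.+1) * (bool * bool) :=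
  (([set u : 'I_k.+1 | X u]%SET, [set u : 'I_k.+1 | chi u]%SET),
   inord #|` [fset v in vset A | (k < v) && X v]|,
   (`[< exists u, [/\ u \in vset A, ~~ X u & chi u] >],
    `[< exists v, [/\ v \in vset A, ~~ X v & ~~ chi v] >])).
have : p \in vertex_cut_sig c S A.
  rewrite inE; apply/asboolP; exists X, chi; split=> /=.
  - by move=> w _; rewrite !inE.
  - by rewrite inordK.
  - by move=> e x y ix iy; apply: (mono e); rewrite inE ?ix ?iy.
  - by move/asboolP.
  - by move/asboolP.
rewrite esig inE => /asboolP[X' [chi' /= []]].
rewrite inordK // => agree0 cc' mono' ht hf.
have agreeX (w : 'I_k.+1) : w \in S -> X' w = X w by move=> /agree0[-> _]; rewrite inE.
have agree (w : 'I_k.+1) : w \in S -> chi' w = chi w by move=> /agree0[_ ->]; rewrite inE.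
pose h := splice (vset A') chi' chi; pose Y := splice (vset A') X' X.
have hA w : w \in vset A' -> h w = chi' w by exact: splicel.
have hB w : w \in vset B -> h w = chi w by exact: (splicer gl' agree).
have YA w : w \in vset A' -> Y w = X' w by exact: splicel.
have YB w : w \in vset B -> Y w = X w by exact: (splicer gl' agreeX).
exists Y, h; split.
- apply: leq_trans cX; rewrite (card_vertices_gunion _ gl) (card_vertices_gunion _ gl').
  rewrite (_ : [fset v in vset A' | _] = [fset v in vset A' | (k < v) && X' v]); last first.
    by apply/fsetP => w; rewrite !inE; apply: andb_id2l => wA; rewrite YA.
  rewrite (_ : [fset v in vset B | Y v] = [fset v in vset B | X v]) ?leq_add2r //.
  by apply/fsetP => w; rewrite !inE; apply: andb_id2l => wB; rewrite YB.
- move=> e x y ix iy; have [eK _] := is_graph_inc (glued_graph gl') ix.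
  move: (eK); rewrite mem_gunion_edge => /orP[eA|eB].
    move: ix iy; rewrite !(inc_gunionl _ gA' gB (gl_edges gl') eA) => ix iy.
    have [_ xA] := is_graph_inc gA' ix; have [_ yA] := is_graph_inc gA' iy.
    by rewrite !YA // !hA //; exact: mono' ix iy.
  move: ix iy; rewrite !(inc_gunionr _ gA' gB (gl_edges gl') eB) => ix iy.
  have [_ xB] := is_graph_inc gB ix; have [_ yB] := is_graph_inc gB iy.
  by rewrite !YB // !hB //; apply: (mono e); rewrite inE ?ix ?iy orbT.
- move: uK; rewrite mem_gunion_vertex; have [uB _|uB] := boolP (u \in vset B).
    by exists u; rewrite hB // YB // mem_gunion_vertex uB orbT.
  rewrite orbF => uA; have [|w [wA Xw cw]] := ht; first by apply/asboolP; exists u.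
  by exists w; rewrite hA // YA // mem_gunion_vertex wA.
- move: vK; rewrite mem_gunion_vertex; have [vB _|vB] := boolP (v \in vset B).
    by exists v; rewrite hB // YB // mem_gunion_vertex vB orbT.
  rewrite orbF => vA; have [|w [wA Xw cw]] := hf; first by apply/asboolP; exists v.
  by exists w; rewrite hA // YA // mem_gunion_vertex wA.
Qed.

Lemma del_vertices_wf G X : is_graph G -> inc_wf (del_vertices G X).
Proof.
move=> gG e v; rewrite !inE /= => /andP[i /andP[eG dis]]; split; first by rewrite eG.
have [_ ->] := is_graph_inc gG i; rewrite andbT.
by move/fdisjointP: dis; apply; rewrite mem_endpoints.
Qed.

Lemma endpoints_pair G e u v : is_graph G -> (e, u) \in inc G -> (e, v) \in inc G -> u != v ->
  endpoints G e = [fset u; v].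
Proof.
move=> gG iu iv uv; have [eG _] := is_graph_inc gG iu; apply/esym/eqP.
rewrite eqEfcard; have -> : #|` endpoints G e| = 2 by case: gG => _; apply.
rewrite cardfs2 uv leqnn andbT; apply/fsubsetP => x; rewrite !inE => /orP[/eqP->|/eqP->].
  by rewrite -mem_endpoints // in iu; move: iu; rewrite !inE.
by rewrite -mem_endpoints // in iv; move: iv; rewrite !inE.
Qed.

(** The hypothesis [u != v] makes [u] and [v] all the endpoints of [e]; for [u = v] the other
    endpoint could lie in [X]. *)
Lemma inc_del_vertices G X e u v : is_graph G -> (e, u) \in inc G -> (e, v) \in inc G -> u != v ->
  u \notin X -> v \notin X -> (e, u) \in inc (del_vertices G X).
Proof.
move=> gG iu iv uv uX vX; rewrite !inE iu /=; have [-> _] := is_graph_inc gG iu.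
rewrite (endpoints_pair gG iu iv uv); apply/fdisjointP => x; rewrite !inE.
by case/orP => /eqP ->.
Qed.

Lemma vconn_le_cut c G : is_graph G -> (at_most c.+1 G \/ vertex_cut_le c G <-> vconn_le c G).
Proof.
move=> gG; rewrite /vconn_le /vertex_connectivity is_max_le; last first.
  move=> i j ij [V1 co]; split=> [|X sX cX]; first exact: leq_ltn_trans ij V1.
  by apply: co => //; exact: leq_trans ij.
split=> [h [V1 co]|h].
  case: h => [|[X [chi [cX mono [u [uG Xu cu]] [v [vG Xv cv]]]]]]; first by rewrite /at_most leqNgt V1.
  pose XX := [fset v in vset G | X v].
  have sX : XX `<=` vset G by apply/fsubsetP => e; rewrite !inE => /andP[].
  apply: (proj2 (not_connectedE (del_vertices_wf gG)) _ (co _ sX cX)); exists chi; split.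
  - move=> e x y ix iy; have [_] := del_vertices_wf gG ix; have [_] := del_vertices_wf gG iy.
    rewrite !inE => /andP[+ yG] /andP[+ xG]; rewrite xG yG /= => Xy Xx.
    by move: ix iy; rewrite !inE /= => /andP[ix _] /andP[iy _]; apply: mono ix iy Xx Xy.
  - by exists u; rewrite // !inE uG Xu.
  - by exists v; rewrite // !inE vG Xv.
have [V1|V1] := leqP #|` vset G| c.+1; [by left|right].
apply: contrapT => nc; apply: h; split=> // X sX cX; apply: contrapT.
move=> /(not_connectedE (del_vertices_wf gG))[chi [mono [u uG cu] [v vG cv]]].
move: uG vG; rewrite !inE => /andP[uX uG] /andP[vX vG].
apply: nc; exists (fun v => v \in X), chi; split; [| |by exists u|by exists v].
  apply: leq_trans (_ : #|` X| <= c) => //; apply: fsubset_leq_card; apply/fsubsetP => e.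
  by rewrite !inE => /andP[].
move=> e x y ix iy xX yX; have [->//|xy] := eqVneq x y.
apply: (mono e); first exact: (inc_del_vertices gG ix iy).
by apply: (inc_del_vertices gG iy ix) => //; rewrite eq_sym.
Qed.

Theorem connected_core : exists A : nat,
     has_core connected (fun beta mu nu delta =>
       [/\ bigO A beta (fun k => k * lg k), exp_bigO A mu beta,
           exp_bigO A nu beta & exp2_bigO A delta beta]).
Proof.
exists 9; apply: (has_core_iff connected_cut).
(* A trace of [k + 1] bits and two flags, the count being 0, give [l = k + 3]: linear in [k], within
   the required [k * lg k]. *)
apply: (has_core_of_set_sig_bigO (iso_invariant_not (@cut_le_inv 0)) (respects_not (@cut_le_respects 0))
  (l := fun k => k + 3)) => // [k|k k0].
  rewrite card_set_type !card_prod card_set_type !card_ord card_bool leq_exp2l //.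
  by rewrite muln1 expnD expnS; lia.
by have := lg_gt0 k; nia.
Qed.

Theorem econn_core : exists A : nat, forall c : nat,
     has_core (econn_le c) (fun beta mu nu delta =>
       [/\ bigO A beta (fun k => lg c + k * lg k), exp_bigO A mu beta,
           exp_bigO A nu beta & exp2_bigO A delta beta]).
Proof.
exists 12 => c; apply: (has_core_iff (@econn_le_cut c)).
apply: (has_core_of_set_sig_bigO (iso_invariant_or (@at_most_inv 1) (@cut_le_inv c))
  (respects_or (@at_most_respects 1) (@cut_le_respects c))
  (l := fun k => lg c + k + 5)) => // [k|k k0].
  rewrite card_prod card_set_type !card_prod card_set_type !card_ord card_bool.
  apply: (@leq_trans (2 ^ (2 + 2 ^ (lg c + k + 4)))).
    rewrite expnD leq_mul // leq_exp2l // -addnA expnD addn4 !expnS.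
    by have := ltn_lg c; rewrite expnS; have := expn_gt0 2 k; rewrite /=; nia.
  rewrite leq_exp2l // [in X in _ <= X]addnS expnS.
  by have := ltn_expl (lg c + k + 4) (ltnSn 1); lia.
by have := lg_gt0 k; nia.
Qed.

Theorem vconn_core : exists A : nat, forall c : nat,
     has_core (vconn_le c) (fun beta mu nu delta =>
       [/\ bigO A beta (fun k => lg c + k * lg k), exp_bigO A mu beta,
           exp_bigO A nu beta & exp2_bigO A delta beta]).
Proof.
exists 14 => c; apply: (has_core_iff (@vconn_le_cut c)).
apply: (has_core_of_set_sig_bigO (iso_invariant_or (@at_most_inv c.+1) (@vertex_cut_le_inv c))
  (respects_or (@at_most_respects c.+1) (@vertex_cut_le_respects c))
  (l := fun k => lg c + 2 * k + 6)) => // [k|k k0].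
  rewrite card_prod card_set_type !card_prod card_set_type !card_ord card_bool.
  (* The vertex count takes [c + 3] values, at most [2 ^ c.+2]; in the second exponent this [c.+2]
     is absorbed by [lg c] and constants. *)
  apply: (@leq_trans (2 ^ (c.+2 + 2 ^ (lg c + 2 * k + 5)))).
    rewrite expnD leq_mul //; first exact: ltn_expl.
    have -> : 2 ^ (lg c + 2 * k + 5) = 2 ^ k * 2 ^ k * (2 ^ (lg c).+1) * 16.
      by rewrite -[16]/(2 ^ 4) -!expnD; congr (_ ^ _); lia.
    by rewrite leq_exp2l // expnS; have := leq_mul (leqnn (2 ^ k * 2 ^ k)) (ltn_lg c); lia.
  rewrite leq_exp2l //= [in X in _ <= X]addnS [X in _ <= X]expnS [X in _ <= X]mul2n -[X in _ <= X]addnn leq_add2r.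
  apply: leq_trans (_ : 2 ^ (lg c).+2 <= _); last by rewrite leq_exp2l //; lia.
  by rewrite expnS; have := ltn_lg c; have := expn_gt0 2 (lg c); rewrite !expnS; lia.
by have := lg_gt0 k; nia.
Qed.

End Cuts.

(** * Minors *)

Section Minor.
Local Open Scope fset_scope.
Local Open Scope nat_scope.

Definition mono_on (chi : nat -> bool) (X : {fset nat}) G : Prop :=
  forall e u v, (e, u) \in inc G -> (e, v) \in inc G -> u \in X -> v \in X -> chi u = chi v.

(** For two vertices of [X] this says that they lie in one component of the subgraph induced by
    [X]. *)
Definition conn_in G (X : {fset nat}) u v : Prop := forall chi, mono_on chi X G -> chi u = chi v.

Definition linked G (X : {fset nat}) : Prop := {in X &, forall u v, conn_in G X u v}.

Lemma conn_in_sym G X u v : conn_in G X u v -> conn_in G X v u.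
Proof. by move=> c chi m; rewrite (c chi m). Qed.

Lemma conn_in_trans G X v u w : conn_in G X u v -> conn_in G X v w -> conn_in G X u w.
Proof. by move=> c d chi m; rewrite (c chi m) (d chi m). Qed.

Lemma conn_in_edge G X e u v : (e, u) \in inc G -> (e, v) \in inc G -> u \in X -> v \in X ->
  conn_in G X u v.
Proof. by move=> iu iv uX vX chi m; exact: m iu iv uX vX. Qed.

Lemma connected_induced G X : is_graph G -> X `<=` vset G -> (connected (induced G X) <-> linked G X).
Proof.
move=> gG sX; have eV : vset (induced G X) = X by rewrite /= fsetDK.
rewrite (connectedE (del_vertices_wf gG)) -/(induced G X) eV.
have monoE chi : monochrome chi (induced G X) <-> mono_on chi X G.
  split=> mono e u v iu iv; last first.
    have [_] := del_vertices_wf gG iu; have [_] := del_vertices_wf gG iv.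
    rewrite -/(induced G X) eV => vX uX; apply: (mono e) => //.
      by move: iu; rewrite !inE /= => /andP[].
    by move: iv; rewrite !inE /= => /andP[].
  move=> uX vX; have [->//|uv] := eqVneq u v.
  apply: (mono e); first by apply: (inc_del_vertices gG iu iv); rewrite // inE ?uX ?vX.
  by apply: (inc_del_vertices gG iv iu); rewrite 1?eq_sym // inE ?uX ?vX.
split=> h; first by move=> u v uX vX chi /monoE/h; apply.
by move=> chi /monoE m u v uX vX; apply: h.
Qed.

Variable H : mgraph.

Definition minor_model (X : nat -> {fset nat}) (g : nat -> nat) G : Prop :=
  [/\ {in vset H, forall x, [/\ X x `<=` vset G, X x != fset0 & linked G (X x)]},
      {in vset H &, forall x y, x != y -> [disjoint X x & X y]%fset},
      {in eset H &, injective g},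
      {in eset H, forall e, g e \in eset G}
    & {in eset H & vset H, forall e x, (e, x) \in inc H ->
         exists2 v, v \in X x & (g e, v) \in inc G}].

Lemma has_minorE G : is_graph G -> (has_minor H G <-> exists X g, minor_model X g G).
Proof.
move=> gG; split=> -[X [g [Xp dis gi gE inc]]]; exists X, g; split=> // x xH;
have [sX X0 co] := Xp x xH; split=> //; exact/(connected_induced gG sX).
Qed.

Lemma minor_inv : iso_invariant (has_minor H).
Proof.
move=> f g G gG fi gi /(has_minorE gG)[X [h [Xp dis hi hE hinc]]].
apply/(has_minorE (is_graph_gimage gG fi gi)); exists (fun x => f @` X x), (fun e => g (h e)); split.
- move=> x xH; have [sX X0 co] := Xp x xH; split.
  + by apply/fsubsetP => _ /imfsetP[v /= vX ->]; apply: in_imfset; apply: (fsubsetP sX).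
  + by have /fset0Pn[v vX] := X0; apply/fset0Pn; exists (f v); apply: in_imfset.
  move=> _ _ /imfsetP[u /= uX ->] /imfsetP[v /= vX ->] chi mono.
  apply: (co u v uX vX (fun w => chi (f w))) => e a b ia ib aX bX.
  have [eG aG] := is_graph_inc gG ia; have [_ bG] := is_graph_inc gG ib.
  by apply: (mono (g e)); rewrite ?inc_gimage // in_imfset.
- move=> x y xH yH xy; apply/fdisjointP => _ /imfsetP[u /= uX ->]; apply/negP => /imfsetP[v /= vX].
  have [/fsubsetP sX _ _] := Xp x xH; have [/fsubsetP sY _ _] := Xp y yH.
  move=> /(fi _ _ (sX _ uX) (sY _ vX)) e.
  by have /fdisjointP/(_ u uX) := dis x y xH yH xy; rewrite e vX.
- by move=> e e' eH e'H /gi; rewrite !hE // => /(_ isT isT); exact: hi.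
- by move=> e eH; apply: in_imfset; exact: hE.
- move=> e x eH xH i; have [v vX iv] := hinc e x eH xH i; exists (f v); first exact: in_imfset.
  by have [eG vG] := is_graph_inc gG iv; rewrite inc_gimage.
Qed.

Definition profile k : finType :=
  ({ffun 'I_k.+1 -> option (vset H)} * {ffun 'I_k.+1 -> 'I_k.+1} * {set vset H} * {set eset H})%type.

(* A partial model inside [A]: the label of an active vertex is the branch set
   containing it, [rep] identifies only active vertices linked inside their part,
   [hit] are the nonempty parts, and [D] the edges of [H] realized in [A]. *)
Definition realizes k (S : {set 'I_k.+1}) (A : mgraph) (p : profile k) (X : nat -> {fset nat})
    (g : nat -> nat) : Prop :=
  let: (lab, rep, hit, D) := p in
  [/\ [/\ forall x : vset H, X (val x) `<=` vset A,
          forall x y : vset H, x != y -> [disjoint X (val x) & X (val y)]%fset,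
          forall (u : 'I_k.+1) (x : vset H), u \in S -> ((u : nat) \in X (val x)) = (lab u == Some x)
        & forall x : vset H, (x \in hit) = (X (val x) != fset0)],
      forall (x : vset H) v, v \in X (val x) ->
        (exists2 u : 'I_k.+1, u \in S /\ (u : nat) \in X (val x) & conn_in A (X (val x)) v u) \/
        ((forall u : 'I_k.+1, u \in S -> (u : nat) \notin X (val x)) /\
         {in X (val x), forall w, conn_in A (X (val x)) v w}),
      forall (x : vset H) (u w : 'I_k.+1), u \in S -> w \in S -> lab u = Some x -> lab w = Some x ->
        rep u = rep w -> conn_in A (X (val x)) u w
    & [/\ forall e : eset H, e \in D -> g (val e) \in eset A,
          forall e e' : eset H, e \in D -> e' \in D -> g (val e) = g (val e') -> e = e'
        & forall (e : eset H) (x : vset H), e \in D -> (val e, val x) \in inc H ->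
            exists2 v, v \in X (val x) & (g (val e), v) \in inc A]].

Definition minor_sig k (S : {set 'I_k.+1}) (A : mgraph) : {set profile k} :=
  [set p | `[< exists X g, realizes S A p X g >]]%SET.

Section Restriction.
Variables (k : nat) (S : {set 'I_k.+1}) (A B : mgraph) (gl : glued S A B).
Variables (X : nat -> {fset nat}) (g : nat -> nat).
Hypothesis mod : minor_model X g (gunion A B).

Definition part x := X x `&` vset A.

(** Colour the vertices of [A] linked to [v] inside the part. If no active vertex is among them, no
    edge of [B] meets this colour class within the branch set, so the class is closed and, the
    branch set being linked, is all of it. *)
Lemma part_linked (x : vset H) v : v \in part (val x) ->
  (exists2 u : 'I_k.+1, u \in S /\ (u : nat) \in part (val x) & conn_in A (part (val x)) v u) \/
  ((forall u : 'I_k.+1, u \in S -> (u : nat) \notin part (val x)) /\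
   {in X (val x), forall w, w \in vset A /\ conn_in A (part (val x)) v w}).
Proof.
move=> vX; have [gA gB dAB _ _ _] := gl; have [Xp _ _ _ _] := mod.
have [_ _ co] := Xp _ (valP x).
have [|no] := lem (exists2 u : 'I_k.+1, u \in S /\ (u : nat) \in part (val x) &
    conn_in A (part (val x)) v u); [by left|right].
pose chi w := `[< w \in vset A /\ conn_in A (part (val x)) v w >].
have mono : mono_on chi (X (val x)) (gunion A B).
  move=> e a b ia ib aX bX; have [eK _] := is_graph_inc (glued_graph gl) ia.
  move: (eK); rewrite mem_gunion_edge => /orP[eA|eB].
    move: ia ib; rewrite !(inc_gunionl _ gA gB dAB eA) => ia ib.
    have [_ aA] := is_graph_inc gA ia; have [_ bA] := is_graph_inc gA ib.
    have ab : conn_in A (part (val x)) a b by apply: (conn_in_edge ia ib); rewrite inE ?aX ?bX.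
    apply/asboolP/asboolP => -[_ c]; split=> //; first exact: conn_in_trans c ab.
    exact: conn_in_trans c (conn_in_sym ab).
  move: ia ib; rewrite !(inc_gunionr _ gA gB dAB eB) => ia ib.
  have [_ aB] := is_graph_inc gB ia; have [_ bB] := is_graph_inc gB ib.
  have chiF w : w \in vset B -> w \in X (val x) -> chi w = false.
    move=> wB wX; apply/negP => /asboolP[wA c]; have [u uS eu] := glued_boundary gl wA wB.
    by apply: no; exists u; rewrite -eu // inE wX.
  by rewrite !chiF.
have chiv : chi v by apply/asboolP; split=> //; move: vX; rewrite inE => /andP[].
have chiX w : w \in X (val x) -> w \in vset A /\ conn_in A (part (val x)) v w.
  move=> wX; apply/asboolP; rewrite -/(chi w) -(co v w _ wX chi mono) //.
  by move: vX; rewrite inE => /andP[].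
split=> // u uS; apply/negP => uX; apply: no; exists u => //.
by have [|//] := chiX u; move: uX; rewrite inE => /andP[].
Qed.

Lemma realizes_restriction : exists p, realizes S A p part g /\
  [/\ forall (u : 'I_k.+1) (x : vset H), u \in S -> (p.1.1.1 u == Some x) = ((u : nat) \in X (val x)),
      forall (x : vset H) (u w : 'I_k.+1), u \in S -> w \in S -> p.1.1.1 u = Some x ->
        p.1.1.1 w = Some x -> conn_in A (part (val x)) u w -> p.1.1.2 u = p.1.1.2 w,
      forall x : vset H, (x \in p.1.2) = (part (val x) != fset0)
    & forall e : eset H, (e \in p.2) = (g (val e) \in eset A)].
Proof.
have [gA gB dAB _ _ _] := gl; have [Xp dis gi gE ginc] := mod.
pose lab : {ffun 'I_k.+1 -> option (vset H)} :=
  [ffun u : 'I_k.+1 => [pick x : vset H | (u : nat) \in X (val x)]].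
have labE (u : 'I_k.+1) (x : vset H) : (lab u == Some x) = ((u : nat) \in X (val x)).
  rewrite ffunE; case: pickP => [y uy|/(_ x) -> //]; apply/eqP/idP => [[<-] //|ux].
  congr Some; apply/val_inj/eqP/negPn/negP => yx.
  by have /fdisjointP/(_ _ uy) := dis _ _ (valP y) (valP x) yx; rewrite ux.
pose r (u w : 'I_k.+1) := `[< exists x : vset H, [/\ w \in S, lab u = Some x, lab w = Some x
    & conn_in A (part (val x)) u w] >].
(* Active vertices linked inside their part have the same predicate [r], so [pick] returns a common
   representative. *)
pose rep : {ffun 'I_k.+1 -> 'I_k.+1} := [ffun u => odflt u [pick w | r u w]].
pose hit : {set vset H} := [set x | part (val x) != fset0]%SET.
pose D : {set eset H} := [set e | g (val e) \in eset A]%SET.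
exists (lab, rep, hit, D); split; last first.
  split=> /=; [by move=> u x _; exact: labE| |by move=> x; rewrite inE|by move=> e; rewrite inE].
  move=> x u w uS wS lu lw c; have rE : r u =1 r w.
    move=> z; apply/asboolP/asboolP => -[y [zS]]; rewrite ?lu ?lw => -[<-] lz c'; exists x; split=> //.
      exact: conn_in_trans (conn_in_sym c) c'.
    exact: conn_in_trans c c'.
  rewrite !ffunE (eq_pick rE); case: pickP => //= /(_ w) /negP[]; apply/asboolP.
  by exists x; split.
split.
- split.
  + by move=> x; apply/fsubsetP => v; rewrite inE => /andP[].
  + move=> x y xy; apply/fdisjointP => v; rewrite !inE => /andP[vx _]; rewrite negb_and.
    by have /fdisjointP/(_ _ vx) -> := dis _ _ (valP x) (valP y) xy.
  + by move=> u x uS; rewrite labE inE (gl_active gl) uS andbT.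
  + by move=> x; rewrite inE.
- move=> x v /part_linked[h|[no h]]; [by left|right]; split=> // w.
  by rewrite inE => /andP[/h[_]].
- move=> x u w uS wS lu lw; rewrite !ffunE.
  have ruu z : z \in S -> lab z = Some x -> r z z by move=> zS lz; apply/asboolP; exists x; split.
  case: pickP => [a ra|/(_ u)]; last by rewrite ruu.
  case: pickP => [b rb|/(_ w)]; last by rewrite ruu.
  move=> /= ab; subst b; case/asboolP: ra => y [aS]; rewrite lu => -[<-] la c.
  case/asboolP: rb => z [_]; rewrite lw => -[<-] _ c'.
  exact: conn_in_trans c (conn_in_sym c').
- split.
  + by move=> e; rewrite inE.
  + by move=> e e' _ _ /gi ee; apply/val_inj/ee; exact: valP.
  + move=> e x; rewrite inE => eA i; have [v vX iv] := ginc _ _ (valP e) (valP x) i; exists v.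
      by rewrite inE vX; move: iv; rewrite inc_gunionl // => /(is_graph_inc gA)[].
    by move: iv; rewrite inc_gunionl.
Qed.

End Restriction.

(** Each branch set keeps its part in [B], and its part in [A] is replaced by the one in [A']; edges
    in [D] are taken from the new partial model, the others already lie in [B]. *)
Lemma minor_respects : respects (has_minor H) minor_sig.
Proof.
move=> k S A A' B gl gl' esig /(has_minorE (glued_graph gl))[X [g mod]].
have [gA gB dAB _ _ _] := gl; have [gA' _ dAB' _ _ _] := gl'.
have [[[[lab rep] hit] D] [re [/= labE repE hitE DE]]] := realizes_restriction gl mod.
have : (lab, rep, hit, D) \in minor_sig S A by rewrite inE; apply/asboolP; exists (part A X), g.
rewrite esig inE => /asboolP[X' [g' [[sX' dX' labX' hitX'] lkX' repX' [gE' gi' ginc']]]].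
have [Xp dis gi gE ginc] := mod.
pose Y x := X' x `|` (X x `&` vset B); pose D' e := if insub e is Some e' then e' \in D else false.
pose h e := if D' e then g' e else g e.
have D'E (e : eset H) : D' (val e) = (e \in D) by rewrite /D' valK.
have hT (e : eset H) : e \in D -> h (val e) = g' (val e) by rewrite /h D'E => ->.
have hF (e : eset H) : e \notin D -> h (val e) = g (val e) by rewrite /h D'E => /negPf ->.
have gB' (e : eset H) : e \notin D -> g (val e) \in eset B.
  rewrite DE => eA; have := gE _ (valP e); rewrite mem_gunion_edge; by rewrite (negPf eA).
have lab_of (x : vset H) (u : 'I_k.+1) : u \in S -> (u : nat) \in X' (val x) = ((u : nat) \in X (val x)).
  by move=> uS; rewrite labX' // labE.
apply/(has_minorE (glued_graph gl')); exists Y, h; split.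
- move=> x0 xH; pose x : vset H := [` xH]; rewrite -[x0]/(val x).
  have [sX X0 co] := Xp _ (valP x); split.
  + apply/fsubsetP => v; rewrite !inE => /orP[/(fsubsetP (sX' x)) -> //|/andP[_ ->]].
    by rewrite orbT.
  + apply/fset0Pn; have [hx|hx] := boolP (x \in hit).
      have := hx; rewrite hitX' => /fset0Pn[v vX]; exists v; by rewrite inE vX.
    have := hx; rewrite hitE negbK => /eqP p0; have /fset0Pn[v vX] := X0; exists v.
    rewrite !inE vX /= (_ : v \in vset B) ?orbT //.
    have := fsubsetP sX _ vX; rewrite mem_gunion_vertex => /orP[vA|//].
    have : v \in part A X (val x) by rewrite inE vX.
    by rewrite p0 inE.
  (* A branch set without active vertices lies entirely on one side, and [hit] tells on which. *)
  have [[u0 u0S u0x]|noS] := lem (exists2 u : 'I_k.+1, u \in S & (u : nat) \in X (val x)); last first.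
    have noS' (u : 'I_k.+1) : u \in S -> (u : nat) \notin X (val x).
      by move=> uS; apply/negP => ux; apply: noS; exists u.
    have [hx|hx] := boolP (x \in hit).
      have := hx; rewrite hitE => /fset0Pn[v vp].
      have [[u [uS ux] _]|[_ XA]] := part_linked gl mod vp.
        by move: (noS' u uS); move: ux; rewrite inE => /andP[->].
      have XB : X (val x) `&` vset B = fset0.
        apply/fsetP => w; rewrite !inE; apply/negP => /andP[wX wB].
        have [wA _] := XA w wX; have [u uS eu] := glued_boundary gl wA wB.
        by have := noS' u uS; rewrite -eu wX.
      rewrite /Y XB fsetU0 => u w uX wX chi mono.
      have [[z [zS zx] _]|[_ lk]] := lkX' x u uX; first by move: (noS' z zS); rewrite -lab_of // zx.
      apply: lk => // e a b ia ib; apply: (mono e).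
        by rewrite inE ia.
      by rewrite inE ib.
    have := hx; rewrite hitX' negbK => /eqP XA0; rewrite /Y XA0 fset0U.
    have := hx; rewrite hitE negbK => /eqP pA0.
    have XB : X (val x) `&` vset B = X (val x).
      apply/fsetIidPl/fsubsetP => v vX; have := fsubsetP sX _ vX; rewrite mem_gunion_vertex => /orP[vA|//].
      have : v \in part A X (val x) by rewrite inE vX.
      by rewrite pA0 inE.
    rewrite XB => u w uX wX chi mono; apply: co => // e a b ia ib aX bX.
    have [eK _] := is_graph_inc (glued_graph gl) ia.
    move: (eK); rewrite mem_gunion_edge => /orP[eA|eB].
      move: ia; rewrite (inc_gunionl _ gA gB dAB eA) => /(is_graph_inc gA)[_ aA].
      have : a \in part A X (val x) by rewrite inE aX.
      by rewrite pA0 inE.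
    move: ia ib; rewrite !(inc_gunionr _ gA gB dAB eB) => ia ib.
    by apply: (mono e) => //; rewrite inE ?ia ?ib orbT.
  move=> a0 b0 a0Y b0Y chi' mono'.
  have monoA' : mono_on chi' (X' (val x)) A'.
    move=> e a b ia ib aX bX; apply: (mono' e); rewrite ?inE ?ia ?ib ?aX ?bX //.
  (* To exploit that the old branch set is linked, the colouring [chi'] of the new one is pulled
     back: a vertex of [A] takes the colour of the active vertices linked to it in its part. These
     colours agree, since equal [rep] forces linkedness in [A']. *)
  pose chi v := if v \in vset A then `[< exists2 u : 'I_k.+1, u \in S /\ (u : nat) \in X (val x) &
      conn_in A (part A X (val x)) v u /\ chi' u >] else chi' v.
  have agree (u w : 'I_k.+1) : u \in S -> w \in S -> (u : nat) \in X (val x) -> (w : nat) \in X (val x) ->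
      conn_in A (part A X (val x)) u w -> chi' u = chi' w.
    move=> uS wS ux wx c; have /eqP lu : lab u == Some x by rewrite labE.
    have /eqP lw : lab w == Some x by rewrite labE.
    exact: (repX' x u w uS wS lu lw (repE x u w uS wS lu lw c)).
  have chiS (u : 'I_k.+1) : u \in S -> (u : nat) \in X (val x) -> chi u = chi' u.
    move=> uS ux; rewrite /chi (gl_active gl) uS; apply/asboolP/idP => [[w [wS wx] [c cw]]|cu].
      by rewrite (agree u w).
    by exists u.
  have chiB v : v \in vset B -> v \in X (val x) -> chi v = chi' v.
    move=> vB vX; have [vA|vA] := boolP (v \in vset A); last by rewrite /chi (negPf vA).
    by have [u uS eu] := glued_boundary gl vA vB; rewrite eu chiS // -eu.
  have mono : mono_on chi (X (val x)) (gunion A B).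
    move=> e a b ia ib aX bX; have [eK _] := is_graph_inc (glued_graph gl) ia.
    move: (eK); rewrite mem_gunion_edge => /orP[eA|eB].
      move: ia ib; rewrite !(inc_gunionl _ gA gB dAB eA) => ia ib.
      have [_ aA] := is_graph_inc gA ia; have [_ bA] := is_graph_inc gA ib.
      have ab : conn_in A (part A X (val x)) a b by apply: (conn_in_edge ia ib); rewrite inE ?aX ?bX.
      rewrite /chi aA bA; apply/asboolP/asboolP => -[u us [c cu]]; exists u => //; split=> //.
        exact: conn_in_trans (conn_in_sym ab) c.
      exact: conn_in_trans ab c.
    move: ia ib; rewrite !(inc_gunionr _ gA gB dAB eB) => ia ib.
    have [_ aB] := is_graph_inc gB ia; have [_ bB] := is_graph_inc gB ib.
    rewrite !chiB //; apply: (mono' e); rewrite !inE ?ia ?ib ?aX ?bX ?aB ?bB ?orbT //.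
  have const w : w \in Y (val x) -> chi' w = chi u0.
    rewrite inE => /orP[wX'|]; last first.
      by rewrite inE => /andP[wX wB]; rewrite -chiB //; apply: co.
    have [[u [uS ux'] c]|[no _]] := lkX' x w wX'; last by have := no u0 u0S; rewrite lab_of // u0x.
    have ux : (u : nat) \in X (val x) by rewrite -lab_of.
    by rewrite (c _ monoA') -chiS //; apply: co.
  by rewrite !const.
- move=> x0 y0 xH yH xy; pose x : vset H := [` xH]; pose y : vset H := [` yH].
  rewrite -[x0]/(val x) -[y0]/(val y).
  have xy' : x != y by rewrite -val_eqE.
  have dX (z : vset H) (t : vset H) v : v \in X' (val z) -> v \in X (val t) -> v \in vset B -> z = t.
    move=> vz vt vB; have vA := fsubsetP (sX' z) _ vz; have [u uS eu] := glued_boundary gl' vA vB.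
    have := labX' u z uS; have := labE u t uS; rewrite -eu vz vt => /eqP -> /esym/eqP[] //.
  apply/fdisjointP => v; rewrite !inE => /orP[vx|/andP[vx vB]]; apply/negP => /orP[vy|/andP[vy vB']].
  + by have /fdisjointP/(_ _ vx) := dX' _ _ xy'; rewrite vy.
  + by case/eqP: xy'; exact: dX vx vy vB'.
  + by case/eqP: xy'; apply/esym; exact: dX vy vx vB.
  + by have /fdisjointP/(_ _ vx) := dis _ _ xH yH xy; rewrite vy.
- move=> e0 e0' eH e'H; pose e : eset H := [` eH]; pose e' : eset H := [` e'H].
  rewrite -[e0]/(val e) -[e0']/(val e'); have [eD|eD] := boolP (e \in D); have [eD'|eD'] := boolP (e' \in D).
  + by rewrite !hT // => /gi' -> //.
  + rewrite hT // hF // => ee; have /fdisjointP/(_ _ (gE' e eD)) := dAB'.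
    by rewrite ee gB'.
  + rewrite hF // hT // => ee; have /fdisjointP/(_ _ (gE' e' eD')) := dAB'.
    by rewrite -ee gB'.
  + by rewrite !hF // => /gi; apply.
- move=> e0 eH; pose e : eset H := [` eH]; rewrite -[e0]/(val e) mem_gunion_edge.
  by have [eD|eD] := boolP (e \in D); [rewrite hT // gE'|rewrite hF // gB' ?orbT].
- move=> e0 x0 eH xH; pose e : eset H := [` eH]; pose x : vset H := [` xH].
  rewrite -[e0]/(val e) -[x0]/(val x) => i; have [eD|eD] := boolP (e \in D).
    by have [v vX iv] := ginc' e x eD i; exists v; rewrite ?inE ?vX // hT // iv.
  have [v vX] := ginc _ _ eH xH i; rewrite (inc_gunionr _ gA gB dAB (gB' e eD)) => iv.
  have [_ vB] := is_graph_inc gB iv; exists v; first by rewrite !inE vX vB orbT.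
  by rewrite hF // inE iv orbT.
Qed.

(** From [h <= n * 2 ^ (h %/ n)]. It bounds the labellings of active vertices by branch sets in such
    a way that [|V(H)|] enters the bitlength additively and not as a factor [lg |V(H)|] of [k]. *)
Lemma expn_le_balance h n : 0 < n -> h ^ n <= n ^ n * 2 ^ h.
Proof.
move=> n0; apply: (@leq_trans ((n * 2 ^ (h %/ n)) ^ n)).
  rewrite leq_exp2r //; have := ltn_expl (h %/ n) (ltnSn 1); rewrite {1}(divn_eq h n).
  by have := ltn_pmod h n0; nia.
by rewrite expnMn leq_mul2l -expnM leq_exp2l // leq_trunc_div orbT.
Qed.

Theorem minor_core_bound : has_core (has_minor H) (fun beta mu nu delta =>
       [/\ bigO 14 beta (fun k => k * lg k + #|` vset H| + #|` eset H|),
           forall k, mu k = 2 ^ beta k,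
           exp_bigO 14 nu beta & exp2_bigO 14 delta beta]).
Proof.
(* One term [(lg k).+1 * k.+1], with [|V(H)| + 1], pays for the labelling, the other for [rep];
   [hit] and [D] cost [|V(H)|] and [|E(H)|]. The constant 14 is attained at [k = 1] for empty
   [H]. *)
have core := has_core_of_set_sig minor_inv minor_respects
  (l := fun k => 2 * ((lg k).+1 * k.+1) + 2 * #|` vset H| + #|` eset H| + 1).
apply: (has_core_weaken (core _)) => [k|beta mu nu delta [eb em nuB deltaB]].
  rewrite card_set_type leq_exp2l // !card_prod !card_set_type !card_ffun card_option !card_ord.
  rewrite -!cardfE.
  have hn := expn_le_balance #|` vset H|.+1 (ltn0Sn k).
  have nn : k.+1 ^ k.+1 <= 2 ^ ((lg k).+1 * k.+1) by exact: lg_exp.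
  apply: (@leq_trans (2 ^ ((lg k).+1 * k.+1) * 2 ^ (#|` vset H|.+1) * 2 ^ ((lg k).+1 * k.+1)
                      * 2 ^ #|` vset H| * 2 ^ #|` eset H|)).
    rewrite !leq_mul2r; apply/orP; right; apply/orP; right; apply: leq_mul => //.
    by apply: leq_trans hn _; rewrite leq_mul2r nn orbT.
  by rewrite -!expnD leq_exp2l //; lia.
split=> //.
- by move=> k k0; rewrite eb; have := lg_gt0 k; nia.
- by move=> k k0; apply: leq_trans (nuB k k0) _; rewrite leq_exp2l //; lia.
- by move=> k k0; apply: leq_trans (deltaB k k0) _; do 2 rewrite leq_exp2l //; lia.
Qed.

End Minor.

(** * Hamiltonian cycles as connected two-factors *)

Section TwoFactor.
Local Open Scope fset_scope.
Local Open Scope nat_scope.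

Definition deg_in (X : {fset nat}) G v : nat := #|` [fset e in X | (e, v) \in inc G]|.

Definition closed_under (X : {fset nat}) G (chi : nat -> bool) : Prop :=
  forall e u v, e \in X -> (e, u) \in inc G -> (e, v) \in inc G -> chi u = chi v.

Definition spans (X : {fset nat}) G : Prop :=
  forall chi, closed_under X G chi -> {in vset G &, forall u v, chi u = chi v}.

(** A degree condition and a connectivity condition: both can be followed across a gluing, unlike
    the cyclic order in [hamiltonian]. *)
Definition two_factor (X : {fset nat}) G : Prop :=
  [/\ X `<=` eset G, {in vset G, forall v, deg_in X G v = 2} & spans X G].

Lemma card2_other (K : choiceType) (A : {fset K}) x : #|` A| = 2 -> x \in A ->
  exists y, [/\ y \in A, y != x & forall z, z \in A -> z = x \/ z = y].
Proof.
move=> cA xA; have := cardfsD1 x A; rewrite xA cA => -[/esym/eqP/cardfs1P[y ey]].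
have inA z : z \in A -> z = x \/ z = y.
  move=> zA; have [->|zx] := eqVneq z x; first by left.
  by right; apply/fset1P; rewrite -ey !inE zx.
have : y \in A `\ x by rewrite ey inE.
by rewrite !inE => /andP[yx yA]; exists y.
Qed.

Section Darts.
Variables (G : mgraph) (X : {fset nat}).
Hypotheses (gG : is_graph G) (tf : two_factor X G).

Definition darts : {fset nat * nat} := [fset p in inc G | p.1 \in X].

Lemma dart_inc (d : darts) : ((val d).1, (val d).2) \in inc G /\ (val d).1 \in X.
Proof. by case: d => -[e v] /=; rewrite !inE => /andP[]. Qed.

Lemma dart_of e v : e \in X -> (e, v) \in inc G -> exists d : darts, val d = (e, v).
Proof.
move=> eX i; have h : (e, v) \in darts by rewrite !inE i.
by exists [` h].
Qed.

Lemma edge_flip_exists (d : darts) : exists d' : darts,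
  [/\ (val d').1 = (val d).1, (val d').2 != (val d).2
    & forall x : darts, (val x).1 = (val d).1 -> x = d \/ x = d'].
Proof.
have [i eX] := dart_inc d; have [eG vG] := is_graph_inc gG i.
have [w [wE wv only]] := card2_other (proj2 gG _ eG) (etrans (mem_endpoints _ _ gG) i).
have iw : ((val d).1, w) \in inc G by rewrite -mem_endpoints.
have [d' ed'] := dart_of eX iw; exists d'; rewrite ed'; split=> // x ex.
have [ix _] := dart_inc x.
have [|h|h] := only (val x).2; first by rewrite mem_endpoints // -ex.
  by left; apply/val_inj; rewrite [LHS]surjective_pairing [RHS]surjective_pairing ex h.
by right; apply/val_inj; rewrite ed' [LHS]surjective_pairing ex h.
Qed.

Lemma vertex_flip_exists (d : darts) : exists d' : darts,
  [/\ (val d').2 = (val d).2, (val d').1 != (val d).1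
    & forall x : darts, (val x).2 = (val d).2 -> x = d \/ x = d'].
Proof.
have [i eX] := dart_inc d; have [eG vG] := is_graph_inc gG i; have [_ deg2 _] := tf.
have [|w [wE wv only]] := card2_other (deg2 _ vG) (x := (val d).1).
  by rewrite !inE eX.
have [wX iw] : w \in X /\ (w, (val d).2) \in inc G by move: wE; rewrite !inE => /andP[].
have [d' ed'] := dart_of wX iw; exists d'; rewrite ed'; split=> // x ex.
have [ix xX] := dart_inc x.
have [|h|h] := only (val x).1; first by rewrite !inE xX -ex.
  by left; apply/val_inj; rewrite [LHS]surjective_pairing [RHS]surjective_pairing ex h.
by right; apply/val_inj; rewrite ed' [LHS]surjective_pairing ex h.
Qed.

(** On the half-edges of [X], [al] changes the end of an edge and [si] the edge at a vertex; [tau],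
    which is [al] followed by [si], walks along the factor. An orbit of [tau] passes each vertex at
    most once, and by connectedness it reaches all of them. *)
Lemma hamiltonian_of_two_factor : vset G != fset0 -> hamiltonian G.
Proof.
move=> V0.
have [al alP] : {al : darts -> darts | forall d, [/\ (val (al d)).1 = (val d).1,
    (val (al d)).2 != (val d).2 & forall x : darts, (val x).1 = (val d).1 -> x = d \/ x = al d]}.
  by have [al alP] := choice edge_flip_exists; exists al.
have [si siP] : {si : darts -> darts | forall d, [/\ (val (si d)).2 = (val d).2,
    (val (si d)).1 != (val d).1 & forall x : darts, (val x).2 = (val d).2 -> x = d \/ x = si d]}.
  by have [si siP] := choice vertex_flip_exists; exists si.
have alK d : al (al d) = d.
  have [e1 n1 o1] := alP d; have [e2 n2 _] := alP (al d).
  by case: (o1 (al (al d))) => [|//|h]; [rewrite e2|move: n2; rewrite h eqxx].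
have siK d : si (si d) = d.
  have [e1 n1 o1] := siP d; have [e2 n2 _] := siP (si d).
  by case: (o1 (si (si d))) => [|//|h]; [rewrite e2|move: n2; rewrite h eqxx].
pose tau d := si (al d).
have tau_inj : injective tau by apply: inj_comp (can_inj siK) (can_inj alK).
(* Peeling one step of [tau] off both ends of a walk from [d] to [si d] reduces
   to a fixed point of [si] or [al]: both darts of a vertex never share an orbit. *)
have no_si m d : iter m tau d <> si d /\ iter m.+1 tau d <> si d.
  elim: m d => [|m IH] d.
    split=> /= h; first by have [_ + _] := siP d; rewrite -h eqxx.
    by have [_ + _] := alP d; rewrite -[al d]siK -/(tau d) h siK eqxx.
  split=> h; first by case: (IH d) => _; apply.
  have [+ _] := IH (tau d); apply; apply: (can_inj alK); apply: (can_inj siK).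
  by rewrite -/(tau _) -iterSr -iterS h /tau siK alK.
have [d0 _] : exists d0 : darts, True.
  have /fset0Pn[v vG] := V0; have [_ deg2 _] := tf.
  have : [fset e in X | (e, v) \in inc G] != fset0 by rewrite -cardfs_gt0 -/(deg_in X G v) deg2.
  by case/fset0Pn => e; rewrite !inE => /andP[eX /(dart_of eX)[d _]]; exists d.
have conn_iter x y : fconnect tau x y -> exists m, y = iter m tau x.
  by move/iter_findex => <-; eexists.
have orbP x y : x \in orbit tau d0 -> y \in orbit tau d0 -> fconnect tau x y.
  rewrite -!fconnect_orbit => c0x c0y; apply: connect_trans c0y.
  by rewrite fconnect_sym.
have orb2 x y : x \in orbit tau d0 -> y \in orbit tau d0 -> (val x).2 = (val y).2 -> x = y.
  move=> xo yo e; have [_ _ o] := siP x; case: (o y) => [//|//|ey].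
  by have [m em] := conn_iter _ _ (orbP _ _ xo yo); case: (no_si m x) => + _; rewrite -em ey.
have tau_orb x : x \in orbit tau d0 -> tau x \in orbit tau d0.
  by rewrite -!fconnect_orbit => c; apply: connect_trans c _; exact: fconnect1.
have orb1 x y : x \in orbit tau d0 -> y \in orbit tau d0 -> (val x).1 = (val y).1 -> x = y.
  move=> xo yo e; have [_ _ o] := alP x; case: (o y) => [//|//|ey].
  have [m em] := conn_iter _ _ (orbP _ _ (tau_orb _ xo) yo).
  by case: (no_si m (tau x)) => + _; rewrite -em ey /tau siK.
pose n := order tau d0.
pose vs := [seq (val d).2 | d <- orbit tau d0]; pose es := [seq (val d).1 | d <- orbit tau d0].
have vsV v : v \in vs -> v \in vset G.
  by case/mapP => d _ ->; have [i _] := dart_inc d; case: (is_graph_inc gG i).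
exists vs, es; split; split.
- by rewrite -size_eq0 size_map size_orbit -lt0n order_gt0.
- by rewrite map_inj_in_uniq ?orbit_uniq // => x y xo yo; exact: orb2.
- move=> v; apply/idP/idP => [/vsV //|vG]; have [_ _ sp] := tf.
  have d0v : (val d0).2 \in vs by apply: map_f; rewrite -fconnect_orbit connect0.
  rewrite -(sp (fun v => v \in vs) _ _ _ (vsV _ d0v) vG) //.
  (* From the half-edge [y] at [u], one of the two edges at [u] leads to the next half-edge of the
     orbit and the other back to the previous one. *)
  have half e u w : e \in X -> (e, u) \in inc G -> (e, w) \in inc G -> u \in vs -> w \in vs.
    move=> eX iu iw /mapP[y yo eu].
    have [x ex] := dart_of eX iu; have [z ez] := dart_of eX iw.
    have [_ _ oal] := alP x; case: (oal z) => [|e1|e1]; first by rewrite ez ex.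
      by move: (congr1 val e1); rewrite ez ex => -[->]; rewrite eu; apply: map_f.
    have [_ _ osi] := siP y; case: (osi x) => [|e2|e2]; first by rewrite ex eu.
      have -> : w = (val (tau y)).2 by rewrite /tau; have [-> _ _] := siP (al y); rewrite -e2 -e1 ez.
      by apply: map_f; exact: tau_orb.
    have -> : w = (val z).2 by rewrite ez.
    apply: map_f; have tz : tau z = y by rewrite /tau e1 alK e2 siK.
    rewrite -fconnect_orbit; apply: (@connect_trans _ _ y); first by rewrite fconnect_orbit.
    by rewrite fconnect_sym // -tz fconnect1.
  by move=> e u w eX iu iw; apply/idP/idP => /= h; [exact: (half e u)|exact: (half e w)].
- by rewrite map_inj_in_uniq ?orbit_uniq // => x y xo yo; exact: orb1.
- by move=> _ /mapP[d _ ->]; have [i _] := dart_inc d; case: (is_graph_inc gG i).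
- by rewrite !size_map.
move=> i; rewrite size_map size_orbit -/n => lt_i.
have n0 : 0 < n by exact: order_gt0.
have nthE j : j < n -> nth d0 (orbit tau d0) j = iter j tau d0 by move=> jn; rewrite nth_traject.
rewrite !(nth_map d0) ?size_orbit ?ltn_mod //.
have -> : nth d0 (orbit tau d0) (i.+1 %% n) = tau (nth d0 (orbit tau d0) i).
  rewrite !nthE ?ltn_mod // -iterS; have [lt|ge] := ltnP i.+1 n; first by rewrite modn_small.
  have -> : i.+1 = n by apply/eqP; rewrite eqn_leq lt_i.
  by rewrite modnn iter_order.
set d := nth _ _ i; have [e1 n1 o1] := alP d; have [e2 _ _] := siP (al d).
rewrite /tau e2; have [ii _] := dart_inc d; have [ii' _] := dart_inc (al d).
by apply: (endpoints_pair gG) => //; [rewrite -e1|rewrite eq_sym].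
Qed.

End Darts.

Lemma two_factor_of_hamiltonian G : is_graph G -> hamiltonian G ->
  vset G != fset0 /\ exists X, two_factor X G.
Proof.
move=> gG [vs [es [[vs0 uvs vsV] [ues esE sz ep]]]].
pose n := size vs; have n0 : 0 < n by rewrite lt0n size_eq0.
have nthV i : i < n -> nth 0 vs i \in vset G by move=> lt; rewrite -vsV mem_nth.
have nthE i : i < n -> nth 0 es i \in eset G by move=> lt; apply/esE; rewrite mem_nth ?sz.
(* A cycle of length 1 would be a loop; length 2, by two parallel edges, remains possible. *)
have n1 : 1 < n.
  rewrite ltn_neqAle n0 andbT; apply/eqP => n1.
  have := proj2 gG _ (nthE 0 n0); rewrite ep // -/n -n1 modnn cardfs2 eqxx //.
have incE i v : i < n -> ((nth 0 es i, v) \in inc G) = (v == nth 0 vs i) || (v == nth 0 vs (i.+1 %% n)).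
  by move=> lt; rewrite -mem_endpoints // ep // !inE.
split; first by apply/fset0Pn; exists (nth 0 vs 0); exact: nthV.
exists [fset e in es]; split.
- by apply/fsubsetP => e; rewrite !inE => /esE.
- move=> v; rewrite -vsV => /(nthP 0)[i lt_i <-]; rewrite -/n in lt_i.
  (* The cyclic predecessor of [i]: the edges at vertex number [i] are those numbered [i] and [j],
     which differ because [1 < n]. *)
  pose j := if i is i'.+1 then i' else n.-1.
  have lt_j : j < n by rewrite /j; case: (i) lt_i => [|i'] ?; lia.
  have jE a : a < n -> (nth 0 vs i == nth 0 vs (a.+1 %% n)) = (a == j).
    move=> lt_a; rewrite nth_uniq ?ltn_mod // /j.
    have [lt|ge] := ltnP a.+1 n; first by rewrite modn_small //; case: (i) lt_i => [|i'] ?; lia.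
    have -> : a.+1 = n by lia.
    by rewrite modnn; case: (i) lt_i => [|i'] ?; lia.
  rewrite /deg_in (_ : [fset e in _ | _] = [fset nth 0 es i; nth 0 es j]).
    rewrite cardfs2 nth_uniq ?sz // (_ : i == j = false) //; apply/eqP.
    by rewrite /j; case: (i) lt_i => [|i'] ?; lia.
  apply/fsetP => e; rewrite !inE; apply/idP/idP.
    move=> /andP[/(nthP 0)[a]]; rewrite sz => lt_a <-; rewrite incE // jE // nth_uniq //.
    by case/orP => [/eqP <-|/eqP ->]; rewrite eqxx ?orbT.
  case/orP => /eqP ->; rewrite mem_nth ?sz // incE //=; first by rewrite eqxx.
  by rewrite jE // eqxx orbT.
- move=> chi cl u v; rewrite -!vsV.
  suff h i : i < n -> chi (nth 0 vs i) = chi (nth 0 vs 0).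
    by move=> /(nthP 0)[i lt_i <-] /(nthP 0)[j lt_j <-]; rewrite !h.
  elim: i => // i IH lt_i; rewrite -IH ?(ltnW lt_i) //.
  apply: (cl (nth 0 es i)); rewrite ?inE ?mem_nth ?sz ?(ltnW lt_i) // incE ?(ltnW lt_i) //.
    by rewrite modn_small // eqxx orbT.
  by rewrite eqxx.
Qed.

Lemma hamiltonianE G : is_graph G ->
  (hamiltonian G <-> vset G != fset0 /\ exists X, two_factor X G).
Proof.
move=> gG; split; first exact: two_factor_of_hamiltonian.
by move=> [V0 [X tf]]; exact: hamiltonian_of_two_factor tf V0.
Qed.

Lemma hamiltonian_inv : iso_invariant hamiltonian.
Proof.
move=> f g G gG fi gi [vs [es [[vs0 uvs vsV] [ues esE sz ep]]]].
exists (map f vs), (map g es); split; split.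
- by rewrite -size_eq0 size_map size_eq0.
- by rewrite map_inj_in_uniq // => x y; rewrite !vsV; exact: fi.
- move=> v; apply/mapP/imfsetP => -[w ww ->]; exists w => //; first by rewrite /= -vsV.
  by rewrite vsV.
- by rewrite map_inj_in_uniq // => x y /esE xE /esE yE; exact: gi.
- by move=> _ /mapP[e /esE eE ->]; exact: in_imfset.
- by rewrite !size_map.
move=> i; rewrite size_map => lt_i; have lt0 : 0 < size vs by exact: leq_ltn_trans lt_i.
rewrite !(nth_map 0) ?sz ?ltn_mod // endpoints_gimage ?ep ?imfset_fset2 //.
by apply: esE; rewrite mem_nth ?sz.
Qed.

End TwoFactor.

(** * Counting cuts modulo 2 *)

Section CutCounting.
Local Open Scope fset_scope.
Local Open Scope nat_scope.

Lemma closed_underU k (S : {set 'I_k.+1}) A B XA XB chi : glued S A B ->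
  XA `<=` eset A -> XB `<=` eset B ->
  (closed_under (XA `|` XB) (gunion A B) chi <-> closed_under XA A chi /\ closed_under XB B chi).
Proof.
move=> [gA gB dAB _ _ _] /fsubsetP sA /fsubsetP sB; split=> [cl|[clA clB] e u v].
  split=> e u v eX iu iv; apply: (cl e); rewrite inE ?eX ?iu ?iv ?orbT //.
rewrite inE => /orP[eX|eX].
  by rewrite !(inc_gunionl _ gA gB dAB (sA _ eX)); exact: clA.
by rewrite !(inc_gunionr _ gA gB dAB (sB _ eX)); exact: clB.
Qed.

Lemma eq_closed_under X G chi chi' : is_graph G -> {in vset G, chi =1 chi'} ->
  closed_under X G chi -> closed_under X G chi'.
Proof.
move=> gG e cl x u v xX iu iv; have [_ uG] := is_graph_inc gG iu; have [_ vG] := is_graph_inc gG iv.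
by rewrite -!e //; exact: cl iu iv.
Qed.

Lemma deg_in_gunion k (S : {set 'I_k.+1}) A B XA XB v : glued S A B ->
  XA `<=` eset A -> XB `<=` eset B ->
  deg_in (XA `|` XB) (gunion A B) v = deg_in XA A v + deg_in XB B v.
Proof.
move=> [gA gB dAB _ _ _] /fsubsetP sA /fsubsetP sB; rewrite /deg_in.
rewrite (_ : [fset e in _ | _] = [fset e in XA | (e, v) \in inc A] `|` [fset e in XB | (e, v) \in inc B]).
  rewrite cardfsU disjoint_fsetI0 ?cardfs0 ?subn0 //.
  apply/fdisjointP => e; rewrite !inE => /andP[/sA eA _]; apply/negP => /andP[/sB eB _].
  by have /fdisjointP/(_ _ eA) := dAB; rewrite eB.
apply/fsetP => e; rewrite in_fset in_fsetU !in_fset !inE /=.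
have [eX|eX] := boolP (e \in XA); have [eY|eY] := boolP (e \in XB); rewrite //= ?orbF.
- by have := inc_gunionl v gA gB dAB (sA _ eX); rewrite inE.
- by have := inc_gunionr v gA gB dAB (sB _ eY); rewrite inE.
Qed.

Lemma deg_in_notin X G v : is_graph G -> v \notin vset G -> deg_in X G v = 0.
Proof.
move=> gG vG; apply/eqP; rewrite cardfs_eq0; apply/eqP/fsetP => e; rewrite !inE.
by apply/negP => /andP[_ /(is_graph_inc gG)[_]]; exact/negP.
Qed.

(** For a vertex [p] there are [2 ^ (n - 1)] of them if [X] has [n] components on the vertices of
    [G]. Without the pin, complementation would make the number even in every nonempty graph. *)
Definition pinned_cuts X G p : {fset {fset nat}} :=
  [fset Y in fpowerset (vset G) | `[< closed_under X G (fun v => v \in Y) >] && (p \in Y)].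

Lemma pinned_cutsP X G p Y : reflect [/\ Y `<=` vset G, closed_under X G (fun v => v \in Y) & p \in Y]
  (Y \in pinned_cuts X G p).
Proof.
rewrite !inE /= fpowersetE; apply: (iffP and3P) => -[sY cl pY]; split=> //; exact/asboolP.
Qed.

(* Exchanging a closed set [Z] avoiding [p] pairs off the pinned cuts. *)
Lemma odd_pinned_cuts X G p : is_graph G -> p \in vset G ->
  (odd #|` pinned_cuts X G p| <-> spans X G).
Proof.
move=> gG pG; split=> [|sp]; last first.
  rewrite (_ : pinned_cuts X G p = [fset vset G]) ?cardfs1 //; apply/fsetP => Y; rewrite !inE /=.
  apply/and3P/eqP => [[]|->].
    rewrite fpowersetE => sY /asboolP cl pY; apply/eqP; rewrite eqEfsubset sY /=.
    by apply/fsubsetP => v vG; have /= := sp _ cl v p vG pG; rewrite pY.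
  rewrite fpowersetE fsubset_refl pG; split=> //; apply/asboolP => e u v _ /(is_graph_inc gG)[_ ->].
  by move=> /(is_graph_inc gG)[_ ->].
apply: contraPP => nsp; apply/negP.
have [chi [cl [q [qG qp]]]] : exists chi, closed_under X G chi /\ exists q, q \in vset G /\ chi q != chi p.
  apply: contrapT => no; apply: nsp => chi cl u v uG vG.
  have eqp w : w \in vset G -> chi w = chi p.
    move=> wG; apply/eqP/negPn/negP => ne; apply: no; exists chi; split=> //; by exists w.
  by rewrite !eqp.
pose Z := [fset w in vset G | chi w != chi p].
pose flip (Y : {fset nat}) := (Y `\` Z) `|` (Z `\` Y).
have mem_flip Y w : (w \in flip Y) = (w \in Y) (+) (w \in Z).
  by rewrite in_fsetU !in_fsetD; case: (w \in Y); case: (w \in Z).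
have flipK : involutive flip.
  by move=> Y; apply/fsetP => w; rewrite !mem_flip -addbA addbb addbF.
have pZ : p \in Z = false by rewrite !inE eqxx andbF.
have qZ : q \in Z by rewrite !inE qG.
have flip_cut Y : Y \in pinned_cuts X G p -> flip Y \in pinned_cuts X G p.
  move=> /pinned_cutsP[sY clY pY]; apply/pinned_cutsP; split.
  - apply/fsubsetP => w; rewrite mem_flip.
    have [wY _|_] := boolP (w \in Y); first exact: (fsubsetP sY).
    by rewrite /= !inE => /andP[].
  - move=> e u v eX iu iv; rewrite !mem_flip (clY e u v eX iu iv) !inE.
    have [_ ->] := is_graph_inc gG iu; have [_ ->] := is_graph_inc gG iv.
    by rewrite (cl e u v eX iu iv).
  - by rewrite mem_flip pZ addbF.
pose P1 := [fset Y in pinned_cuts X G p | q \in Y].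
have P1E Y : (Y \in P1) = (Y \in pinned_cuts X G p) && (q \in Y) by rewrite in_fset.
have -> : pinned_cuts X G p = P1 `|` flip @` P1.
  apply/fsetP => Y; rewrite in_fsetU P1E; apply/idP/orP => [YP|[/andP[]//|]].
    have [qY|qY] := boolP (q \in Y); [by left; rewrite YP|right].
    apply/imfsetP; exists (flip Y); last by rewrite flipK.
    by rewrite /= P1E flip_cut //= mem_flip qZ (negPf qY).
  by case/imfsetP => W /=; rewrite P1E => /andP[/flip_cut + _] ->.
rewrite cardfsU disjoint_fsetI0 ?cardfs0 ?subn0.
  have -> : #|` flip @` P1| = #|` P1| by rewrite card_imfset //; exact: inv_inj.
  by rewrite addnn odd_double.
apply/fdisjointP => Y; rewrite P1E => /andP[_ qY]; apply/negP => /imfsetP[W /=].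
by rewrite P1E => /andP[_ qW] e; move: qY; rewrite e mem_flip qW qZ.
Qed.

Section Boundary.
Variables (k : nat) (S : {set 'I_k.+1}).

Definition cuts X G (c : {set 'I_k.+1}) : {fset {fset nat}} :=
  [fset Y in fpowerset (vset G) | `[< closed_under X G (fun v => v \in Y) >] &&
    [forall u in S, ((u : nat) \in Y) == (u \in c)]].

Lemma cutsP X G (c : {set 'I_k.+1}) Y : reflect [/\ Y `<=` vset G, closed_under X G (fun v => v \in Y)
    & forall u, u \in S -> ((u : nat) \in Y) = (u \in c)] (Y \in cuts X G c).
Proof.
rewrite !inE /= fpowersetE; apply: (iffP and3P) => -[sY cl h]; split=> //.
- exact/asboolP.
- by move=> u uS; have /forallP/(_ u) := h; rewrite uS => /eqP.
- exact/asboolP.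
- by apply/forallP => u; apply/implyP => uS; rewrite h.
Qed.

(** A cut of the glued graph is the same as a pair of cuts with equal traces: the two halves agree
    on the shared vertices, so their union restricts back to each of them. *)
Lemma card_cuts_gunion A B XA XB (c : {set 'I_k.+1}) : glued S A B -> XA `<=` eset A -> XB `<=` eset B ->
  #|` cuts (XA `|` XB) (gunion A B) c| = #|` cuts XA A c| * #|` cuts XB B c|.
Proof.
move=> gl sA sB; have [gA gB dAB _ _ _] := gl.
have unionl Y1 Y2 v : Y1 \in cuts XA A c -> Y2 \in cuts XB B c -> v \in vset A ->
    (v \in Y1 `|` Y2) = (v \in Y1).
  move=> /cutsP[s1 _ c1] /cutsP[s2 _ c2] vA; rewrite inE orb_idr // => vY.
  have [u uS eu] := glued_boundary gl vA (fsubsetP s2 _ vY).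
  by move: vY; rewrite eu c1 ?c2.
have unionr Y1 Y2 v : Y1 \in cuts XA A c -> Y2 \in cuts XB B c -> v \in vset B ->
    (v \in Y1 `|` Y2) = (v \in Y2).
  move=> /cutsP[s1 _ c1] /cutsP[s2 _ c2] vB; rewrite inE orb_idl // => vY.
  have [u uS eu] := glued_boundary gl (fsubsetP s1 _ vY) vB.
  by move: vY; rewrite eu c1 ?c2.
rewrite -(size_allpairs (fun Y1 Y2 : {fset nat} => Y1 `|` Y2)); apply: perm_size.
apply: uniq_perm; first exact: fset_uniq.
  apply: allpairs_uniq; try exact: fset_uniq.
  move=> [Y1 Y2] [Z1 Z2] /allpairsP[[a b] /= [a1 b1 [-> ->]]] /allpairsP[[a' b'] /= [a1' b1' [-> ->]]] e.
  have sub X G Y : Y \in cuts X G c -> Y `<=` vset G by case/cutsP.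
  congr (_, _); apply/fsetP => v; apply/idP/idP => vY.
  - by have vA := fsubsetP (sub _ _ _ a1) _ vY; rewrite -(unionl _ _ _ a1' b1') // -e unionl.
  - by have vA := fsubsetP (sub _ _ _ a1') _ vY; rewrite -(unionl _ _ _ a1 b1) // e unionl.
  - by have vA := fsubsetP (sub _ _ _ b1) _ vY; rewrite -(unionr _ _ _ a1' b1') // -e unionr.
  - by have vA := fsubsetP (sub _ _ _ b1') _ vY; rewrite -(unionr _ _ _ a1 b1) // e unionr.
move=> Y; apply/idP/allpairsP => [/cutsP[sY /(closed_underU _ gl sA sB)[clA clB] cY]|].
  exists (Y `&` vset A, Y `&` vset B); split=> /=.
  - apply/cutsP; split; first exact: fsubsetIr.
      by apply: eq_closed_under clA => // v vA; rewrite inE vA andbT.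
    by move=> u uS; rewrite inE cY // (gl_active gl) uS andbT.
  - apply/cutsP; split; first exact: fsubsetIr.
      by apply: eq_closed_under clB => // v vA; rewrite inE vA andbT.
    by move=> u uS; rewrite inE cY // (gl_sub gl uS) andbT.
  by rewrite -fsetIUr; apply/esym/fsetIidPl.
move=> [[Y1 Y2] /= [Y1c Y2c ->]]; have /cutsP[s1 cl1 c1] := Y1c; have /cutsP[s2 cl2 c2] := Y2c.
apply/cutsP; split; first exact: fsetUSS.
  apply/(closed_underU _ gl sA sB); split.
    by apply: eq_closed_under cl1 => // v vA; rewrite (unionl _ _ _ Y1c Y2c).
  by apply: eq_closed_under cl2 => // v vA; rewrite (unionr _ _ _ Y1c Y2c).
by move=> u uS; rewrite inE c1 // c2 // orbb.
Qed.

Lemma card_pinned_cuts G X (u0 : 'I_k.+1) : u0 \in S ->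
  #|` pinned_cuts X G u0| = \sum_(c : {set 'I_k.+1} | (c \subset S) && (u0 \in c)) #|` cuts X G c|.
Proof.
move=> u0S; pose cut (Y : {fset nat}) : {set 'I_k.+1} := [set u in S | (u : nat) \in Y]%SET.
rewrite card_fset_sum1 big_seq (partition_big cut (fun c : {set 'I_k.+1} => (c \subset S) && (u0 \in c))) /=.
  apply: eq_bigr => c /andP[sc uc].
  rewrite [RHS]card_fset_sum1 [RHS]big_seq.
  rewrite -[LHS]big_filter -[RHS]big_filter; apply: perm_big; apply: uniq_perm.
  - by rewrite filter_uniq ?fset_uniq.
  - by rewrite filter_uniq ?fset_uniq.
  move=> Y; rewrite !mem_filter; apply/andP/andP => [[/andP[YP /eqP eY] _]|[Yc _]].
    suff: Y \in cuts X G c by [].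
    by have /pinned_cutsP[sY cl _] := YP; apply/cutsP; split=> // u uS; rewrite -eY inE uS.
  have /cutsP[sY cl cY] := Yc.
  have YP : Y \in pinned_cuts X G u0.
    by apply/pinned_cutsP; split; rewrite ?cY.
  split=> //; rewrite YP /=; apply/eqP/setP => u; rewrite inE.
  have [uS|uS] := boolP (u \in S); first exact: cY.
  by apply/esym/negbTE; apply: contraNN uS; exact: (subsetP sc).
move=> Y YP; rewrite inE u0S /=; apply/andP; split; first by apply/subsetP => u; rewrite inE => /andP[].
by have /pinned_cutsP[] := YP.
Qed.

End Boundary.

End CutCounting.

(** * Spans of cut vectors over F_2 *)

Section HamiltonianSignature.
Import GRing.Theory.
Local Open Scope fset_scope.
Local Open Scope ring_scope.
Local Open Scope nat_scope.
Variable k : nat.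
Notation N := #|{set 'I_k.+1}|.
Implicit Types (S : {set 'I_k.+1}) (d : {ffun 'I_k.+1 -> 'I_3}).

Definition nth_set (i : 'I_N) : {set 'I_k.+1} := enum_val i.

Definition cut_vector S X G : 'rV['F_2]_N :=
  \row_i (#|` cuts S X G (nth_set i)|%:R)%R.

(** [cuts] sees an index only through its intersection with [S], so indices not contained in [S] are
    zeroed to count each trace once; the condition on [u0] is the pin. *)
Definition cut_functional S X G (u0 : 'I_k.+1) : 'cV['F_2]_N :=
  \col_i (if (nth_set i \subset S) && (u0 \in nth_set i)
          then #|` cuts S X G (nth_set i)|%:R else 0)%R.

Lemma cut_pairing S A B XA XB (u0 : 'I_k.+1) : glued S A B -> XA `<=` eset A -> XB `<=` eset B ->
  u0 \in S -> (cut_vector S XA A *m cut_functional S XB B u0 != 0)%R =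
  odd #|` pinned_cuts (XA `|` XB) (gunion A B) u0|.
Proof.
move=> gl sA sB u0S.
have e : (cut_vector S XA A *m cut_functional S XB B u0)%R 0%R 0%R =
    (#|` pinned_cuts (XA `|` XB) (gunion A B) u0|%:R)%R :> 'F_2.
  rewrite (card_pinned_cuts _ _ u0S) natr_sum mxE.
  rewrite [RHS]big_mkcond /= [RHS](reindex _ (onW_bij _ (enum_val_bij _))).
  apply: eq_bigr => i _; rewrite !mxE -/(nth_set i).
  case: ifP => _; last by rewrite mulr0.
  by rewrite (card_cuts_gunion _ gl sA sB) natrM.
have -> : (cut_vector S XA A *m cut_functional S XB B u0 != 0)%R =
    ((cut_vector S XA A *m cut_functional S XB B u0)%R 0%R 0%R != 0%R).
  congr (~~ _); apply/eqP/eqP => [->|h]; first by rewrite mxE.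
  by apply/matrixP => i j; rewrite !ord1 h mxE.
rewrite e -(dvdn_pcharf (pchar_Fp (isT : prime 2))) dvdn2 negbK //.
Qed.

Definition partial_cycles S A d X : Prop :=
  [/\ X `<=` eset A, forall u : 'I_k.+1, u \in S -> deg_in X A u = d u
    & {in vset A, forall v, k < v -> deg_in X A v = 2}].

Definition partial_vectors S A d : {set 'rV['F_2]_N} :=
  [set v | `[< exists2 X, partial_cycles S A d X & v = cut_vector S X A >]]%SET.

(** A subspace stored as a square matrix generating it, hence in [N ^ 2] bits. *)
Definition cycle_span S A d : 'M['F_2]_N :=
  (<<(\sum_(v in partial_vectors S A d) <<v>>)%MS>>)%MS.

(** A functional vanishing on all vectors of [A'] vanishes on their span, which is also the span for
    [A]. The solution found in [A'] need not have the same cut vector as the one in [A]. *)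
Lemma cycle_span_functional S A A' d (w : 'cV['F_2]_N) v : cycle_span S A d = cycle_span S A' d ->
  v \in partial_vectors S A d -> (v *m w != 0)%R ->
  exists2 v', v' \in partial_vectors S A' d & (v' *m w != 0)%R.
Proof.
move=> e vA vw; apply: contrapT => no.
have sub : (cycle_span S A' d <= kermx w)%MS.
  rewrite /cycle_span genmxE.
  apply/sumsmx_subP => v' v'A; rewrite genmxE; apply/sub_kermxP/eqP.
  by apply/negPn/negP => ne; apply: no; exists v'.
case/negP: vw; apply/eqP/sub_kermxP; apply: submx_trans sub; rewrite -e genmxE.
by apply: (sumsmx_sup v) => //; rewrite genmxE.
Qed.

(** The first two components serve the case of an empty [S], where there is no active vertex to
    pin. *)
Definition ham_sig S A : ('I_2 * bool * {ffun {ffun 'I_k.+1 -> 'I_3} -> 'M['F_2]_N})%type :=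
  (size_sig 0 S A, `[< hamiltonian A >], [ffun d => cycle_span S A d]).

End HamiltonianSignature.

Section HamiltonianGluing.
Local Open Scope fset_scope.
Local Open Scope nat_scope.

Lemma empty_graphE G : is_graph G -> vset G = fset0 -> G = MGraph fset0 fset0 fset0.
Proof.
move=> gG V0; apply: mgraph_eq => //=; apply/fsetP.
  move=> e; rewrite inE; apply/negP => eG; have := proj2 gG e eG.
  by have [x [y [_ + _ _]]] := endpoints2 gG eG; rewrite V0 inE.
by move=> [e v]; rewrite inE; apply/negP => /(is_graph_inc gG)[_]; rewrite V0 inE.
Qed.

Lemma gunion_empty G : gunion G (MGraph fset0 fset0 fset0) = G.
Proof. by case: G => V E I; rewrite /gunion /= !fsetU0. Qed.

Lemma fsubset_split (X Y Z : {fset nat}) : X `<=` Y `|` Z -> X = (X `&` Y) `|` (X `&` Z).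
Proof. by move=> /fsetIidPl h; rewrite -fsetIUr h. Qed.

Lemma hamiltonian_respects : respects hamiltonian ham_sig.
Proof.
move=> k S A A' B gl gl' [esize eham espan] hK.
have [gA gB dAB _ _ _] := gl; have [gA' _ dAB' _ _ _] := gl'.
have empA : (vset A == fset0) = (vset A' == fset0).
  move: esize => /(congr1 val); rewrite /= !inordK ?ltnS ?geq_minr //.
  by rewrite -!cardfs_eq0; lia.
have [V0 [X [sX degX spX]]] := proj1 (hamiltonianE (glued_graph gl)) hK.
pose XA := X `&` eset A; pose XB := X `&` eset B.
have sA : XA `<=` eset A by exact: fsubsetIr.
have sB : XB `<=` eset B by exact: fsubsetIr.
have eX : X = XA `|` XB by exact: fsubset_split.
(* Without active vertices, connectedness of the factor forces one side to be empty. *)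
have [/eqP S0|/set0Pn[u0 u0S]] := boolP (S == set0).
  have noAB v : v \in vset A -> v \in vset B -> False.
    by move=> vA vB; have [u] := glued_boundary gl vA vB; rewrite S0 inE.
  have cl : closed_under X (gunion A B) (fun v => v \in vset A).
    rewrite eX; apply/(closed_underU _ gl sA sB); split=> e u v _.
      by move=> /(is_graph_inc gA)[_ ->] /(is_graph_inc gA)[_ ->].
    move=> /(is_graph_inc gB)[_ uB] /(is_graph_inc gB)[_ vB].
    by apply/idP/idP => vA; [case: (noAB _ vA uB)|case: (noAB _ vA vB)].
  have [A0|/fset0Pn[a aA]] := boolP (vset A == fset0).
    have eA := empty_graphE gA (eqP A0); rewrite empA in A0.
    by rewrite (empty_graphE gA' (eqP A0)) -eA.
  have B0 : vset B = fset0.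
    apply/fsetP => b; rewrite inE; apply/negP => bB.
    have /= := spX _ cl a b; rewrite !mem_gunion_vertex aA bB orbT => /(_ isT isT)/esym.
    by move=> bA; case: (noAB b bA bB).
  move: hK; rewrite (empty_graphE gB B0) !gunion_empty => hA; apply/asboolP; rewrite -eham.
  exact/asboolP.
have dK (u : 'I_k.+1) : u \in S -> deg_in XA A u + deg_in XB B u = 2.
  move=> uS; rewrite -(deg_in_gunion _ gl sA sB) -eX degX // mem_gunion_vertex.
  by rewrite (gl_active gl) uS.
pose d : {ffun 'I_k.+1 -> 'I_3} := [ffun u : 'I_k.+1 => inord (deg_in XA A u)].
have dE (u : 'I_k.+1) : u \in S -> d u = deg_in XA A u :> nat.
  by move=> uS; rewrite ffunE inordK //; have := dK u uS; lia.
have inA : cut_vector S XA A \in partial_vectors S A d.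
  rewrite inE; apply/asboolP; exists XA => //; split=> // [u uS|v vA kv]; first by rewrite dE.
  have := degX v; rewrite mem_gunion_vertex vA eX (deg_in_gunion _ gl sA sB) => /(_ isT).
  by rewrite [deg_in XB B v]deg_in_notin ?addn0 // (glued_inner gl vA) -leqNgt.
have oddK : odd #|` pinned_cuts (XA `|` XB) (gunion A B) u0|.
  by rewrite -eX; apply/odd_pinned_cuts; rewrite ?mem_gunion_vertex ?(gl_active gl) ?u0S //; exact: glued_graph gl.
rewrite -(cut_pairing gl sA sB u0S) in oddK.
have espan_d : cycle_span S A d = cycle_span S A' d by have /ffunP/(_ d) := espan; rewrite !ffunE.
have [v'] := cycle_span_functional espan_d inA oddK.
rewrite inE => /asboolP[XA' [sA' degA' inner] ->]; rewrite (cut_pairing gl' sA' sB u0S) => oddK'.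
have u0A : (u0 : nat) \in vset A' by rewrite (gl_active gl').
apply/(hamiltonianE (glued_graph gl')); split.
  by apply/fset0Pn; exists (u0 : nat); rewrite mem_gunion_vertex u0A.
exists (XA' `|` XB); split; first exact: fsetUSS.
- move=> v; rewrite mem_gunion_vertex (deg_in_gunion _ gl' sA' sB).
  have [vB _|vB] := boolP (v \in vset B); last first.
    rewrite orbF => vA; rewrite [deg_in XB B v]deg_in_notin ?addn0 // inner //.
    by move: vB; rewrite (glued_inner gl' vA) -leqNgt.
  have [vA|vA] := boolP (v \in vset A').
    by have [u uS ->] := glued_boundary gl' vA vB; rewrite degA' // dE // dK.
  rewrite deg_in_notin // add0n.
  have := degX v; rewrite mem_gunion_vertex vB orbT eX (deg_in_gunion _ gl sA sB) => /(_ isT).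
  by rewrite [deg_in XA A v]deg_in_notin // -(glued_same gl gl').
apply/(odd_pinned_cuts _ (glued_graph gl')); last exact: oddK'.
by rewrite mem_gunion_vertex u0A.
Qed.

Theorem hamiltonian_core : exists A : nat,
     has_core hamiltonian (fun beta mu nu delta =>
       [/\ bigO A beta (fun k => k * lg k), exp_bigO A mu id,
           exp_bigO A nu beta & exp2_bigO A delta id]).
Proof.
exists 14; have core := has_core_of_set_sig hamiltonian_inv hamiltonian_respects
  (l := fun k => 4 * k.+1 + 1).
apply: (has_core_weaken (core _)) => [k|beta mu nu delta [eb em nuB deltaB]].
  rewrite !card_prod card_bool card_ord !card_ffun card_mx card_Fp // !card_ord card_set_type card_ord.
  (* Each of the [3 ^ k.+1] degree patterns carries a matrix of [2 ^ k.+1 * 2 ^ k.+1] bits; bounding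
     3 by 4 gives [2 ^ (4 * k.+1)] bits in all, and the first two components add 2. *)
  apply: (@leq_trans (2 ^ (2 + 2 ^ (4 * k.+1)))).
    rewrite expnD leq_mul // -expnM leq_exp2l // mulnC.
    have -> : 2 ^ (4 * k.+1) = 4 ^ k.+1 * (2 ^ k.+1 * 2 ^ k.+1).
      by rewrite -[4]/(2 ^ 2) -expnM -!expnD; congr (_ ^ _); lia.
    by rewrite leq_mul // leq_exp2r.
  rewrite leq_exp2l // addn1 [X in _ <= X]expnS.
  have : 2 ^ 1 <= 2 ^ (4 * k.+1) by rewrite leq_exp2l //; lia.
  by lia.
split=> k k0.
- by rewrite eb; have := lg_gt0 k; nia.
- by rewrite em eb leq_exp2l //; lia.
- by apply: leq_trans (nuB k k0) _; rewrite leq_exp2l //; lia.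
- by apply: leq_trans (deltaB k k0) _; do 2 rewrite leq_exp2l //; rewrite eb; lia.
Qed.

End HamiltonianGluing.

Theorem theorem10 :
  (exists A : nat,
     has_core simple (fun beta mu nu delta =>
       [/\ bigO A beta (fun k => k ^ 2), forall k, mu k = 1,
           exp_bigO A nu beta & exp_bigO A delta beta])) /\
  (exists A : nat, forall c : nat,
     has_core (max_deg_ge c) (fun beta mu nu delta =>
       [/\ bigO A beta (fun k => k * lg c), forall k, mu k = 1,
           exp_bigO A nu beta & exp_bigO A delta beta])) /\
  (exists A : nat, forall c : nat,
     has_core (min_deg_le c) (fun beta mu nu delta =>
       [/\ bigO A beta (fun k => k * lg c), forall k, mu k = 1,
           exp_bigO A nu beta & exp_bigO A delta beta])) /\
  (exists A : nat, forall c : nat,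
     has_core (colorable c) (fun beta mu nu delta =>
       [/\ bigO A beta (fun k => k * lg c), exp_bigO A mu beta,
           exp_bigO A nu beta & exp2_bigO A delta beta])) /\
  (exists A : nat,
     has_core connected (fun beta mu nu delta =>
       [/\ bigO A beta (fun k => k * lg k), exp_bigO A mu beta,
           exp_bigO A nu beta & exp2_bigO A delta beta])) /\
  (exists A : nat, forall c : nat,
     has_core (vconn_le c) (fun beta mu nu delta =>
       [/\ bigO A beta (fun k => lg c + k * lg k), exp_bigO A mu beta,
           exp_bigO A nu beta & exp2_bigO A delta beta])) /\
  (exists A : nat, forall c : nat,
     has_core (econn_le c) (fun beta mu nu delta =>
       [/\ bigO A beta (fun k => lg c + k * lg k), exp_bigO A mu beta,
           exp_bigO A nu beta & exp2_bigO A delta beta])) /\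
  (exists A : nat,
     has_core hamiltonian (fun beta mu nu delta =>
       [/\ bigO A beta (fun k => k * lg k), exp_bigO A mu id,
           exp_bigO A nu beta & exp2_bigO A delta id])) /\
  (exists A : nat, forall m : nat, 0 < m ->
     has_core (nzflow m) (fun beta mu nu delta =>
       [/\ bigO A beta (fun k => k * lg m), exp_bigO A mu beta,
           exp_bigO A nu beta & exp2_bigO A delta beta])) /\
  (exists A : nat, forall H : mgraph, is_graph H ->
     has_core (has_minor H) (fun beta mu nu delta =>
       [/\ bigO A beta (fun k => k * lg k + #|` vset H| + #|` eset H|),
           forall k, mu k = 2 ^ beta k,
           exp_bigO A nu beta & exp2_bigO A delta beta])).
Proof.
split; first exact: simple_core.
split; first exact: max_deg_core.
split; first exact: min_deg_core.
split; first exact: colorable_core.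
split; first exact: connected_core.
split; first exact: vconn_core.
split; first exact: econn_core.
split; first exact: hamiltonian_core.
split; first exact: nzflow_core.
by exists 14 => H _; exact: minor_core_bound.
Qed.
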